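(* Let $\mathbb{K}$ be a commutative field, $n$ a positive integer, $V$ a linear hyperplane of $\operatorname{M}_n(\mathbb{K})$, and $f : V \to V$ a linear automorphism such that $f(V \cap \operatorname{GL}_n(\mathbb{K})) \subset \operatorname{GL}_n(\mathbb{K})$. Then $f$ extends to a Frobenius automorphism of $\operatorname{M}_n(\mathbb{K})$, unless $n=3$, $\mathbb{K} \simeq \mathbb{F}_2$ and $V$ is equivalent to $\mathcal{V}_1(\mathbb{F}_2)$ (i.e. the conclusion is asserted whenever these three conditions do not all hold).
   Context: $\mathcal{V}_1(\mathbb{F}_2)$ is the linear hyperplane of $\operatorname{M}_3(\mathbb{F}_2)$ consisting of all matrices whose $(3,3)$ entry is zero. Two linear subspaces $V,W$ of $\operatorname{M}_n(\mathbb{K})$ are equivalent if $W=PVQ^{-1}$ for some $P,Q\in \operatorname{GL}_n(\mathbb{K})$. A Frobenius automorphism of $\operatorname{M}_n(\mathbb{K})$ is a map of the form $M\mapsto PMQ$ or of the form $M \mapsto PM^TQ$ for some $P,Q\in\operatorname{GL}_n(\mathbb{K})$. *)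

(* Defs.v *)
From HB Require Import structures.
From mathcomp Require Import all_boot all_order all_algebra.

Set Implicit Arguments.
Unset Strict Implicit.
Unset Printing Implicit Defensive.

Import GRing.Theory.
Local Open Scope ring_scope.

Definition hyperplane (K : fieldType) (n : nat) (V : {vspace 'M[K]_n}) : Prop :=
  (\dim V).+1 = \dim {: 'M[K]_n}.

Definition frobenius (K : fieldType) (n : nat) (g : 'M[K]_n -> 'M[K]_n) : Prop :=
  exists P Q : 'M[K]_n,
    [/\ P \in unitmx, Q \in unitmx &
        (forall M, g M = P *m M *m Q) \/ (forall M, g M = P *m M^T *m Q)].

Definition equivalent (K : fieldType) (n : nat) (V W : {vspace 'M[K]_n}) : Prop :=
  exists P Q : 'M[K]_n,
    [/\ P \in unitmx, Q \in unitmx &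
        forall M, M \in W <-> exists2 N, N \in V & M = P *m N *m invmx Q].

Definition entry33 (K : fieldType) (M : 'M[K]_3) : K^o := M ord_max ord_max.

Lemma entry33_is_linear (K : fieldType) : linear (@entry33 K).
Proof. by move=> a M N; rewrite /entry33 !mxE. Qed.

HB.instance Definition _ (K : fieldType) :=
  GRing.isLinear.Build K 'M[K]_3 K^o _ (@entry33 K) (@entry33_is_linear K).

(* Stated over any field K: once K is isomorphic to the two-element field,
   V1 K is the image of V1 'F_2 under any isomorphism. *)
Definition V1 (K : fieldType) : {vspace 'M[K]_3} := lker (linfun (@entry33 K)).

Lemma memV1 (K : fieldType) (M : 'M[K]_3) :
  (M \in V1 K) = (M ord_max ord_max == 0).
Proof. by rewrite memv_ker lfunE. Qed.

Definition isF2 (K : fieldType) : Prop :=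
  exists phi : {rmorphism 'F_2 -> K}, bijective phi.

(* The equation n = 3 is used to transport V to the subspaces of 'M_3. *)
Definition exceptional (K : fieldType) (n : nat) (V : {vspace 'M[K]_n}) : Prop :=
  exists n3 : n = 3,
    isF2 K /\
    equivalent (eq_rect n (fun m => {vspace 'M[K]_m}) V 3 n3) (V1 K).

(* Main.v *)
Require Import Defs.
From HB Require Import structures.
From mathcomp Require Import all_boot all_order all_algebra.
From mathcomp Require Import zify ring.
From Stdlib Require Import Classical.

Set Implicit Arguments.
Unset Strict Implicit.
Unset Printing Implicit Defensive.

Import GRing.Theory.
Local Open Scope ring_scope.

(** Identify the dual of the space of matrices with itself by the trace form, so that
    V = {M | tr (A M) = 0}, and extend f to a linear bijection F with tr (A F(M)) = tr (A M).
    For a column x != 0 the space {M in V | F(M) x = 0} contains no unit and is the orthogonal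
    of a space T of dimension at most n + 1. For n >= 4 such a T contains all the dyads y u for
    some column y != 0, or all the dyads v z for some row z != 0. Hence F(M) x = 0 implies
    M y = 0 (or z M = 0) on V, so that M y = Q F(M) x for a matrix Q. If the sum of a basis x_i
    lies in the image of A, then (F(M) x_1, F(M) x_i) takes all values on V, and comparing the
    factors Q at x_1, x_i and x_1 + x_i gives M P = Q F(M) X for constant invertible P, Q, X
    (or the same with M transposed).

    For n = 3, T may also be a space {N | q N = 0, N c = 0}. If there are more than two
    scalars, then the exceptional x lie in the image of A when A has rank 1, and on a single
    line otherwise; the basis is chosen to avoid them. Over two scalars, with A of rank 2
    or 3, the linear maps preserving units are enumerated. For n = 2 the inverse of F preserves
    singular matrices, and V is a space of symmetric matrices (where the determinant is a
    conic) or of matrices with a zero entry. *)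

(** * Spaces of matrices and the trace form *)

Section Duality.
Variable K : fieldType.

(** Only units are known to be mapped to units, and nothing is given about the image of a singular
    matrix. The spaces attached to columns x turn this into information on all the M in V for which
    F(M) has x in its kernel. The bound n + 1 counts the n independent dyads x u, pulled back by the
    adjoint of F, and A itself. The structure of these spaces T is found by induction on the size. A
    dyad orthogonal to T becomes, in suitable bases, an entry that vanishes on T, and the lower
    right blocks of the orthogonal of T form again a space without units. Coming back to the
    original size costs the inequality dim T < 2 (n - 1), which n + 1 satisfies exactly when n >= 4.
    In the equality case n = 3, a polynomial of degree 2 with the three roots 0, 1 and t is needed,
    which explains the special role of two scalars. The sum of the basis is put in the image of A so
    that no row of the dual basis kills A. For two basis columns, a third dual row q kills both of
    them but not A; adding some c q to F(M) then moves M into V without changing the two values of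
    F(M). *)

Lemma linear_factor (U W W' : vectType K) (T : {vspace U})
    (phi : {linear U -> W}) (psi : {linear U -> W'}) :
    (forall N, N \in T -> phi N = 0 -> psi N = 0) ->
  exists theta : {linear W -> W'}, forall N, N \in T -> psi N = theta (phi N).
Proof.
move=> kers; pose phiT := (linfun phi \o projv T)%VF.
exists (linfun psi \o projv T \o phiT^-1)%VF => N NT.
have phiN : phiT N = phi N by rewrite comp_lfunE lfunE projv_id.
have/limg_lfunVK : phi N \in limg phiT by rewrite -phiN memv_img ?memvf.
set N' := (phiT^-1)%VF _; rewrite comp_lfunE lfunE /= => phiN'.
rewrite comp_lfunE comp_lfunE lfunE -/N' /=.
apply/eqP; rewrite -subr_eq0 -linearB; apply/eqP/kers.
  by rewrite rpredB ?memv_proj.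
by rewrite linearB /= phiN' subrr.
Qed.

Lemma trace_form m n (psi : {linear 'M[K]_(m, n) -> K^o}) :
  exists C : 'M_(n, m), forall N, psi N = \tr (C *m N).
Proof.
exists (\matrix_(j, i) psi (delta_mx i j)) => N.
rewrite {1}[N]matrix_sum_delta linear_sum mxtrace_mulC /mxtrace.
apply: eq_bigr => i _; rewrite linear_sum !mxE; apply: eq_bigr => j _.
by rewrite linearZ /= mxE.
Qed.

Lemma trace_factor (U : vectType K) p q (T : {vspace U})
    (phi : {linear U -> 'M[K]_(p, q)}) (psi : {linear U -> K^o}) :
    (forall N, N \in T -> phi N = 0 -> psi N = 0) ->
  exists C : 'M_(q, p), forall N, N \in T -> psi N = \tr (C *m phi N).
Proof.
move=> /linear_factor[theta thetaE]; have [C CE] := trace_form theta.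
by exists C => N /thetaE ->.
Qed.

Lemma tr_dyad n (x : 'cV[K]_n) (u : 'rV_n) (M : 'M_n) :
  \tr (x *m u *m M) = (u *m M *m x) 0 0.
Proof. by rewrite -mulmxA mxtrace_mulC trace_mx11. Qed.

Lemma tr_delta m n (A : 'M[K]_(m, n)) i j : \tr (A *m delta_mx j i) = A i j.
Proof.
rewrite -(mul_delta_mx (0 : 'I_1)) mulmxA mxtrace_mulC mulmxA trace_mx11.
by rewrite -rowE -colE !mxE.
Qed.

Lemma tr_nondeg m n (A : 'M[K]_(m, n)) : (forall M, \tr (A *m M) = 0) -> A = 0.
Proof. by move=> A0; apply/matrixP => i j; rewrite -tr_delta A0 mxE. Qed.

Definition orth n (T : {vspace 'M[K]_n}) (M : 'M[K]_n) : Prop :=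
  forall N, N \in T -> \tr (N *m M) = 0.

(** [1 - projv E] is a projection with kernel [E]. An entry of it that is nonzero at [N] is the
    required functional. *)
Lemma separation m n (E : {vspace 'M[K]_(m, n)}) (N : 'M_(m, n)) : N \notin E ->
  exists2 C : 'M_(n, m), \tr (C *m N) != 0 & forall X, X \in E -> \tr (C *m X) = 0.
Proof.
move=> NE; pose rho := (\1 - projv E)%VF.
have rhoE X : X \in E -> rho X = 0.
  by move=> XE; rewrite add_lfunE opp_lfunE id_lfunE projv_id // subrr.
have rhoN : rho N != 0.
  apply: contra NE; rewrite add_lfunE opp_lfunE id_lfunE subr_eq0 => /eqP->.
  exact: memv_proj.
have /existsP[i /existsP[j ij]] : [exists i, exists j, rho N i j != 0].
  apply: contraNT rhoN => /existsPn rho0; apply/eqP/matrixP => i j.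
  by have /existsPn/(_ j) := rho0 i; rewrite negbK mxE => /eqP.
pose psi (X : 'M[K]_(m, n)) : K^o := rho X i j.
have psi_lin : linear psi by move=> a X Y; rewrite /psi linearP !mxE.
pose psiL := GRing.isLinear.Build _ _ _ _ psi psi_lin.
pose psi' : {linear 'M[K]_(m, n) -> K^o} := HB.pack psi psiL.
have [C CE] := trace_form psi'; exists C; first by rewrite -CE.
by move=> X XE; rewrite -CE /= /psi rhoE // mxE.
Qed.

Lemma orthK n (T : {vspace 'M[K]_n}) (N : 'M[K]_n) :
  (forall M, orth T M -> \tr (N *m M) = 0) -> N \in T.
Proof.
move=> TN; apply: contraT => /separation[C CN CT].
by rewrite mxtrace_mulC TN ?eqxx // in CN => X XT; rewrite mxtrace_mulC CT.
Qed.

Lemma annihilating_row m (E : {vspace 'cV[K]_m}) : (\dim E < m)%N ->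
  exists2 u : 'rV_m, u != 0 & forall w, w \in E -> u *m w = 0.
Proof.
move=> dimE; have nz : (E^C)%VS != 0%VS.
  by rewrite -dimv_eq0 dimv_compl dimvf dim_matrix mulr1 subn_eq0 -ltnNge.
have /separation[C CN CE] : vpick (E^C)%VS \notin E.
  apply: contra nz => wE; rewrite -vpick0 -memv0 -(capv_compl E) memv_cap wE.
  exact: memv_pick.
exists C => [|w wE]; first by apply: contraNneq CN => ->; rewrite mul0mx mxtrace0.
by rewrite [LHS]mx11_scalar -trace_mx11 CE // raddf0.
Qed.

Lemma delta_entry m n (A : 'M[K]_(m, n)) i j :
  delta_mx 0 i *m A *m delta_mx j 0 = (A i j)%:M :> 'M_1.
Proof. by rewrite -rowE -colE; apply/matrixP=> k l; rewrite !mxE !ord1 mulr1n. Qed.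

Lemma unit_row n (i : 'I_n) (u : 'rV[K]_n) : u != 0 ->
  exists2 U, U \in unitmx & delta_mx 0 i *m U = u.
Proof.
move=> u0; pose f := (const_mx 1 : 'cV[K]_n) *m u.
have fi : delta_mx 0 i *m f = u.
  rewrite mulmxA -rowE; suff -> : row i (const_mx 1 : 'cV[K]_n) = 1 by rewrite mul1mx.
  by apply/matrixP => k l; rewrite !mxE !ord1.
have [|U Uu Uf] := @complete_unitmx _ _ _ (delta_mx 0 i : 'rV[K]_n) f.
  by rewrite fi mxrank_delta rank_rV u0.
by exists U; rewrite // -Uf.
Qed.

Lemma unit_col n (i : 'I_n) (x : 'cV[K]_n) : x != 0 ->
  exists2 X, X \in unitmx & X *m delta_mx i 0 = x.
Proof.
rewrite -(inj_eq trmx_inj) trmx0 => /(unit_row i)[U Uu Ux].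
by exists U^T; rewrite ?unitmx_tr // -[x]trmxK -Ux trmx_mul trmx_delta.
Qed.

Lemma vanish_col m n (M : 'M[K]_(m, n)) : (forall x : 'cV_n, M *m x = 0) -> M = 0.
Proof.
move=> M0; apply/matrixP => i j; have := M0 (delta_mx j 0).
by rewrite -colE => /matrixP/(_ i 0); rewrite !mxE.
Qed.

Lemma nonzero_col m n (M : 'M[K]_(m, n)) : M != 0 -> exists x : 'cV_n, M *m x != 0.
Proof.
move=> M0; apply: NNPP => Mx; case/eqP: M0; apply: vanish_col => x.
by apply/eqP; apply: contraT => Mx0; case: Mx; exists x.
Qed.

Definition equivT n (U X : 'M[K]_n) (T : {vspace 'M[K]_n}) : {vspace 'M[K]_n} :=
  (linfun (mulmx U \o mulmxr X) @: T)%VS.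

Lemma mem_equivT n (U X : 'M[K]_n) (T : {vspace 'M[K]_n}) N : U \in unitmx -> X \in unitmx ->
  (U *m N *m X \in equivT U X T) = (N \in T).
Proof.
move=> Uu Xu; have E N' : linfun (mulmx U \o mulmxr X) N' = U *m N' *m X.
  by rewrite lfunE /= mulmxA.
apply/idP/idP => [|NT]; last by rewrite -E memv_img.
move=> /memv_imgP[N' N'T]; rewrite E => /(canLR (mulmxK Xu))/(canLR (mulKmx Uu)).
by rewrite -!mulmxA mulmxV // mulmx1 mulKmx // => ->.
Qed.

Lemma equivTP n (U X : 'M[K]_n) (T : {vspace 'M[K]_n}) (P : 'M[K]_n -> Prop) :
  U \in unitmx -> X \in unitmx ->
  (forall N, N \in T -> P (U *m N *m X)) <-> (forall N, N \in equivT U X T -> P N).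
Proof.
move=> Uu Xu; split=> PT N NT; last by apply: PT; rewrite mem_equivT.
have NE : N = U *m (invmx U *m N *m invmx X) *m X.
  by rewrite -!mulmxA mulKVmx // mulmxA mulmxKV.
by rewrite NE; apply: PT; rewrite -(mem_equivT T _ Uu Xu) -NE.
Qed.

Lemma dim_equivT n (U X : 'M[K]_n) T : U \in unitmx -> X \in unitmx ->
  \dim (equivT U X T) = \dim T.
Proof.
move=> Uu Xu; apply: limg_dim_eq; apply/eqP; rewrite -subv0; apply/subvP => N.
rewrite memv_cap memv_ker lfunE /= => /andP[_ /eqP/(congr1 (mulmx (invmx U)))].
by rewrite mulKmx // mulmx0 => /(canRL (mulmxK Xu)) ->; rewrite mul0mx mem0v.
Qed.

Lemma tr_equiv n (U N X M : 'M[K]_n) :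
  \tr (U *m N *m X *m M) = \tr (N *m (X *m M *m U)).
Proof. by rewrite -!mulmxA mxtrace_mulC -!mulmxA. Qed.

Lemma orth_equivT n (U X : 'M[K]_n) T M : U \in unitmx -> X \in unitmx ->
  orth (equivT U X T) M <-> orth T (X *m M *m U).
Proof.
move=> Uu Xu; rewrite /orth -(@equivTP _ _ _ _ (fun N => \tr (N *m M) = 0) Uu Xu).
by split=> H N /H; rewrite tr_equiv.
Qed.

Definition corner_emb m (N : 'M[K]_m) : 'M[K]_(1 + m) := block_mx 0 0 0 N.
Lemma corner_emb_linear m : linear (@corner_emb m).
Proof. by move=> a M N; rewrite /corner_emb scale_block_mx add_block_mx !scaler0 !addr0. Qed.
HB.instance Definition _ m := GRing.isLinear.Build K 'M[K]_m 'M[K]_(1 + m) _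
  (@corner_emb m) (@corner_emb_linear m).

Lemma ulsubmx_linear m1 m2 n1 n2 : linear (@ulsubmx K m1 m2 n1 n2).
Proof. by move=> a X Y; apply/matrixP => i j; rewrite !mxE. Qed.
HB.instance Definition _ m1 m2 n1 n2 :=
  GRing.isLinear.Build K _ _ _ (@ulsubmx K m1 m2 n1 n2) (@ulsubmx_linear m1 m2 n1 n2).

Lemma ursubmx_linear m1 m2 n1 n2 : linear (@ursubmx K m1 m2 n1 n2).
Proof. by move=> a X Y; apply/matrixP => i j; rewrite !mxE. Qed.
HB.instance Definition _ m1 m2 n1 n2 :=
  GRing.isLinear.Build K _ _ _ (@ursubmx K m1 m2 n1 n2) (@ursubmx_linear m1 m2 n1 n2).

Lemma dlsubmx_linear m1 m2 n1 n2 : linear (@dlsubmx K m1 m2 n1 n2).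
Proof. by move=> a X Y; apply/matrixP => i j; rewrite !mxE. Qed.
HB.instance Definition _ m1 m2 n1 n2 :=
  GRing.isLinear.Build K _ _ _ (@dlsubmx K m1 m2 n1 n2) (@dlsubmx_linear m1 m2 n1 n2).

Lemma drsubmx_linear m1 m2 n1 n2 : linear (@drsubmx K m1 m2 n1 n2).
Proof. by move=> a X Y; apply/matrixP => i j; rewrite !mxE. Qed.
HB.instance Definition _ m1 m2 n1 n2 :=
  GRing.isLinear.Build K _ _ _ (@drsubmx K m1 m2 n1 n2) (@drsubmx_linear m1 m2 n1 n2).

(** Dual of cutting out the lower right block: when the upper left entry vanishes on [T], the
    orthogonal of this space consists of the lower right blocks of the orthogonal of [T]. *)
Definition corner_space m (T : {vspace 'M[K]_(1 + m)}) : {vspace 'M[K]_m} :=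
  (linfun (@corner_emb m) @^-1: T)%VS.

Lemma mem_corner_space m (T : {vspace 'M[K]_(1 + m)}) N :
  (N \in corner_space T) = (corner_emb N \in T).
Proof. by rewrite -memv_preim lfunE. Qed.

Lemma tr_mul_block m (A A' : 'M[K]_1) B B' C C' (D D' : 'M[K]_m) :
  \tr (block_mx A B C D *m block_mx A' B' C' D') =
  \tr (A *m A') + \tr (B *m C') + \tr (C *m B') + \tr (D *m D').
Proof. by rewrite mulmx_block mxtrace_block !mxtraceD !addrA. Qed.

(** The functional N |-> tr (N M0) - tr (N22 B) vanishes on the elements of [T] reduced to their
    lower right block N22. On [T] it thus depends only on the two off-diagonal blocks, which gives
    [r] and [c]. The entry [a] is free because it only meets the zero upper left entry. *)
Lemma corner_space_lift m (T : {vspace 'M[K]_(1 + m)}) (M0 : 'M[K]_(1 + m)) (B : 'M_m) :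
    (forall N, N \in T -> ulsubmx N = 0) ->
    (forall N, N \in corner_space T -> \tr (N *m B) = \tr (corner_emb N *m M0)) ->
  exists r c, forall a N, N \in T -> \tr (N *m block_mx a r c B) = \tr (N *m M0).
Proof.
move=> T0 TB.
pose psi (N : 'M[K]_(1 + m)) : K^o := \tr (N *m M0) - \tr (drsubmx N *m B).
have psi_lin : linear psi.
  move=> a X Y; rewrite /psi [drsubmx _]linearP !mulmxDl -!scalemxAl !linearP /=.
  by rewrite scalerBr opprD addrACA.
pose psi' : {linear 'M[K]_(1 + m) -> K^o} :=
  HB.pack psi (GRing.isLinear.Build _ _ _ _ psi psi_lin).
pose phi (N : 'M[K]_(1 + m)) := N - corner_emb (drsubmx N).
have phi_lin : linear phi.
  by move=> a X Y; rewrite /phi [drsubmx _]linearP linearP /= scalerBr opprD addrACA.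
pose phi' : {linear 'M[K]_(1 + m) -> 'M[K]_(1 + m)} :=
  HB.pack phi (GRing.isLinear.Build _ _ _ _ phi phi_lin).
have [|C CE] := @trace_factor _ _ _ T phi' psi'.
  move=> N NT /= /eqP; rewrite /phi subr_eq0 => /eqP NE.
  by rewrite /psi TB ?mem_corner_space -NE ?subrr.
exists (ursubmx C), (dlsubmx C) => a N NT.
have := CE N NT; rewrite /= /psi /phi -(submxK N) T0 //.
move: (ursubmx N) (dlsubmx N) (drsubmx N) => n12 n21 n22.
rewrite -{1}(submxK C) /corner_emb block_mxKdr opp_block_mx add_block_mx => /eqP.
rewrite subr_eq => /eqP ->; rewrite !subr0 subrr !tr_mul_block !mulmx0 !mul0mx !mxtrace0.
by rewrite !add0r addr0 (mxtrace_mulC n12) (mxtrace_mulC n21) [X in X + _ = _]addrC.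
Qed.

Lemma dim_corner_space m (T : {vspace 'M[K]_(1 + m)}) (E : {vspace 'M[K]_(1 + m)}) :
    (forall N, N \in corner_space T -> corner_emb N \in E) -> (\dim (corner_space T) <= \dim E)%N.
Proof.
move=> TE; have <- : \dim (linfun (@corner_emb m) @: corner_space T) = \dim (corner_space T).
  apply: limg_dim_eq; apply/eqP; rewrite -subv0; apply/subvP => N.
  rewrite memv_cap memv_ker lfunE /= => /andP[_ /eqP /(congr1 drsubmx)].
  rewrite block_mxKdr linear0 => ->; exact: mem0v.
by apply: dimvS; apply/subvP => _ /memv_imgP[N /TE NE ->]; rewrite lfunE.
Qed.

(** The upper left entry makes the Schur complement of [B] equal to 1. *)
Lemma unit_block m (r : 'rV[K]_m) (c : 'cV_m) (B : 'M_m) : B \in unitmx ->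
  block_mx (1 + r *m invmx B *m c) r c B \in unitmx.
Proof.
move=> Bu; have -> : block_mx (1 + r *m invmx B *m c) r c B =
    block_mx 1%:M (r *m invmx B) 0 1%:M *m block_mx 1%:M 0 c B :> 'M_(1 + m).
  by rewrite mulmx_block !mulmx1 !mul1mx !mulmx0 !add0r mulmxKV.
by rewrite unitmx_mul !unitmxE det_ublock det_lblock !det1 mul1r unitr1 mul1r -unitmxE.
Qed.

Definition kerT n (T : {vspace 'M[K]_n}) (x : 'cV_n) (u : 'rV_n) : {vspace 'M[K]_n} :=
  (T :&: lker (linfun (mulmxr x)) :&: lker (linfun (mulmx u)))%VS.

Lemma mem_kerT n (T : {vspace 'M[K]_n}) x u N :
  (N \in kerT T x u) = [&& N \in T, N *m x == 0 & u *m N == 0].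
Proof. by rewrite !memv_cap !memv_ker !lfunE /= andbA. Qed.

Lemma tr_corner_emb m (N : 'M[K]_m) (M : 'M_(1 + m)) :
  \tr (corner_emb N *m M) = \tr (N *m drsubmx M).
Proof. by rewrite -{1}[M]submxK tr_mul_block !mul0mx !mxtrace0 !add0r. Qed.

(** Bases in which the dyad [x *m u], orthogonal to [T], becomes the upper left matrix unit. An
    element of the new corner space has zero first row and column, so it comes from an element of
    [T] killed by both [x] and [u]. *)
Lemma corner m (T : {vspace 'M[K]_(1 + m)}) (x : 'cV_(1 + m)) (u : 'rV_(1 + m)) :
    x != 0 -> u != 0 -> (forall N, N \in T -> u *m N *m x = 0) ->
  exists U X, [/\ U \in unitmx, X \in unitmx,
    delta_mx 0 (lshift m 0) *m U = u, X *m delta_mx (lshift m 0) 0 = x &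
    (forall N, N \in equivT U X T -> ulsubmx N = 0) /\
    (\dim (corner_space (equivT U X T)) <= \dim (kerT T x u))%N].
Proof.
move=> x0 u0 uTx.
have [U Uu uE] := unit_row (lshift m 0) u0.
have [X Xu xE] := unit_col (lshift m 0) x0.
exists U, X; split=> //; split.
  apply/equivTP => // N /uTx; rewrite -uE -xE => E.
  apply/matrixP => i j; rewrite !mxE !ord1.
  have {}E : delta_mx 0 (lshift m 0) *m (U *m N *m X) *m delta_mx (lshift m 0) 0 = 0 :> 'M_1.
    by rewrite -E !mulmxA.
  by move: E; rewrite delta_entry => /matrixP/(_ 0 0); rewrite !mxE mulr1n.
rewrite -(dim_equivT (kerT T x u) Uu Xu); apply: dim_corner_space => N; rewrite mem_corner_space.
have NE : corner_emb N = U *m (invmx U *m corner_emb N *m invmx X) *m X.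
  by rewrite -!mulmxA mulKVmx // mulmxA mulmxKV.
rewrite NE !mem_equivT // mem_kerT => -> /=; rewrite -uE -xE.
rewrite -!mulmxA mulKmx // mulKVmx // -colE mulmxA -rowE.
have -> : col (lshift m 0) (corner_emb N) = 0.
  by rewrite /corner_emb /block_mx col_col_mx !colKl !col0 col_mx0.
have -> : row (lshift m 0) (corner_emb N) = 0 by rewrite rowKu row_row_mx !row0 row_mx0.
by rewrite mulmx0 mul0mx !eqxx.
Qed.

(** Dieudonne's theorem: an affine space of singular matrices of size m has codimension at least m.
    As dim T is less than the size, T x is a proper subspace for every x, and some dyad is
    orthogonal to T. Choosing x with N0 x != 0 makes the corner space strictly smaller; a unit found
    there is bordered with Schur complement 1. *)
Lemma affine_unit m (T : {vspace 'M[K]_m}) (M0 : 'M_m) : (\dim T < m)%N ->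
  exists2 M, M \in unitmx & forall N, N \in T -> \tr (N *m M) = \tr (N *m M0).
Proof.
elim: m => // m IHm in T M0 *; rewrite ltnS => dimT.
have [T0|T0] := eqVneq T 0%VS.
  exists 1%:M; rewrite ?unitmx1 // => N; rewrite T0 memv0 => /eqP->.
  by rewrite !mul0mx.
pose N0 := vpick T; have /nonzero_col[x N0x] : N0 != 0 by rewrite vpick0.
have x0 : x != 0 by apply: contraNneq N0x => ->; rewrite mulmx0.
have [|u u0 uT] := @annihilating_row _ (linfun (mulmxr x) @: T).
  by rewrite ltnS (leq_trans _ dimT) // -(limg_ker_dim (linfun (mulmxr x)) T) leq_addl.
have uTx N : N \in T -> u *m N *m x = 0.
  by move=> NT; rewrite -mulmxA uT //; apply/memv_imgP; exists N; rewrite // lfunE.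
have [U [X [Uu Xu _ _ [T1 dimred]]]] := corner x0 u0 uTx.
pose M1 : 'M_(1 + m) := invmx X *m M0 *m invmx U.
have [|B Bu BT] := IHm (corner_space (equivT U X T)) (drsubmx M1).
  apply: leq_trans dimT; apply: leq_ltn_trans dimred _.
  rewrite ltn_neqAle dimvS /kerT -?capvA ?capvSl // andbT.
  apply: contraNneq N0x => /eqP; rewrite (eqn_leq _ (\dim T)) => /andP[_ le].
  have : (T <= kerT T x u)%VS.
    by rewrite -(geq_leqif (dimv_leqif_sup _)) /kerT -?capvA ?capvSl.
  by move/subvP/(_ _ (memv_pick T)); rewrite mem_kerT => /and3P[].
have [|r [c /(_ (1 + r *m invmx B *m c)) rcT]] := corner_space_lift T1 (M0 := M1) (B := B).
  by move=> N /BT; rewrite tr_corner_emb.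
exists (X *m block_mx (1 + r *m invmx B *m c) r c B *m U).
  by rewrite !unitmx_mul Xu Uu unit_block.
move=> N NT; rewrite -tr_equiv rcT ?mem_equivT // tr_equiv.
by rewrite /M1 -!mulmxA mulKVmx // mulVmx // mulmx1.
Qed.

End Duality.

(** * Spaces with singular orthogonal *)

Section Singular.
Variable K : fieldType.

Definition sing n (T : {vspace 'M[K]_n}) : Prop :=
  forall M, orth T M -> M \notin unitmx.

Definition dyadic n (T : {vspace 'M[K]_n}) : Prop :=
  (exists2 y : 'cV_n, y != 0 & forall u, y *m u \in T) \/
  (exists2 z : 'rV_n, z != 0 & forall v, v *m z \in T).

Definition trT n (T : {vspace 'M[K]_n}) : {vspace 'M[K]_n} :=
  (linfun (@trmx K n n) @: T)%VS.

Lemma mem_trT n (T : {vspace 'M[K]_n}) N : (N \in trT T) = (N^T \in T).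
Proof.
apply/idP/idP => [/memv_imgP[M MT ->]|NT]; first by rewrite lfunE /= trmxK.
by apply/memv_imgP; exists N^T; rewrite // lfunE /= trmxK.
Qed.

Lemma dim_trT n (T : {vspace 'M[K]_n}) : \dim (trT T) = \dim T.
Proof.
apply: limg_dim_eq; apply/eqP; rewrite -subv0; apply/subvP => N.
rewrite memv_cap memv_ker lfunE /= => /andP[_ /eqP/(congr1 trmx)].
by rewrite trmxK trmx0 => ->; rewrite mem0v.
Qed.

Lemma orth_trT n (T : {vspace 'M[K]_n}) M : orth (trT T) M <-> orth T M^T.
Proof.
split=> TM N; first by rewrite -[N]trmxK -mem_trT => /TM; 
  rewrite -mxtrace_tr trmx_mul mxtrace_mulC.
by rewrite mem_trT => /TM; rewrite -mxtrace_tr trmx_mul !trmxK mxtrace_mulC.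
Qed.

Lemma sing_trT n (T : {vspace 'M[K]_n}) : sing T -> sing (trT T).
Proof. by move=> sT M /orth_trT/sT; rewrite unitmx_tr. Qed.

Lemma dyadic_trT n (T : {vspace 'M[K]_n}) : dyadic (trT T) -> dyadic T.
Proof.
case=> [[y y0 yT]|[z z0 zT]]; [right|left].
  exists y^T => [|v]; first by rewrite -(inj_eq trmx_inj) trmxK trmx0.
  by have := yT v^T; rewrite mem_trT trmx_mul trmxK.
exists z^T => [|v]; first by rewrite -(inj_eq trmx_inj) trmxK trmx0.
by have := zT v^T; rewrite mem_trT trmx_mul trmxK.
Qed.

Lemma sing_equivT n (U X : 'M[K]_n) (T : {vspace 'M[K]_n}) :
  U \in unitmx -> X \in unitmx -> sing T -> sing (equivT U X T).
Proof.
by move=> Uu Xu sT M /(orth_equivT _ _ Uu Xu)/sT; rewrite !unitmx_mul Uu Xu andbT.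
Qed.

Lemma dyadic_equivT n (U X : 'M[K]_n) (T : {vspace 'M[K]_n}) :
  U \in unitmx -> X \in unitmx -> dyadic (equivT U X T) -> dyadic T.
Proof.
move=> Uu Xu [[y y0 yT]|[z z0 zT]]; [left|right].
  exists (invmx U *m y) => [|u].
    by apply: contra y0 => /eqP/(canRL (mulKVmx Uu)) ->; rewrite mulmx0.
  by rewrite -(mem_equivT T _ Uu Xu) !mulmxA mulmxV // mul1mx -mulmxA yT.
exists (z *m invmx X) => [|v].
  by apply: contra z0 => /eqP/(canRL (mulmxKV Xu)) ->; rewrite mul0mx.
by rewrite -(mem_equivT T _ Uu Xu) -!mulmxA mulVmx // mulmx1 mulmxA zT.
Qed.

Lemma corner_space_sing m (T : {vspace 'M[K]_(1 + m)}) :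
  (forall N, N \in T -> ulsubmx N = 0) -> sing T -> sing (corner_space T).
Proof.
move=> T0 sT B BT; apply/negP => Bu.
have [|r [c /(_ (1 + r *m invmx B *m c)) rcT]] := corner_space_lift T0 (M0 := 0) (B := B).
  by move=> N /BT ->; rewrite mulmx0 mxtrace0.
have /sT/negP[] : orth T (block_mx (1 + r *m invmx B *m c) r c B).
  by move=> N /rcT ->; rewrite mulmx0 mxtrace0.
exact: unit_block.
Qed.

Lemma sing_dim n (T : {vspace 'M[K]_n}) : sing T -> (n <= \dim T)%N.
Proof.
move=> sT; rewrite leqNgt; apply/negP => /(affine_unit 0)[M Mu MT].
by have /sT/negP[] : orth T M by move=> N /MT ->; rewrite mulmx0 mxtrace0.
Qed.

(** The dyads [y *m w] with [w] in a hyperplane of rows: this is what a dyadic corner space leaves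
    in [T], up to transposition. *)
Definition almost_col n (T : {vspace 'M[K]_n}) : Prop :=
  exists x y : 'cV_n, [/\ x != 0, y != 0 & forall w, w *m x = 0 -> y *m w \in T].

Lemma dyadic_red m (T : {vspace 'M[K]_(1 + m)}) :
  dyadic (corner_space T) -> almost_col T \/ almost_col (trT T).
Proof.
have col (E : {vspace 'M[K]_(1 + m)}) (y : 'cV_m) : y != 0 ->
    (forall u, corner_emb (y *m u) \in E) -> almost_col E.
  move=> y0 yE; exists (delta_mx (lshift m 0) 0), (col_mx 0 y); split.
  - by apply/eqP => /matrixP/(_ (lshift m 0) 0)/eqP; rewrite !mxE !eqxx oner_eq0.
  - by apply: contra y0 => /eqP; rewrite -col_mx0 => /eq_col_mx[_ ->].
  move=> w; rewrite -colE => w0; have := yE (rsubmx w); rewrite /corner_emb.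
  rewrite -{2}[w](@hsubmxK _ _ 1 m) mul_col_row !mul0mx.
  suff -> : lsubmx w = 0 by rewrite mulmx0.
  by apply/matrixP => i j; rewrite !ord1; move/matrixP/(_ 0 0): w0; rewrite !mxE.
case=> [[y y0 yT]|[z z0 zT]]; [left|right].
  by apply: (col _ y) => // u; rewrite -mem_corner_space.
apply: (col _ z^T) => [|u]; first by rewrite -(inj_eq trmx_inj) trmxK trmx0.
by rewrite mem_trT /corner_emb tr_block_mx !trmx0 trmx_mul trmxK -mem_corner_space.
Qed.

(** In bases where [x] and [y] become the first basis column, the only missing dyad is the upper
    left matrix unit. *)
Lemma almost_col_norm m (T : {vspace 'M[K]_(1 + m)}) : almost_col T ->
  exists U X, [/\ U \in unitmx, X \in unitmx,
    forall w, block_mx 0 w 0 0 \in equivT U X T &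
    block_mx 1%:M 0 0 0 \in equivT U X T -> dyadic T].
Proof.
case=> x [y [x0 y0 wT]].
have [Y Yu yE] := unit_col (lshift m 0) y0; have [X Xu xE] := unit_col (lshift m 0) x0.
have Yu' : invmx Y \in unitmx by rewrite unitmx_inv.
have e0E : delta_mx (lshift m 0) 0 = col_mx 1%:M 0 :> 'cV[K]_(1 + m).
  apply/matrixP => i j; have [k ->|k ->] := split_ordP i.
    by rewrite col_mxEu !mxE !ord1 !eqxx.
  by rewrite col_mxEd !mxE eq_shift.
exists (invmx Y), X; set T1 := equivT _ _ _.
have yT1 (v : 'rV_(1 + m)) :
    (delta_mx (lshift m 0) 0 *m v \in T1) = (y *m (v *m invmx X) \in T).
  rewrite -(mem_equivT T _ Yu' Xu) -yE -/T1; congr (_ \in T1).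
  by rewrite -!mulmxA mulKmx // mulVmx // mulmx1.
have wT1 (v : 'rV_m) : block_mx 0 v 0 0 \in T1.
  have -> : block_mx 0 v 0 0 = delta_mx (lshift m 0) 0 *m row_mx 0 v :> 'M_(1 + m).
    by rewrite e0E mul_col_row !mul1mx !mul0mx.
  by rewrite yT1 wT // -xE mulmxA mulmxKV // e0E mul_row_col mul0mx mulmx0 addr0.
split=> // eT1; left; exists y => // w.
rewrite -[w](mulmxK Xu) -yT1; set v := w *m X.
rewrite -[v](@hsubmxK _ _ 1 m) e0E mul_col_row !mul1mx !mul0mx.
rewrite -[block_mx _ _ _ _]addr0 (_ : block_mx _ _ _ _ =
   (lsubmx v 0 0) *: block_mx 1%:M 0 0 0 + block_mx 0 (rsubmx v) 0 0).
  by rewrite addr0 rpredD ?memvZ.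
rewrite scale_block_mx add_block_mx !scaler0 scale_scalar_mx mulr1 !addr0 add0r.
by rewrite -mx11_scalar.
Qed.

(** For an element of [T] with zero lower left block, the upper right block can be subtracted inside
    [T]. As the upper left matrix unit is not in [T], the upper left entry is then determined by the
    lower right block, through [C0]. Hence a [C] that agrees with [- C0] on [T3] is completed to a
    block triangular element of the orthogonal of [T], which is a unit when [C] is. *)
Lemma corner_functional m (T : {vspace 'M[K]_(1 + m)}) :
    (forall w, block_mx 0 w 0 0 \in T) -> block_mx 1%:M 0 0 0 \notin T ->
  exists C0 (T2 : {vspace 'M_(1 + m)}) (T3 : {vspace 'M_m}),
  [/\ forall N, (N \in T2) = (N \in T) && (dlsubmx N == 0),
     forall X, X \in T3 <-> exists2 N, N \in T2 & X = drsubmx N,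
     (m + \dim T3 <= \dim T2)%N,
     forall N, N \in T2 -> \tr (ulsubmx N) = \tr (C0 *m drsubmx N) &
     forall C, (forall X, X \in T3 -> \tr (X *m C) = - \tr (X *m C0)) ->
       exists r, orth T (block_mx 1%:M r 0 C)].
Proof.
move=> wT eT.
pose dl : {linear 'M[K]_(1 + m) -> 'cV_m} := @dlsubmx K 1 m 1 m.
pose dr : {linear 'M[K]_(1 + m) -> 'M_m} := @drsubmx K 1 m 1 m.
pose ul (N : 'M[K]_(1 + m)) : K^o := \tr (ulsubmx N).
have ul_lin : linear ul.
  by move=> a X Y; rewrite /ul !linearP.
pose ull : {linear 'M[K]_(1 + m) -> K^o} :=
  HB.pack ul (GRing.isLinear.Build _ _ _ _ _ ul_lin).
pose T2 := (T :&: lker (linfun dl))%VS.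
have memT2 N : (N \in T2) = (N \in T) && (dlsubmx N == 0).
  by rewrite memv_cap memv_ker lfunE.
have [|C0 C0E] := @trace_factor K _ _ _ T2 dr ull.
  move=> N; rewrite memT2 => /andP[NT /eqP dl0] /= dr0.
  have := rpredB NT (wT (ursubmx N)); rewrite -{1}[N]submxK dl0 dr0.
  rewrite opp_block_mx add_block_mx !subr0 subrr [ulsubmx N]mx11_scalar -/(ul N).
  have -> : ulsubmx N 0 0 = ul N by rewrite /ul trace_mx11.
  move=> aT; apply/eqP; apply: contraNT eT => a0.
  have := memvZ ((ul N : K)^-1) aT; rewrite scale_block_mx !scaler0 scale_scalar_mx.
  by rewrite mulVf.
pose T3 := (linfun dr @: T2)%VS.
exists C0, T2, T3; split=> // [X||C CE].
- split=> [/memv_imgP[N NT2 ->]|[N NT2 ->]]; first by exists N; rewrite ?lfunE.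
  by apply/memv_imgP; exists N; rewrite ?lfunE.
- rewrite -(limg_ker_dim (linfun dr) T2) leq_add2r.
  pose uremb (w : 'rV[K]_m) : 'M[K]_(1 + m) := block_mx 0 w 0 0.
  have uremb_lin : linear uremb.
    by move=> a v w; rewrite /uremb scale_block_mx add_block_mx !scaler0 !addr0.
  pose uL : {linear 'rV[K]_m -> 'M[K]_(1 + m)} :=
    HB.pack uremb (GRing.isLinear.Build _ _ _ _ _ uremb_lin).
  have dimuL : \dim (linfun uL @: fullv) = m.
    rewrite limg_dim_eq ?dimvf ?dim_matrix ?mul1r //.
    apply/eqP; rewrite -subv0; apply/subvP => w.
    rewrite memv_cap memv_ker lfunE => /andP[_ /eqP /(congr1 ursubmx)].
    rewrite /= block_mxKur => ->; rewrite linear0; exact: mem0v.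
  rewrite -[X in (X <= _)%N]dimuL.
  apply: dimvS; apply/subvP => _ /memv_imgP[w _ ->]; rewrite lfunE /=.
  rewrite memv_cap memT2 memv_ker lfunE /= wT /uremb block_mxKdl block_mxKdr.
  by rewrite !eqxx.
pose psi (N : 'M[K]_(1 + m)) : K^o := - (ul N + \tr (C *m drsubmx N)).
have psi_lin : linear psi.
  move=> a X Y; rewrite /psi ul_lin drsubmx_linear mulmxDr -scalemxAr !linearP /=.
  by rewrite scalerN -opprD; congr (- _); rewrite scalerDr addrACA.
pose psiL : {linear 'M[K]_(1 + m) -> K^o} :=
  HB.pack psi (GRing.isLinear.Build _ _ _ _ _ psi_lin).
have [|r rE] := @trace_factor K _ _ _ T dl psiL.
  move=> N NT /= dl0; have NT2 : N \in T2 by rewrite memT2 NT dl0 eqxx.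
  apply/eqP; rewrite oppr_eq0 addr_eq0; apply/eqP.
  have := C0E N NT2; rewrite /= => ->; rewrite mxtrace_mulC [in RHS]mxtrace_mulC CE ?opprK //.
  by apply/memv_imgP; exists N; rewrite ?lfunE.
exists r => N NT; have := rE N NT; rewrite -{3}[N]submxK tr_mul_block /= /psi.
rewrite mulmx1 mulmx0 mxtrace0 addr0 (mxtrace_mulC r) => <-.
by rewrite /ul (mxtrace_mulC C) opprD addrA subrr sub0r addNr.
Qed.

(** Otherwise [\dim T3 < m], and [affine_unit] provides a unit [C], against [sing T]. For a space of
    dimension n + 1 at size n = m + 1, the bound means n >= 4. *)
Lemma lift_corner m (T : {vspace 'M[K]_(1 + m)}) :
    sing T -> (\dim T < m + m)%N -> (forall w, block_mx 0 w 0 0 \in T) ->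
  block_mx 1%:M 0 0 0 \in T.
Proof.
move=> sT dimT wT; apply: contraT => eT.
have [C0 [T2 [T3 [T2E _ dimT3 _ CT]]]] := corner_functional wT eT.
have [|C Cu CE] := @affine_unit K m T3 (- C0).
  rewrite -(ltn_add2l m); apply: leq_ltn_trans dimT3 (leq_ltn_trans _ dimT).
  by apply: dimvS; apply/subvP => N; rewrite T2E => /andP[].
have [|r /sT/negP[]] := CT C.
  by move=> X /CE ->; rewrite mulmxN raddfN.
by rewrite unitmxE det_ublock det1 mul1r -unitmxE.
Qed.

Lemma dyadic_step m (T : {vspace 'M[K]_(1 + m)}) :
  sing T -> (\dim T < m + m)%N -> dyadic (corner_space T) -> dyadic T.
Proof.
have col (E : {vspace 'M[K]_(1 + m)}) :
    sing E -> (\dim E < m + m)%N -> almost_col E -> dyadic E.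
  move=> sE dimE /almost_col_norm[U [X [Uu Xu wE]]]; apply.
  by apply: lift_corner => //; [apply: sing_equivT|rewrite dim_equivT].
move=> sT dimT /dyadic_red[]; first exact: col.
by move=> /col typT; apply/dyadic_trT/typT; [apply: sing_trT|rewrite dim_trT].
Qed.

Lemma rank1_dyad m n (M : 'M[K]_(m, n)) : (\rank M <= 1)%N ->
  exists x (u : 'rV_n), M = x *m u.
Proof.
rewrite leq_eqVlt ltnS leqn0 mxrank_eq0 => /orP[|/eqP ->]; last first.
  by exists 0, 0; rewrite mul0mx.
move: (col_base M) (row_base M) (mulmx_base M) => C R; move: (\rank M) C R => r C R ME /eqP r1.
by subst r; exists C, R.
Qed.

Lemma det_singular n (M : 'M[K]_n) : M \notin unitmx -> \det M = 0.
Proof. by rewrite unitmxE unitfE negbK => /eqP. Qed.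

(** In bases where a nonzero element of the orthogonal, necessarily of rank 1, is the upper left
    matrix unit, the lower right entry vanishes on the whole orthogonal. The product of the two
    other entries then vanishes too, and a space on which a product of two linear forms is zero lies
    in the kernel of one of them. *)
Lemma sing_dyadic2 (T : {vspace 'M[K]_2}) : sing T -> dyadic T.
Proof.
move=> sT; have [[M [MT M0]]|nM] := classic (exists M, orth T M /\ M <> 0); last first.
  left; exists (const_mx 1) => [|u].
    by apply/eqP => /matrixP/(_ 0 0)/eqP; rewrite !mxE oner_eq0.
  apply: orthK => M MT; suff -> : M = 0 by rewrite mulmx0 mxtrace0.
  by apply: NNPP => M0; apply: nM; exists M.
have : (\rank M <= 1)%N.
  have := rank_leq_row M; rewrite leq_eqVlt ltnS => /orP[|//] fM.
  by have := sT M MT; rewrite -row_free_unit /row_free fM.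
case/rank1_dyad => x [u ME].
have x0 : x != 0 by apply/eqP => x0; apply: M0; rewrite ME x0 mul0mx.
have u0 : u != 0 by apply/eqP => u0; apply: M0; rewrite ME u0 mulmx0.
have uTx N : N \in T -> u *m N *m x = 0.
  move=> /MT; rewrite mxtrace_mulC ME tr_dyad => E.
  by apply/matrixP => i j; rewrite !ord1 E mxE.
have [U [X [Uu Xu _ _ [T0 _]]]] := @corner K 1 T x u x0 u0 uTx.
apply: (dyadic_equivT Uu Xu); move: (sing_equivT Uu Xu sT) T0.
move: (equivT U X T) => {sT MT uTx}T sT T0.
have rT : 1%:M \in corner_space T.
  suff -> : corner_space T = fullv by rewrite memvf.
  apply/eqP; rewrite eqEdim subvf dimvf dim_matrix.
  exact: sing_dim (corner_space_sing T0 sT).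
have o11 M' : orth T M' -> M' ord_max ord_max = 0.
  move=> M'T; have := M'T (corner_emb 1%:M); rewrite -mem_corner_space => /(_ rT).
  rewrite tr_corner_emb mul1mx trace_mx11 !mxE => <-.
  by congr (M' _ _); apply: val_inj.
have o0 M' : orth T M' -> M' ord0 ord_max * M' ord_max ord0 = 0.
  move=> M'T; have /sT/det_singular := M'T.
  rewrite (expand_det_row _ ord0) big_ord_recl big_ord1 /cofactor !det_mx11 !mxE.
  have -> : lift ord0 ord0 = ord_max :> 'I_2 by apply: val_inj.
  have -> : lift (ord_max : 'I_2) ord0 = ord0 by apply: val_inj.
  rewrite o11 // !mulr0 add0r => /eqP.
  by rewrite /= expr1 mulN1r mulrN oppr_eq0 => /eqP.
have [or|nor] := classic (forall M', orth T M' -> M' ord0 ord_max = 0).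
  left; exists (delta_mx ord_max 0) => [|w].
    by apply/eqP => /matrixP/(_ ord_max 0)/eqP; rewrite !mxE !eqxx oner_eq0.
  apply: orthK => M' M'T; rewrite tr_dyad -mulmxA -colE.
  suff -> : col ord_max M' = 0 by rewrite mulmx0 mxE.
  apply/matrixP => i j; rewrite !mxE; case: (unliftP ord_max i) => [k ->|->].
    by rewrite -(or M' M'T); congr (M' _ _); apply: val_inj; rewrite /= ord1.
  exact: o11.
right; exists (delta_mx 0 ord_max) => [|w].
  by apply/eqP => /matrixP/(_ 0 ord_max)/eqP; rewrite !mxE !eqxx oner_eq0.
apply: orthK => M' M'T; rewrite tr_dyad -rowE.
suff -> : row ord_max M' = 0 by rewrite mul0mx mxE.
apply/matrixP => i j; rewrite !mxE; case: (unliftP ord_max j) => [k ->|->]; last exact: o11.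
have -> : lift ord_max k = ord0 by apply: val_inj; rewrite /= ord1.
apply: NNPP => M'0; apply: nor => M2 M2T; apply: NNPP => M20.
have M2' : M2 ord_max ord0 = 0.
  by have /eqP := o0 _ M2T; rewrite mulf_eq0 => /orP[/eqP|/eqP].
have M'' : M' ord0 ord_max = 0.
  by have /eqP := o0 _ M'T; rewrite mulf_eq0 => /orP[/eqP|/eqP].
have /o0/eqP : orth T (M' + M2) by move=> N NT; rewrite mulmxDr linearD /= M'T ?M2T ?addr0.
by rewrite !mxE M'' M2' add0r addr0 mulf_eq0 => /orP[/eqP|/eqP].
Qed.

End Singular.

(** * Dyads orthogonal to a space *)

Section Rank1.
Variable K : fieldType.

Lemma det0_row n (c : 'rV[K]_n) (M : 'M_n) : c != 0 -> c *m M = 0 -> \det M = 0.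
Proof.
move=> c0 cM; apply: det_singular; apply: contra c0 => Mu.
by rewrite -[c](mulmxK Mu) cM mul0mx.
Qed.

Lemma complete_rows p q (R : 'M[K]_(p, p + q)) : row_free R ->
  exists C, col_mx R C \in unitmx.
Proof.
move=> fR; pose f := col_mx R 0 : 'M_(p + q).
have fE : row_mx 1%:M 0 *m f = R by rewrite mul_row_col mul1mx mul0mx addr0.
have [|U Uu UE] := @complete_unitmx _ _ _ (row_mx 1%:M 0 : 'M[K]_(p, p + q)) f.
  by rewrite fE (eqP fR); apply/esym/eqP; apply/row_freeP; exists (col_mx 1%:M 0);
     rewrite mul_row_col mul1mx mul0mx addr0.
exists (dsubmx U); rewrite -fE UE -{1}[U]vsubmxK mul_row_col mul1mx mul0mx addr0.
by rewrite vsubmxK.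
Qed.

Lemma det_col_mx1_linear p (R : 'M[K]_(p, 1 + p)) :
  exists c : 'cV_(1 + p), forall a, \det (col_mx a R) = (a *m c) 0 0.
Proof.
exists (\col_j ((-1) ^+ j * \det (col_mx (0 : 'M_(0, p)) (col' j R)))) => a.
rewrite (expand_det_row _ (lshift p 0)) mxE; apply: eq_bigr => j _.
rewrite col_mxEu mxE /cofactor; congr (_ * (_ * \det _)).
suff -> : col' j (col_mx a R) = col_mx (col' j a) (col' j R).
  by rewrite row'Ku [row' _ _]flatmx0.
by apply/matrixP => i k; rewrite !mxE; case: split => l; rewrite !mxE.
Qed.

(** The first two rows are singled out because the argument varies them alone, using bilinearity in
    [a] and [b]. *)
Definition detR n (a b : 'rV[K]_(2 + n)) (M : 'M_(n, 2 + n)) : K :=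
  \det (col_mx a (col_mx b M)).

Lemma detRE n (X : 'M_(2, 2 + n)) (M : 'M_(n, 2 + n)) :
  \det (col_mx X M) = detR (@usubmx K 1 1 _ X) (@dsubmx K 1 1 _ X) M.
Proof. by rewrite /detR col_mxA castmx_id (@vsubmxK K 1 1). Qed.

Lemma detRDl n (a a' b : 'rV[K]_(2 + n)) (M : 'M_(n, 2 + n)) :
  detR (a + a') b M = detR a b M + detR a' b M.
Proof.
by rewrite /detR; have [c cE] := det_col_mx1_linear (col_mx b M); rewrite !cE mulmxDl mxE.
Qed.

Lemma detR_swap n : exists2 s : K, s != 0 &
  forall (a b : 'rV[K]_(2 + n)) (M : 'M_(n, 2 + n)), detR b a M = s * detR a b M.
Proof.
pose P : 'M[K]_2 := block_mx (0 : 'M_(1, 1)) 1%:M 1%:M (0 : 'M_(1, 1)).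
have PP : P *m P = 1%:M.
  rewrite /P (@mulmx_block _ 1 1 1 1 1 1) !mulmx0 !mulmx1 !add0r !addr0 -scalar_mx_block.
  by [].
have [Pu _] := mulmx1_unit PP.
exists (\det P) => [|a b M]; first by rewrite -unitfE -unitmxE.
have -> : detR b a M = \det (block_mx P 0 0 1%:M *m col_mx (col_mx a b) M).
  rewrite (@mul_block_col _ 2 n 2 n) !mul0mx mul1mx add0r addr0.
  rewrite (@mul_block_col _ 1 1 1 1) !mul0mx !mul1mx.
  by rewrite add0r addr0 /detR col_mxA castmx_id.
by rewrite det_mulmx det_ublock det1 mulr1 /detR col_mxA castmx_id.
Qed.

Lemma detRDr n (a b b' : 'rV[K]_(2 + n)) (M : 'M_(n, 2 + n)) :
  detR a (b + b') M = detR a b M + detR a b' M.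
Proof. by have [s _ sE] := detR_swap n; rewrite !(sE _ a) detRDl mulrDr. Qed.

Lemma detR_repeatr n (a b : 'rV[K]_(2 + n.+1)) (M : 'M_(n, 2 + n.+1)) :
  detR a b (col_mx b M) = 0.
Proof.
rewrite /detR; apply: (@det0_row _ (row_mx (0 : 'rV_1) (row_mx 1%:M (row_mx (-1%:M) (0 : 'rV_n))))).
  apply/eqP => /matrixP/(_ 0 (rshift 1 (lshift n.+1 0)))/eqP.
  by rewrite row_mxEr row_mxEl !mxE eqxx oner_eq0.
by rewrite !mul_row_col !mul0mx mul1mx mulNmx mul1mx addr0 add0r subrr.
Qed.

Lemma detR_repeatl n (a b : 'rV[K]_(2 + n.+1)) (M : 'M_(n, 2 + n.+1)) :
  detR b a (col_mx b M) = 0.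
Proof. by have [s _ ->] := detR_swap n.+1; rewrite detR_repeatr mulr0. Qed.

Lemma detR_independent n (u w v : 'rV[K]_(2 + n.+1)) :
    row_free (col_mx u w) -> ~~ (v <= col_mx u w)%MS ->
  exists M : 'M_(n, 2 + n.+1), detR v w (col_mx u M) != 0.
Proof.
move=> fuw vuw.
have fR : row_free (col_mx v (col_mx w u)).
  apply: inj_row_free => c.
  rewrite -[c](@hsubmxK _ _ 1 2) mul_row_col; move: (lsubmx c) (rsubmx c) => c0 c'.
  rewrite -[c'](@hsubmxK _ _ 1 1) mul_row_col; move: (lsubmx c') (rsubmx c') => c1 c2 E.
  have c00 : c0 = 0.
    apply/eqP; apply: contraNT vuw => c0n; apply/submxP.
    have c0u : c0 \in unitmx.
      rewrite unitmxE det_mx11 unitfE; apply: contra c0n => /eqP c00.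
      by rewrite [c0]mx11_scalar c00 raddf0.
    exists (invmx c0 *m (- row_mx c2 c1)).
    rewrite -mulmxA -[v](mulKmx c0u); congr (_ *m _); apply/eqP.
    by rewrite mulNmx mul_row_col -addr_eq0 (addrC (c2 *m u)) E.
  move: E; rewrite c00 mul0mx add0r addrC -mul_row_col => /(congr1 (mulmxr (pinvmx (col_mx u w)))).
  rewrite /= -mulmxA mulmxVp // mulmx1 mul0mx => /eqP; rewrite -row_mx0.
  by move=> /eqP/eq_row_mx[-> ->]; rewrite !row_mx0.
have [M Mu] := @complete_rows 3 n _ fR.
exists M; rewrite /detR -unitfE -unitmxE; move: Mu.
by rewrite (@col_mxA K 1 1 n _ w) castmx_id (@col_mxA K 1 2 n _ v) castmx_id.
Qed.

Lemma annihilator_dim m n (E : {vspace 'M[K]_(m, n)}) :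
  exists2 F : {vspace 'M[K]_(n, m)}, (m * n <= \dim F + \dim E)%N &
    forall M, M \in F <-> forall X, X \in E -> \tr (X *m M) = 0.
Proof.
pose b := vbasis E; pose phi (M : 'M[K]_(n, m)) := \row_(i < \dim E) \tr (b`_i *m M).
have phi_lin : linear phi.
  by move=> a M N; apply/matrixP => i j; rewrite !mxE mulmxDr -scalemxAr linearP.
pose phiL : {linear 'M[K]_(n, m) -> 'rV_(\dim E)} :=
  HB.pack phi (GRing.isLinear.Build _ _ _ _ _ phi_lin).
exists (lker (linfun phiL)) => [|M].
  have <- : \dim {: 'M[K]_(n, m)} = (m * n)%N by rewrite dimvf dim_matrix mulnC.
  rewrite -(limg_ker_dim (linfun phiL) fullv) capfv leq_add2l.
  by rewrite (leq_trans (dimvS (subvf _))) // dimvf dim_matrix mul1r.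
rewrite memv_ker lfunE /=; split=> [/eqP/matrixP phi0 X XE | ME].
  rewrite (coord_vbasis XE) mulmx_suml linear_sum big1 // => i _.
  by rewrite -scalemxAl linearZ /=; have := phi0 0 i; rewrite !mxE => ->; rewrite mulr0.
apply/eqP/matrixP => i j; rewrite !mxE ME //; apply: vbasis_mem; apply: mem_nth.
by rewrite size_tuple.
Qed.

Lemma dyad_eq0 m n (h : 'cV[K]_m) (r : 'rV_n) : h != 0 -> h *m r = 0 -> r = 0.
Proof.
move=> h0 hr; have /existsP[i hi] : [exists i, h i 0 != 0].
  apply: contraNT h0 => /existsPn h0; apply/eqP/matrixP => i j.
  by rewrite !ord1 mxE; apply/eqP; rewrite -[_ == _]negbK h0.
apply/matrixP => k j; rewrite !ord1; move/matrixP/(_ i j)/eqP: hr.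
by rewrite !mxE big_ord1 mulf_eq0 (negPf hi) => /eqP.
Qed.

Lemma dyad_eq0r m n (v : 'cV[K]_m) (c : 'rV_n) : c != 0 -> v *m c = 0 -> v = 0.
Proof.
rewrite -(inj_eq trmx_inj) trmx0 => c0 /(congr1 trmx); rewrite trmx_mul trmx0.
by move/(dyad_eq0 c0)/(congr1 trmx); rewrite trmxK trmx0.
Qed.

Lemma col_mx_swap n (a b : 'rV[K]_n) : (col_mx a b :=: col_mx b a)%MS.
Proof.
apply: eqmx_trans (eqmx_sym (addsmxE a b)) _.
by apply: eqmx_trans (addsmxE b a); rewrite addsmxC; apply: eqmx_refl.
Qed.

Lemma col_mx_flat n (z : 'rV[K]_n) (M : 'M_(0, n)) : col_mx z M = z :> 'M_(1, n).
Proof.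
apply/matrixP => i j; rewrite !mxE; case: splitP => [l _|[]//].
by rewrite !ord1.
Qed.

Lemma row_mx10 : (row_mx 1%:M 0 : 'rV[K]_(1 + 1)) != 0.
Proof.
apply/eqP; rewrite -row_mx0 => /eq_row_mx[/matrixP/(_ 0 0)/eqP].
by rewrite !mxE oner_eq0.
Qed.

Lemma row_mx01 : (row_mx 0 1%:M : 'rV[K]_(1 + 1)) != 0.
Proof.
apply/eqP; rewrite -row_mx0 => /eq_row_mx[_ /matrixP/(_ 0 0)/eqP].
by rewrite !mxE oner_eq0.
Qed.

(* F is the space of the X such that (X; 0) is orthogonal to T. For (M1; M2) orthogonal to T,
   det (M1 + X; M2) vanishes for all X in F; comparing the terms of degree 2 in X shows
   that all the elements of F have their rows in the row space of a single X0, so that F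
   is too large unless n = 3. *)
Lemma rank1_core k (T : {vspace 'M[K]_(2 + k.+1)}) :
    (\dim T <= k.+4)%N -> sing T ->
    (forall N, N \in T -> lsubmx N = 0 -> N = 0) ->
  exists (x : 'cV_(2 + k.+1)) (u : 'rV_(2 + k.+1)),
    [/\ x != 0, u != 0 & forall N, N \in T -> u *m N *m x = 0].
Proof.
move=> dimT sT T0; apply: NNPP => nr.
pose ls : {linear 'M[K]_(2 + k.+1) -> 'M_(2 + k.+1, 2)} := @lsubmx K (2 + k.+1) 2 k.+1.
have [F dimF FP] := annihilator_dim (linfun ls @: T).
have {}FP M1 : M1 \in F <-> orth T (col_mx M1 0).
  rewrite FP; split=> M1T N => [NT|/memv_imgP[N' N'T ->]]; last first.
    by have := M1T N' N'T; rewrite -{1}[N']hsubmxK mul_row_col mulmx0 addr0 lfunE.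
  rewrite -{1}[N]hsubmxK mul_row_col mulmx0 addr0 -[lsubmx N]/(ls N) M1T //.
  by apply/memv_imgP; exists N; rewrite ?lfunE.
have {}dimF : (k.+2 <= \dim F)%N.
  have le : (\dim (linfun ls @: T) <= k.+4)%N.
    by rewrite (leq_trans _ dimT) // -(limg_ker_dim (linfun ls) T) leq_addl.
  by have := leq_trans dimF (leq_add (leqnn _) le); lia.
(* A rank 1 element of [F], bordered by zero rows, would be a dyad orthogonal to [T]. *)
have freeF X : X \in F -> X != 0 -> row_free X.
  move=> XF X0; rewrite /row_free eqn_leq rank_leq_row leqNgt ltnS.
  apply/negP => /rank1_dyad[p [q XE]]; apply: nr; exists (col_mx p 0), q; split.
  - by apply: contra X0 => /eqP; rewrite -col_mx0 => /eq_col_mx[p0 _]; rewrite XE p0 mul0mx.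
  - by apply: contra X0 => /eqP q0; rewrite XE q0 mulmx0.
  move=> N NT; apply/matrixP => i j; rewrite !ord1 [RHS]mxE -tr_dyad.
  rewrite mul_col_mx mul0mx -XE mxtrace_mulC; exact: (iffLR (FP X) XF).
pose up (X : 'M[K]_(2, 2 + k.+1)) := @usubmx K 1 1 _ X.
pose dn (X : 'M[K]_(2, 2 + k.+1)) := @dsubmx K 1 1 _ X.
(* Elements of [T] are determined by their first two columns, so the lower rows of an element of the
   orthogonal can be prescribed. *)
have lift M2 : exists M1, orth T (col_mx M1 M2).
  have psi_lin : linear (fun N : 'M[K]_(2 + k.+1) => - \tr (rsubmx N *m M2) : K^o).
    by move=> a X Y; rewrite linearP mulmxDl -scalemxAl linearP /= opprD scalerN.
  pose psi : {linear 'M[K]_(2 + k.+1) -> K^o} := HB.pack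
    (fun N : 'M[K]_(2 + k.+1) => - \tr (rsubmx N *m M2) : K^o)
    (GRing.isLinear.Build _ _ _ _ _ psi_lin).
  have [|M1 M1E] := @trace_factor K _ _ _ T ls psi.
    by move=> N NT /T0 -> //=; rewrite linear0 mul0mx mxtrace0 oppr0.
  exists M1 => N NT; rewrite -[N]hsubmxK mul_row_col linearD /= mxtrace_mulC.
  by rewrite -[lsubmx N]/(ls N) -M1E //= addNr.
have polar M1 M2 X : orth T (col_mx M1 M2) -> X \in F ->
    detR (up M1 + up X) (dn M1 + dn X) M2 = 0.
  move=> MT XF; rewrite -!linearD /= -detRE; apply/det_singular/sT => N NT.
  rewrite -[M2]addr0 -add_col_mx mulmxDr linearD /= MT //.
  by rewrite (iffLR (FP X) XF) ?addr0.
have polar2 M2 X Y : X \in F -> Y \in F -> detR (up X) (dn Y) M2 + detR (up Y) (dn X) M2 = 0.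
  move=> XF YF; have [M1 MT] := lift M2.
  have := polar _ _ _ MT (mem0v F); have := polar _ _ _ MT XF; have := polar _ _ _ MT YF.
  have := polar _ _ _ MT (rpredD XF YF); rewrite /up /dn !linearD !linear0 /= !addr0.
  rewrite !(detRDl, detRDr).
  set p := detR _ _ _; set q := detR _ _ _; set r := detR _ _ _; set s := detR _ _ _.
  set t := detR _ _ _; set u := detR _ _ _; set v := detR _ _ _.
  set w := detR _ _ _; set z := detR _ _ _.
  move=> e1 e2 e3 e4.
  transitivity (p + (q + r) + (s + t + (u + v + (w + z))) - (p + r + (t + z)) -
    (p + q + (s + u)) + p); first by ring.
  by rewrite e1 e2 e3 e4 !subr0 addr0.
have upK X : X = col_mx (up X) (dn X) by rewrite (@vsubmxK K 1 1).
have fswap X : row_free X -> row_free (col_mx (dn X) (up X)).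
  by rewrite /row_free (col_mx_swap (dn X)) -upK.
(* Repeating a row of X at the top of M2 kills one of the two terms of [polar2]. The other one
   vanishes for all M, which puts a row of Y in the row space of X. *)
have spanF X Y : X \in F -> Y \in F -> X != 0 -> (up Y <= X)%MS && (dn Y <= X)%MS.
  move=> XF YF X0; have fX := freeF X XF X0; apply/andP; split.
    apply: contraT => YX; have [|| M /negP[]] := @detR_independent k (up X) (dn X) (up Y).
    - by rewrite -upK.
    - by rewrite -upK.
    by have := polar2 (col_mx (up X) M) X Y XF YF; rewrite detR_repeatl add0r => ->.
  apply: contraT => YX; have [|| M] := @detR_independent k (dn X) (up X) (dn Y).
  - exact: fswap.
  - by rewrite (col_mx_swap (dn X)) -upK.
  have [s s0 ->] := detR_swap k.+1; have := polar2 (col_mx (dn X) M) X Y XF YF.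
  by rewrite (detR_repeatr (up Y)) addr0 => ->; rewrite mulr0 eqxx.
pose X0 := vpick F; have X0F : X0 \in F by apply: memv_pick.
have X00 : X0 != 0 by rewrite vpick0 -dimv_eq0 -lt0n (leq_trans _ dimF).
pose W := (linfun (mulmxr X0 : 'rV_2 -> 'rV_(2 + k.+1)) @: fullv)%VS.
have memW v : (v <= X0)%MS -> v \in W.
  by case/submxP => c ->; apply/memv_imgP; exists c; rewrite ?memvf // lfunE.
have dimW : (\dim W <= 2)%N.
  have le := leq_addl (\dim (fullv :&: lker (linfun (mulmxr X0 : 'rV_2 -> 'rV_(2 + k.+1))))) (\dim W).
  by apply: leq_trans le _; rewrite limg_ker_dim dimvf dim_matrix mul1r.
have upsub (g : {linear 'M[K]_(2, 2 + k.+1) -> 'rV_(2 + k.+1)}) :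
    (forall X, X \in F -> (g X <= X0)%MS) -> (forall X, X \in F -> g X = 0 -> X = 0) ->
    \dim (linfun g @: F) = \dim F /\ (linfun g @: F <= W)%VS.
  move=> gX0 g0; split; last first.
    by apply/subvP => _ /memv_imgP[X XF ->]; rewrite lfunE memW ?gX0.
  apply: limg_dim_eq; apply/eqP; rewrite -subv0; apply/subvP => X.
  by rewrite memv_cap memv_ker lfunE /= => /andP[XF /eqP/(g0 X XF) ->]; rewrite mem0v.
have kill X (c : 'rV_2) : X \in F -> c != 0 -> c *m X = 0 -> X = 0.
  move=> XF c0 cX; apply: contraNeq c0 => X1; have /row_freeP[B XB] := freeF X XF X1.
  by rewrite -[c]mulmx1 -XB mulmxA cX mul0mx.
pose upL : {linear 'M[K]_(2, 2 + k.+1) -> 'rV_(2 + k.+1)} :=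
  (@usubmx K 1 1 (2 + k.+1) : {linear 'M[K]_(1 + 1, 2 + k.+1) -> 'rV_(2 + k.+1)}).
pose dnL : {linear 'M[K]_(2, 2 + k.+1) -> 'rV_(2 + k.+1)} :=
  (@dsubmx K 1 1 (2 + k.+1) : {linear 'M[K]_(1 + 1, 2 + k.+1) -> 'rV_(2 + k.+1)}).
have [||dimup upW] := upsub upL.
- by move=> X XF; have /andP[] := spanF X0 X X0F XF X00.
- move=> X XF X1; apply: (kill X (row_mx 1%:M 0 : 'M_(1, 1 + 1)) XF).
    exact: row_mx10.
  by rewrite [X]upK (@mul_row_col _ 1 1 1) mul0mx mul1mx addr0.
have [||dimdn dnW] := upsub dnL.
- by move=> X XF; have /andP[] := spanF X0 X X0F XF X00.
- move=> X XF X1; apply: (kill X (row_mx 0 1%:M : 'M_(1, 1 + 1)) XF).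
    exact: row_mx01.
  by rewrite [X]upK (@mul_row_col _ 1 1 1) mul0mx mul1mx add0r.
have k0 : k = 0%N.
  have := leq_trans dimF (leq_trans (eq_leq (esym dimup)) (leq_trans (dimvS upW) dimW)); lia.
have ontoW (g : {linear 'M[K]_(2, 2 + k.+1) -> 'rV_(2 + k.+1)}) z :
    \dim (linfun g @: F) = \dim F -> (linfun g @: F <= W)%VS -> (z <= X0)%MS ->
    exists2 Z, Z \in F & g Z = z.
  move=> dimg gW /memW; suff -> : W = (linfun g @: F)%VS.
    by case/memv_imgP => Z ZF ->; exists Z; rewrite ?lfunE.
  apply/esym/eqP; rewrite eqEdim gW dimg (leq_trans dimW) // (leq_trans _ dimF) //.
subst k.
have [s s0 sE] := detR_swap 1.
have subX0 Z v : Z \in F -> (v <= Z)%MS -> (v <= X0)%MS.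
  move=> ZF /submx_trans; apply; rewrite [Z]upK (@col_mx_sub _ 1 1); exact: spanF.
have rl (z b : 'rV_3) : detR z b z = 0.
  by have := @detR_repeatl 0 b z 0; rewrite col_mx_flat.
have rr (z b : 'rV_3) : detR b z z = 0.
  by have := @detR_repeatr 0 b z 0; rewrite col_mx_flat.
(* At size 3, M2 is a single row z, and both rows of the elements of [F] fill the plane [W]. The
   terms of degree 1 in Z, for Z in [F] having z as one of its rows, force the rows of M1 into this
   plane. *)
have inX0 M1 (z : 'rV_3) : orth T (col_mx M1 z) -> (z <= X0)%MS ->
    (up M1 <= X0)%MS && (dn M1 <= X0)%MS.
  move=> MT zX0; have [z0|z0] := eqVneq z 0.
    by apply: spanF => //; apply/FP; rewrite -z0.
  have D0 : detR (up M1) (dn M1) z = 0.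
    by have := polar _ _ _ MT (mem0v F); rewrite /up /dn !linear0 !addr0.
  apply/andP; split; apply: contraT => nX0.
    have [Z ZF Zz] := ontoW upL z dimup upW zX0.
    have Z0 : Z != 0 by apply: contra z0 => /eqP Z0; rewrite -Zz Z0 linear0.
    have [|| M] := @detR_independent 0 (up Z) (dn Z) (up M1).
    - by rewrite -upK freeF.
    - by apply: contra nX0; rewrite -upK; apply: subX0.
    have := polar _ _ _ MT ZF; rewrite !(detRDl, detRDr) -[up Z]/(upL Z) Zz.
    rewrite !rl D0 add0r !addr0 col_mx_flat => ->.
    by rewrite eqxx.
  have [Z ZF Zz] := ontoW dnL z dimdn dnW zX0.
  have Z0 : Z != 0 by apply: contra z0 => /eqP Z0; rewrite -Zz Z0 linear0.
  have [|| M] := @detR_independent 0 (dn Z) (up Z) (dn M1).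
  - by rewrite fswap ?freeF.
  - by apply: contra nX0; rewrite (col_mx_swap (dn Z)) -upK; apply: subX0.
  have := polar _ _ _ MT ZF; rewrite !(detRDl, detRDr) -[dn Z]/(dnL Z) Zz.
  rewrite !rr D0 addr0 !add0r col_mx_flat sE addr0 => /eqP.
  by rewrite mulf_eq0 (negPf s0) => /= ->.
have fX0 := freeF X0 X0F X00.
have [h h0 X0h] : exists2 h : 'cV_3, h != 0 & X0 *m h = 0.
  exists (nz_row (kermx X0^T))^T.
    rewrite -(inj_eq trmx_inj) trmxK trmx0 nz_row_eq0 -mxrank_eq0 mxrank_ker mxrank_tr.
    by rewrite (eqP fX0).
  apply: trmx_inj; rewrite trmx_mul trmxK trmx0; apply/sub_kermxP; exact: nz_row_sub.
have sub0 (v : 'rV_3) : (v <= X0)%MS -> v *m h = 0.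
  by case/submxP => c ->; rewrite -mulmxA X0h mulmx0.
have hX0 (v : 'rV_3) : v *m h = 0 -> (v <= X0)%MS.
  move=> vh; apply: contraT => vX0.
  have [|| M] := @detR_independent 0 (up X0) (dn X0) v; try by rewrite -upK.
  rewrite /detR col_mx_flat -unitfE -unitmxE => Mu; case/eqP: h0; rewrite -[h](mulKmx Mu).
  have /andP[/sub0 uh /sub0 dh] := spanF X0 X0 X0F X0F X00.
  by rewrite !mul_col_mx vh uh dh !col_mx0 mulmx0.
have HM M : orth T M -> @dsubmx K 2 1 3 M *m h = 0 -> M *m h = 0.
  rewrite -{1 3}[M](@vsubmxK K 2 1) => MT Mh; have /andP[uX dX] := inX0 _ _ MT (hX0 _ Mh).
  rewrite mul_col_mx Mh [usubmx M]upK (@mul_col_mx _ 1 1).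
  by rewrite !sub0 // !col_mx0.
(* Dual form of [HM]: modulo the dyad h (0, 0, 1), all the dyads h (c, 0) belong to [T]. *)
have hT (c : 'rV_2) : exists a : 'M_1, h *m row_mx c a \in T.
  have : h *m (row_mx c 0 : 'rV_(2 + 1)) \in (T + <[h *m (row_mx 0 1%:M : 'rV_(2 + 1))]>)%VS.
    apply: orthK => M MT'; have MT : orth T M.
      by move=> N NT; apply: MT'; rewrite -[N]addr0 memv_add ?mem0v.
    rewrite tr_dyad -mulmxA HM ?mulmx0 ?mxE //.
    have := MT' _ (subvP (addvSr _ _) _ (memv_line _)).
    have -> : @dsubmx K 2 1 3 M = (row_mx 0 1%:M : 'rV_(2 + 1)) *m M.
      by rewrite -{2}[M](@vsubmxK K 2 1) (@mul_row_col _ _ 2 1) mul0mx mul1mx add0r.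
    rewrite tr_dyad => E.
    by apply/matrixP => i j; rewrite !ord1 E mxE.
  case/memv_addP => t tT [_ /vlineP[a ->] E]; exists (- a)%:M.
  suff -> : h *m row_mx c (- a)%:M = t by [].
  apply/(addIr (a *: (h *m row_mx 0 1%:M))); rewrite -E scalemxAr -mulmxDr.
  by rewrite scale_row_mx add_row_mx scaler0 addr0 scale_scalar_mx mulr1 -raddfD addNr raddf0.
have [a0 a0T] := hT (row_mx 1%:M 0 : 'rV_(1 + 1)).
have [a1 a1T] := hT (row_mx 0 1%:M : 'rV_(1 + 1)).
pose a : 'cV_2 := col_mx a0 a1 : 'cV_(1 + 1).
pose G : 'M_(2, 3) := row_mx 1%:M a : 'M_(2, 2 + 1).
have GE (c : 'rV_2) : c *m G = row_mx c (c *m a) :> 'rV_(2 + 1).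
  by rewrite /G (@mul_mx_row _ 1 2 2 1) mulmx1.
have cT (c : 'rV_2) : h *m (c *m G) \in T.
  have -> : c = (@lsubmx K 1 1 1 c) 0 0 *: row_mx 1%:M 0 + (@rsubmx K 1 1 1 c) 0 0 *: row_mx 0 1%:M
      :> 'rV_(1 + 1).
    rewrite !scale_row_mx add_row_mx !scaler0 addr0 add0r !scale_scalar_mx !mulr1.
    by rewrite -!mx11_scalar (@hsubmxK _ _ 1 1).
  rewrite mulmxDl mulmxDr -!scalemxAl -!scalemxAr rpredD // memvZ // GE.
    by rewrite /a (@mul_row_col _ _ 1 1) mul0mx mul1mx addr0.
  by rewrite /a (@mul_row_col _ _ 1 1) mul0mx mul1mx add0r.
pose x : 'cV_3 := col_mx a (- 1%:M) : 'cV_(2 + 1).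
have x0 : x != 0.
  apply/eqP; rewrite /x -[RHS](@col_mx0 _ 2 1) => /(@eq_col_mx _ 2 1)[_ /matrixP/(_ 0 0)/eqP].
  by rewrite !mxE oppr_eq0 oner_eq0.
have Gx : G *m x = 0 by rewrite /G /x (@mul_row_col _ _ 2 1) mul1mx mulmxN mulmx1 addrN.
(* The dyads h c G form a plane in [T] killed by x. So T x has dimension at most 4 - 2 < 3, and a
   row u killing it gives the forbidden dyad. *)
have two : (2 <= \dim (T :&: lker (linfun (mulmxr x))))%N.
  have lin : linear (fun c : 'rV[K]_2 => h *m (c *m G)).
    by move=> b c d; rewrite mulmxDl mulmxDr -!scalemxAl -scalemxAr.
  pose gam : {linear 'rV[K]_2 -> 'M[K]_3} := HB.pack (fun c : 'rV[K]_2 => h *m (c *m G))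
    (GRing.isLinear.Build _ _ _ _ _ lin).
  have dimg : \dim (linfun gam @: fullv) = 2%N.
    rewrite limg_dim_eq ?dimvf ?dim_matrix ?mul1r //.
    apply/eqP; rewrite -subv0; apply/subvP => c.
    rewrite memv_cap memv_ker lfunE /= => /andP[_ /eqP/(dyad_eq0 h0)].
    by rewrite GE -[RHS](@row_mx0 _ 1 2 1) => /(@eq_row_mx _ _ 2 1)[-> _]; rewrite mem0v.
  apply: leq_trans (eq_leq (esym dimg)) _; apply: dimvS; apply/subvP => _ /memv_imgP[c _ ->].
  by rewrite lfunE memv_cap memv_ker lfunE /= cT -!mulmxA Gx !mulmx0 eqxx.
have [|u u0 uT] := @annihilating_row _ _ (linfun (mulmxr x) @: T).
  rewrite -(ltn_add2l (\dim (T :&: lker (linfun (mulmxr x))))) limg_ker_dim.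
  by apply: leq_ltn_trans dimT _; apply: leq_trans (leq_add two (leqnn 3)).
apply: nr; exists x, u; split=> // N NT; rewrite -mulmxA uT //.
by apply/memv_imgP; exists N; rewrite ?lfunE.
Qed.

Lemma row_free2 n (x x' : 'cV[K]_n) :
  (forall a b, a *: x + b *: x' = 0 -> a = 0 /\ b = 0) -> row_free (col_mx x^T x'^T).
Proof.
move=> xx'; apply: inj_row_free => c; rewrite -[c](@hsubmxK _ _ 1 1) mul_row_col.
move: (lsubmx c) (rsubmx c) => c0 c1 /(congr1 trmx).
rewrite linearD /= !trmx_mul !trmxK trmx0 [c0]mx11_scalar [c1]mx11_scalar !tr_scalar_mx.
by rewrite !mul_mx_scalar => /xx'[-> ->]; rewrite !raddf0 row_mx0.
Qed.

(** Without an orthogonal dyad, T x is the whole space for every x != 0, so the elements of [T]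
    killing x form at most a line. A column x' not killed by a generator of this line completes x to
    a pair that determines the elements of [T], as [rank1_core] requires. *)
Lemma rank1_orth k (T : {vspace 'M[K]_(k.+3)}) : (\dim T <= k.+4)%N -> sing T ->
  exists (x : 'cV_(k.+3)) (u : 'rV_(k.+3)),
    [/\ x != 0, u != 0 & forall N, N \in T -> u *m N *m x = 0].
Proof.
move=> dimT sT; apply: NNPP => nr.
have onto (x : 'cV_(k.+3)) : x != 0 -> (\dim (T :&: lker (linfun (mulmxr x))) <= 1)%N.
  move=> x0; have := limg_ker_dim (linfun (mulmxr x)) T.
  suff le : (k.+3 <= \dim (linfun (mulmxr x) @: T))%N.
    move=> E; have := leq_trans (leq_add (leqnn _) le) (leq_trans (eq_leq E) dimT).
    by rewrite -[k.+4]add1n leq_add2r.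
  rewrite leqNgt; apply/negP => lt; have [u u0 uT] := annihilating_row lt.
  apply: nr; exists x, u; split=> // N NT; rewrite -mulmxA uT //.
  by apply/memv_imgP; exists N; rewrite ?lfunE.
pose x : 'cV[K]_(k.+3) := delta_mx 0 0.
have x0 : x != 0 by apply/eqP => /matrixP/(_ 0 0)/eqP; rewrite !mxE eqxx oner_eq0.
have [x' [x'x x'T]] : exists x' : 'cV_(k.+3),
    row_free (col_mx x^T x'^T) /\ forall N, N \in T -> N *m x = 0 -> N *m x' = 0 -> N = 0.
  pose N1 := vpick (T :&: lker (linfun (mulmxr x)))%VS.
  have [N10|N10] := eqVneq N1 0.
    exists (delta_mx (lift 0 0) 0); split.
      apply: row_free2 => a b /matrixP ab; have := ab 0 0; have := ab (lift 0 0) 0.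
      by rewrite !mxE !eqxx /= !mulr1 !mulr0 add0r addr0.
    move=> N NT Nx _; suff : N \in (T :&: lker (linfun (mulmxr x)))%VS.
      by move/eqP: N10; rewrite vpick0 => /eqP ->; rewrite memv0 => /eqP.
    by rewrite memv_cap NT memv_ker lfunE /= Nx eqxx.
  have [x' N1x'] := nonzero_col N10; exists x'.
  have /memv_capP[N1T] : N1 \in (T :&: lker (linfun (mulmxr x)))%VS by apply: memv_pick.
  rewrite memv_ker lfunE /= => /eqP N1x; split.
    apply: row_free2 => a b ab; have b0 : b = 0.
      have := congr1 (mulmx N1) ab; rewrite mulmxDr -!scalemxAr N1x scaler0 add0r mulmx0.
      by move/eqP; rewrite scaler_eq0 (negPf N1x') orbF => /eqP.
    by move/eqP: ab; rewrite b0 scale0r addr0 scaler_eq0 (negPf x0) orbF => /eqP.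
  move=> N NT Nx Nx'; have : N \in <[N1]>%VS.
    have <- : (T :&: lker (linfun (mulmxr x)))%VS = <[N1]>%VS.
      apply/esym/eqP; rewrite eqEdim dim_vline N10 onto // andbT -memvE memv_pick //.
    by rewrite memv_cap NT memv_ker lfunE /= Nx eqxx.
  case/vlineP => a Na; move/eqP: Nx'; rewrite Na -scalemxAl scaler_eq0 (negPf N1x') orbF.
  by move=> /eqP->; rewrite scale0r.
have [C Cu] := @complete_rows 2 k.+1 _ x'x.
pose X : 'M_(k.+3) := (col_mx (col_mx x^T x'^T) C)^T.
have Xu : X \in unitmx by rewrite unitmx_tr.
have lX : @lsubmx K _ 2 k.+1 X = row_mx x x'.
  by rewrite /X -(@trmx_usub _ 2 k.+1) (@col_mxKu _ 2 k.+1) (@tr_col_mx _ 1 1) !trmxK.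
have [|||y [u [y0 u0 uTy]]] := @rank1_core k (equivT 1%:M X T).
- by rewrite dim_equivT ?unitmx1.
- by apply: sing_equivT; rewrite ?unitmx1.
- apply/(@equivTP _ _ _ _ _ (fun N => @lsubmx K _ 2 k.+1 N = 0 -> N = 0)); rewrite ?unitmx1 //.
  move=> N NT; rewrite mul1mx -[in lsubmx _](@hsubmxK _ _ 2 k.+1 X) (@mul_mx_row _ _ _ 2 k.+1).
  rewrite (@row_mxKl _ _ 2 k.+1) lX (@mul_mx_row _ _ _ 1 1).
  rewrite -[X in _ = X -> _](@row_mx0 _ _ 1 1) => /(@eq_row_mx _ _ 1 1)[Nx Nx'].
  by rewrite (x'T N NT Nx Nx') mul0mx.
apply: nr; exists (X *m y), u; split=> //.
  by apply: contra y0 => /eqP/(canRL (mulKmx Xu)) ->; rewrite mulmx0.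
move=> N NT; rewrite mulmxA -(mulmxA u); apply: uTy.
by have := mem_equivT T N (unitmx1 _ _) Xu; rewrite mul1mx => ->.
Qed.

End Rank1.

(** * Dyadic structure in dimension at most n, then n + 1 *)

Section Key.
Variable K : fieldType.

Lemma trmx_neq0 m n (A : 'M[K]_(m, n)) : (A^T != 0) = (A != 0).
Proof. by rewrite -(inj_eq trmx_inj) trmxK trmx0. Qed.

Lemma nonzero_row m n (M : 'M[K]_(m, n)) : M != 0 -> exists u : 'rV_m, u *m M != 0.
Proof.
rewrite -trmx_neq0 => /nonzero_col[x]; rewrite -trmx_neq0 trmx_mul trmxK.
by exists x^T.
Qed.

(** The corner space is smaller by one in size, and by at least one in dimension when
    [kerT T x u != T]. The bound of [dyadic_step] reads n < 2 (n - 1), true from n = 3 on. *)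
Lemma sing_dyadic k (T : {vspace 'M[K]_(k.+2)}) : (\dim T <= k.+2)%N -> sing T -> dyadic T.
Proof.
elim: k => [|k IHk] in T *; first by move=> _; apply: sing_dyadic2.
move=> dimT sT; have [x0 [u0 [x00 u00 uTx0]]] := rank1_orth (leqW dimT) sT.
have T0 : T != 0%VS by rewrite -dimv_eq0 -lt0n (leq_trans _ (sing_dim sT)).
have N0T := memv_pick T; set N0 := vpick T in N0T.
have N00 : N0 != 0 by rewrite vpick0.
(* If [x0] kills all of [T], any row is allowed with it, and one that does not kill [N0] is
   taken. *)
have [x [u [x1 u1 uTx kTx]]] : exists (x : 'cV_(k.+3)) (u : 'rV_(k.+3)),
    [/\ x != 0, u != 0, forall N, N \in T -> u *m N *m x = 0 & kerT T x u != T].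
  have [kT|kT] := eqVneq (kerT T x0 u0) T; last by exists x0, u0.
  have [u uN0] := nonzero_row N00; exists x0, u; split=> //.
  - by apply: contraNneq uN0 => ->; rewrite mul0mx.
  - by move=> N; rewrite -{1}kT mem_kerT -mulmxA => /and3P[_ /eqP-> _]; rewrite mulmx0.
  - by apply: contraNneq uN0 => kT'; move: N0T; rewrite -{1}kT' mem_kerT => /and3P[].
have [U [X [Uu Xu _ _ [T0' dimred]]]] := @corner K k.+2 T x u x1 u1 uTx.
have sT' := sing_equivT Uu Xu sT; apply: (dyadic_equivT Uu Xu).
apply: (@dyadic_step K k.+2) => //.
  by rewrite dim_equivT //; apply: leq_ltn_trans dimT _; rewrite !addSn !ltnS leq_addl.
apply: IHk; last exact: (corner_space_sing T0' sT').
rewrite -ltnS; apply: leq_trans dimT; apply: leq_ltn_trans dimred _.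
have sub : (kerT T x u <= T)%VS by rewrite /kerT -capvA capvSl.
by rewrite ltn_neqAle dimvS // andbT (dimv_leqif_eq sub).
Qed.

Lemma kerT_trT n (T : {vspace 'M[K]_n}) x u :
  kerT (trT T) u^T x^T = trT (kerT T x u).
Proof.
apply/vspaceP => N; rewrite mem_kerT !mem_trT mem_kerT; congr (_ && _).
by rewrite andbC; congr (_ && _); rewrite -(inj_eq trmx_inj) trmx_mul trmxK trmx0.
Qed.

Lemma dyad_factor n (v : 'cV[K]_n) (N : 'M_n) : v != 0 ->
  (forall u : 'rV_n, u *m v = 0 -> u *m N = 0) -> exists w, N = v *m w.
Proof.
move=> v0 vN; have [c cv] : exists c : 'rV_n, c *m v = 1.
  have [u uv] := nonzero_row v0; exists (((u *m v) 0 0)^-1 *: u).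
  rewrite -scalemxAl [X in _ *: X]mx11_scalar scale_scalar_mx mulVf //.
  by apply: contra uv => /eqP uv; rewrite [_ *m _]mx11_scalar uv raddf0.
exists (c *m N); apply/eqP; rewrite -subr_eq0; apply/eqP/trmx_inj; rewrite trmx0.
apply: vanish_col => u; apply: trmx_inj; rewrite trmx_mul trmxK trmx0 mulmxBr.
rewrite [v *m _]mulmxA [u^T *m (_ *m N)]mulmxA [u^T *m (v *m c)]mulmxA.
by rewrite -mulmxBl vN // mulmxBl -(mulmxA _ c) cv mulmx1 subrr.
Qed.

(** With a drop of at most 1, T x is a line spanned by v, and the elements of T killing x are killed
    by every row that kills v. They are thus dyads v w with w x = 0, which form a space of dimension
    at most n - 1. *)
Lemma dim_drop_le n (T : {vspace 'M[K]_n}) (x : 'cV_n) (u : 'rV_n) N0 :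
    x != 0 -> u != 0 -> (forall N, N \in T -> u *m N *m x = 0) ->
    N0 \in T -> N0 *m x != 0 ->
    (forall x u, x != 0 -> u != 0 -> (forall N, N \in T -> u *m N *m x = 0) ->
       (\dim T <= (\dim (kerT T x u)).+1)%N) ->
  (\dim T <= n)%N.
Proof.
move=> x0 u0 uTx N0T N0x H; set v := N0 *m x in N0x.
pose T1 := (T :&: lker (linfun (mulmxr x)))%VS.
have memT1 N : (N \in T1) = (N \in T) && (N *m x == 0).
  by rewrite memv_cap memv_ker lfunE.
have ltT1 : (\dim T1 < \dim T)%N.
  have sub : (T1 <= T)%VS by rewrite capvSl.
  rewrite ltn_neqAle dimvS // andbT (dimv_leqif_eq sub); apply: contraNneq N0x => T1T.
  by move: N0T; rewrite -T1T memT1 => /andP[].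
have kT1 (u' : 'rV_n) : u' != 0 -> (forall N, N \in T -> u' *m N *m x = 0) ->
    forall N, N \in T1 -> u' *m N = 0.
  move=> u'0 u'Tx; have sub : (kerT T x u' <= T1)%VS by rewrite capvSl.
  have /eqP kE : kerT T x u' == T1.
    by rewrite eqEdim sub -ltnS (leq_trans ltT1) // H.
  by move=> N; rewrite -kE mem_kerT => /and3P[_ _ /eqP].
have Tx N : N \in T -> exists a, N *m x = a *: v.
  move=> NT; have dim1 : (\dim (linfun (mulmxr x) @: T) <= 1)%N.
    rewrite -(leq_add2l (\dim T1)) limg_ker_dim addn1 (leq_trans (H x u x0 u0 uTx)) //.
    by rewrite ltnS dimvS // capvSl.
  have vT : v \in (linfun (mulmxr x) @: T)%VS.
    by apply/memv_imgP; exists N0; rewrite ?lfunE.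
  have /eqP vE : <[v]>%VS == (linfun (mulmxr x) @: T)%VS.
    by rewrite eqEdim -memvE vT dim_vline N0x.
  by apply/vlineP; rewrite vE; apply/memv_imgP; exists N; rewrite ?lfunE.
have T1v N : N \in T1 -> exists w, N = v *m w.
  move=> NT1; apply: dyad_factor => // u' u'v.
  have [->|u'0] := eqVneq u' 0; first by rewrite mul0mx.
  apply: kT1 => // N' /Tx[a N'x].
  by rewrite -mulmxA N'x -scalemxAr u'v scaler0.
pose W := lker (linfun (mulmxr x : 'rV_n -> 'M_1)).
have dimW : (\dim W < n)%N.
  have := limg_ker_dim (linfun (mulmxr x : 'rV_n -> 'M_1)) fullv.
  rewrite capfv -/W dimvf dim_matrix mul1r => sumE.
  apply: leq_trans (eq_leq sumE); rewrite -addn1 leq_add2l lt0n dimv_eq0; apply/eqP => E.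
  have [r rx] := nonzero_row x0; case/eqP: rx.
  have : linfun (mulmxr x : 'rV_n -> 'M_1) r \in limg (linfun (mulmxr x : 'rV_n -> 'M_1)).
    by rewrite memv_img ?memvf.
  by rewrite E memv0 lfunE => /eqP.
have sub : (T1 <= linfun (mulmx v : 'rV_n -> 'M_n) @: W)%VS.
  apply/subvP => N NT1; have [w Nw] := T1v N NT1; apply/memv_imgP; exists w; last by rewrite lfunE.
  rewrite memv_ker lfunE /=; move: NT1; rewrite memT1 Nw -mulmxA => /andP[_ /eqP].
  by move/(dyad_eq0 N0x) ->.
apply: leq_trans dimW; apply: leq_trans (H x u x0 u0 uTx) _; rewrite ltnS.
have subk : (kerT T x u <= T1)%VS by rewrite capvSl.
apply: leq_trans (dimvS (subv_trans subk sub)) _.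
by rewrite -(limg_ker_dim (linfun (mulmx v : 'rV_n -> 'M_n)) W) leq_addl.
Qed.

(** In dimension n + 1, losing two dimensions in a single step brings the corner space back under
    the bound of [sing_dyadic]. *)
Lemma drop_two n (T : {vspace 'M[K]_n}) (x0 : 'cV_n) (u0 : 'rV_n) :
    (n < \dim T)%N -> x0 != 0 -> u0 != 0 ->
    (forall N, N \in T -> u0 *m N *m x0 = 0) ->
  exists (x : 'cV_n) (u : 'rV_n), [/\ x != 0, u != 0, forall N, N \in T -> u *m N *m x = 0 &
    ((\dim (kerT T x u)).+2 <= \dim T)%N].
Proof.
move=> dimT x00 u00 uTx; apply: NNPP => nex.
have H (x : 'cV_n) (u : 'rV_n) : x != 0 -> u != 0 -> (forall N, N \in T -> u *m N *m x = 0) ->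
    (\dim T <= (\dim (kerT T x u)).+1)%N.
  move=> x1 u1 uTx1; rewrite leqNgt; apply/negP => lt; apply: nex.
  by exists x, u.
have rowcase (x : 'cV_n) (u : 'rV_n) N0 : x != 0 -> u != 0 ->
    (forall N, N \in T -> u *m N *m x = 0) -> N0 \in T -> u *m N0 != 0 -> False.
  move=> x1 u1 uTx1 N0T uN0; move: dimT; rewrite ltnNge => /negP[].
  rewrite -dim_trT; apply: (@dim_drop_le _ _ u^T x^T N0^T); rewrite ?trmx_neq0 //.
  - by move=> N; rewrite mem_trT => /uTx1/(congr1 trmx); rewrite !trmx_mul trmxK mulmxA trmx0.
  - by rewrite mem_trT trmxK.
  - by rewrite -trmx_mul trmx_neq0.
  move=> y z y0 z0 zTy; rewrite -[y]trmxK -[z]trmxK kerT_trT !dim_trT.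
  apply: H; rewrite ?trmx_neq0 // => N NT; apply: trmx_inj.
  by rewrite !trmx_mul !trmxK mulmxA trmx0 zTy // mem_trT trmxK.
have T0 : T != 0%VS by rewrite -dimv_eq0 -lt0n (leq_ltn_trans _ dimT).
have N00 : vpick T != 0 by rewrite vpick0.
have [u uN0] := nonzero_row N00.
have u1 : u != 0 by apply: contraNneq uN0 => ->; rewrite mul0mx.
have [Tx|Tx] := boolP (T <= lker (linfun (mulmxr x0)))%VS.
  apply: (rowcase x0 u _ x00 u1 _ (memv_pick T) uN0) => N NT.
  by move/subvP: Tx => /(_ N NT); rewrite memv_ker lfunE /= -mulmxA => /eqP->; rewrite mulmx0.
have [N1 N1T] := subvPn Tx; rewrite memv_ker lfunE /= => N1x.
by have := dim_drop_le x00 u00 uTx N1T N1x H; rewrite leqNgt dimT.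
Qed.

Lemma sing_dyadicS k (T : {vspace 'M[K]_(k.+4)}) : (\dim T <= k.+4.+1)%N -> sing T -> dyadic T.
Proof.
move=> dimT sT; have [le|gt] := leqP (\dim T) k.+4; first exact: sing_dyadic.
have [x0 [u0 [x00 u00 uTx0]]] := rank1_orth dimT sT.
have [x [u [x1 u1 uTx kTx]]] := drop_two gt x00 u00 uTx0.
have [U [X [Uu Xu _ _ [T0' dimred]]]] := @corner K k.+3 T x u x1 u1 uTx.
have sT' := sing_equivT Uu Xu sT; apply: (dyadic_equivT Uu Xu).
apply: (@dyadic_step K k.+3) => //.
  by rewrite dim_equivT //; apply: leq_ltn_trans dimT _; rewrite !addSn !ltnS leq_addl.
apply: sing_dyadic; last exact: (corner_space_sing T0' sT').
by apply: leq_trans dimred _; rewrite -2!ltnS (leq_trans kTx).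
Qed.

End Key.

(** * Spaces of 3 x 3 matrices with singular orthogonal *)

Section Dim3.
Variable K : fieldType.

(** The orthogonal of such a space consists of the sums [c *m a + b *m q], of rank at most 2. *)
Definition compression n (T : {vspace 'M[K]_n}) (q : 'rV_n) (c : 'cV_n) : Prop :=
  [/\ q != 0, c != 0 & forall N, N \in T <-> q *m N = 0 /\ N *m c = 0].

Lemma compression_equivT n (U X : 'M[K]_n) (T : {vspace 'M[K]_n}) q c :
  U \in unitmx -> X \in unitmx -> compression (equivT U X T) q c ->
  compression T (q *m U) (X *m c).
Proof.
move=> Uu Xu [q0 c0 TE]; split.
- by apply: contra q0 => /eqP/(canRL (mulmxK Uu)) ->; rewrite mul0mx.
- by apply: contra c0 => /eqP/(canRL (mulKmx Xu)) ->; rewrite mulmx0.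
move=> N; rewrite -(mem_equivT T N Uu Xu) TE.
have -> : q *m (U *m N *m X) = q *m U *m N *m X by rewrite !mulmxA.
have -> : U *m N *m X *m c = U *m (N *m (X *m c)) by rewrite !mulmxA.
split=> -[qN Nc]; split.
- by rewrite -[LHS](mulmxK Xu) qN mul0mx.
- by rewrite -[LHS](mulKmx Uu) Nc mulmx0.
- by rewrite qN mul0mx.
- by rewrite Nc mulmx0.
Qed.

Lemma compression_trT n (T : {vspace 'M[K]_n}) q c :
  compression (trT T) q c -> compression T c^T q^T.
Proof.
case=> q0 c0 TE; split; rewrite ?trmx_neq0 // => N.
have -> : (N \in T) = (N^T \in trT T) by rewrite mem_trT trmxK.
rewrite TE; split=> -[E1 E2]; split; apply: trmx_inj; rewrite trmx_mul ?trmxK trmx0 //.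
Qed.

Lemma det2E (A : 'M[K]_2) : \det A = A 0 0 * A 1 1 - A 0 1 * A 1 0.
Proof.
rewrite (expand_det_row _ 0) big_ord_recl big_ord1 /cofactor !det_mx11 !mxE /=.
rewrite expr0 mul1r expr1 mulN1r mulrN.
by congr (_ * A _ _ - A _ _ * A _ _); apply: val_inj.
Qed.

Lemma det2_quad (C1 C : 'M[K]_2) :
  exists b, forall s, \det (C1 + s *: C) = \det C1 + s * b + s ^+ 2 * \det C.
Proof.
exists (C1 0 0 * C 1 1 + C 0 0 * C1 1 1 - C1 0 1 * C 1 0 - C 0 1 * C1 1 0) => s.
by rewrite !det2E !mxE; ring.
Qed.

Lemma unit_map n (z z' : 'cV[K]_n) : z != 0 -> z' != 0 ->
  exists2 C, C \in unitmx & C *m z = z'.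
Proof.
case: n => [|n] in z z' *; first by rewrite [z]flatmx0 eqxx.
move=> /(unit_col 0)[Z Zu zE] /(unit_col 0)[Z' Z'u z'E].
exists (Z' *m invmx Z); first by rewrite unitmx_mul unitmx_inv Zu Z'u.
by rewrite -zE -mulmxA mulKmx.
Qed.

(** The equality case 4 = 2 + 2 of [lift_corner]. For [C] orthogonal to [T3], det (- C0 + s C) has
    degree at most 2 in s and vanishes at 0, 1 and t, whence det C = 0 and [sing_dyadic2] applies to
    [T3]. Over two scalars s^2 + s vanishes everywhere and the argument breaks down. *)
Lemma lift_corner3 (t : K) (T : {vspace 'M[K]_(1 + 2)}) :
    t != 0 -> t != 1 -> sing T -> (\dim T <= 4)%N ->
    (forall w, block_mx 0 w 0 0 \in T) -> block_mx 1%:M 0 0 0 \notin T ->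
  dyadic T \/ exists q c, compression T q c.
Proof.
move=> t0 t1 sT dimT wT eT.
have [C0 [T2 [T3 [T2E T3E dimT3 C0E CT]]]] := corner_functional wT eT.
have nunit C : (forall X, X \in T3 -> \tr (X *m C) = - \tr (X *m C0)) -> C \notin unitmx.
  by move=> /CT[r /sT]; rewrite !unitmxE det_ublock det1 mul1r.
have sub2 : (T2 <= T)%VS by apply/subvP => N; rewrite T2E => /andP[].
have ge3 : (2 <= \dim T3)%N.
  by rewrite leqNgt; apply/negP => /(affine_unit (- C0))[C Cu CE];
     have /negP[] := nunit C (fun X XT => etrans (CE X XT) (etrans (congr1 _ (mulmxN _ _)) (raddfN _ _))).
have T2T : T2 = T.
  apply/eqP; rewrite eqEdim sub2; apply: leq_trans dimT _.
  exact: leq_trans (leq_add (leqnn 2) ge3) dimT3.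
have le3 : (\dim T3 <= 2)%N.
  by rewrite -(leq_add2l 2); apply: leq_trans dimT3 _; rewrite T2T.
have dl0 N : N \in T -> dlsubmx N = 0.
  by rewrite -T2T T2E => /andP[_ /eqP].
have sT3 : sing T3.
  move=> C CT3; have nu s : \det (- C0 + s *: C) = 0.
    apply/det_singular/nunit => X XT; rewrite mulmxDr mulmxN -scalemxAr linearD raddfN /=.
    by rewrite linearZ /= CT3 // mulr0 addr0.
  have [b bE] := det2_quad (- C0) C.
  have d0 : \det (- C0) = 0 by have := nu 0; rewrite scale0r addr0.
  have e1 : b + \det C = 0 by have := bE 1; rewrite nu d0 add0r mul1r expr1n mul1r.
  have e2 : t * b + t ^+ 2 * \det C = 0 by have := bE t; rewrite nu d0 add0r.
  have : t * (t - 1) * \det C = 0.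
    by transitivity (t * b + t ^+ 2 * \det C - t * (b + \det C)); [ring|rewrite e1 e2 mulr0 subr0].
  move/eqP; rewrite !mulf_eq0 (negPf t0) subr_eq0 (negPf t1) /= => dC.
  by rewrite unitmxE unitfE (eqP dC) eqxx.
have inT (n12 : 'rV_2) (X : 'M_2) : (forall Y, Y \in T3 -> \tr (C0 *m Y) = 0) ->
    X \in T3 -> block_mx 0 n12 0 X \in T.
  move=> C00 /[dup] XT /T3E[N]; rewrite T2T => NT XE.
  have := rpredD NT (wT (n12 - ursubmx N)); rewrite -{1}[N]submxK dl0 // -XE.
  rewrite add_block_mx !addr0 addrC subrK [ulsubmx N]mx11_scalar -trace_mx11 C0E ?T2T //.
  by rewrite -XE C00 // raddf0.
have inTE (C00 : forall Y, Y \in T3 -> \tr (C0 *m Y) = 0) N : N \in T ->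
    N = block_mx 0 (ursubmx N) 0 (drsubmx N) /\ drsubmx N \in T3.
  move=> NT; have dT : drsubmx N \in T3 by apply/T3E; exists N; rewrite // T2T.
  split=> //; rewrite -{1}[N]submxK dl0 // [ulsubmx N]mx11_scalar -trace_mx11.
  by rewrite C0E ?T2T // C00 // raddf0.
have [[z z0 zT]|[z z0 zT]] := sing_dyadic2 sT3.
  have zT3 Y : Y \in T3 -> exists w, Y = z *m w.
    pose L := (linfun (mulmx z : 'rV_2 -> 'M_2) @: fullv)%VS.
    have LT3 : (L <= T3)%VS by apply/subvP => _ /memv_imgP[w _ ->]; rewrite lfunE /= zT.
    have dimL : \dim L = 2%N.
      rewrite limg_dim_eq ?dimvf ?dim_matrix ?mul1r //.
      apply/eqP; rewrite -subv0; apply/subvP => w; rewrite memv_cap memv_ker lfunE /=.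
      by case/andP => _ /eqP/(dyad_eq0 z0) ->; rewrite mem0v.
    have /eqP <- : L == T3 by rewrite eqEdim LT3 dimL.
    by case/memv_imgP => w _ ->; exists w; rewrite lfunE.
  (* Otherwise a unit [C] with C z = - C0 z would agree with [- C0] on all of [T3]. Consequently the
     upper left entry vanishes on [T]. *)
  have C0z : C0 *m z = 0.
    apply/eqP; apply: contraT => C0z.
    have [|C Cu Cz] := unit_map z0 (_ : - (C0 *m z) != 0); first by rewrite oppr_eq0.
    have /negP[] : C \notin unitmx; last exact: Cu.
    apply: nunit => _ /zT3[w ->].
    by rewrite !tr_dyad -!mulmxA Cz mulmxN mxE.
  have C00 Y : Y \in T3 -> \tr (C0 *m Y) = 0.
    by case/zT3 => w ->; rewrite mulmxA C0z mul0mx mxtrace0.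
  right; have [q q0 qz] : exists2 q : 'rV_2, q != 0 & q *m z = 0.
    have [|q q0 qz] := @annihilating_row K 2 <[z]>%VS; first by rewrite dim_vline z0.
    by exists q; rewrite ?qz ?memv_line.
  exists (row_mx 0 q : 'rV_(1 + 2)), (delta_mx (lshift 2 0) 0 : 'cV_(1 + 2)); split.
  - by apply: contra q0 => /eqP; rewrite -row_mx0 => /eq_row_mx[_ ->].
  - by apply/eqP => /matrixP/(_ (lshift 2 0) 0)/eqP; rewrite !mxE !eqxx oner_eq0.
  move=> N; split=> [NT|[qN Ne]].
    have [NE /zT3[w Nw]] := inTE C00 N NT; rewrite NE Nw; split.
      by rewrite mul_row_block !mul0mx !mulmx0 !add0r mulmxA qz mul0mx row_mx0.
    by rewrite -colE /block_mx col_col_mx !colKl !col0 col_mx0.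
  have ul0 : ulsubmx N = 0.
    apply/matrixP => i j; rewrite !ord1 !mxE; move/matrixP/(_ (lshift 2 0) 0): Ne.
    by rewrite -colE !mxE.
  have dl0' : dlsubmx N = 0.
    apply/matrixP => i j; rewrite !ord1 !mxE; move/matrixP/(_ (rshift 1 i) 0): Ne.
    by rewrite -colE !mxE.
  move: qN; rewrite -{1}[N]submxK mul_row_block !mul0mx !add0r -row_mx0 => /eq_row_mx[_ qN].
  have [|w Nw] := @dyad_factor K 2 z (drsubmx N) z0.
    move=> u uz; have qk : (q <= kermx z)%MS by apply/sub_kermxP.
    have /(submx_trans _) uq : (kermx z <= q)%MS.
      by rewrite -(geq_leqif (mxrank_leqif_sup qk)) mxrank_ker -(mxrank_tr z) !rank_rV trmx_neq0 z0 q0.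
    have /uq/submxP[a ->] : (u <= kermx z)%MS by apply/sub_kermxP.
    by rewrite -mulmxA qN mulmx0.
  by rewrite -[N]submxK ul0 dl0' Nw inT // zT.
have zT3 Y : Y \in T3 -> exists v, Y = v *m z.
  pose L := (linfun (mulmxr z : 'cV_2 -> 'M_2) @: fullv)%VS.
  have LT3 : (L <= T3)%VS by apply/subvP => _ /memv_imgP[w _ ->]; rewrite lfunE /= zT.
  have dimL : \dim L = 2%N.
    rewrite limg_dim_eq ?dimvf ?dim_matrix ?mulr1 //.
    apply/eqP; rewrite -subv0; apply/subvP => v; rewrite memv_cap memv_ker lfunE /=.
    case/andP => _ /eqP/(congr1 trmx); rewrite trmx_mul trmx0 => /dyad_eq0.
    by rewrite trmx_neq0 => /(_ z0)/(congr1 trmx); rewrite trmxK trmx0 => ->; rewrite mem0v.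
  have /eqP <- : L == T3 by rewrite eqEdim LT3 dimL.
  by case/memv_imgP => w _ ->; exists w; rewrite lfunE.
have zC0 : z *m C0 = 0.
  apply/eqP; apply: contraT => zC0.
  have [||C Cu Cz] := @unit_map 2 z^T (- (z *m C0))^T; rewrite ?trmx_neq0 ?oppr_eq0 //.
  have /negP[] : C^T \notin unitmx; last by rewrite unitmx_tr.
  apply: nunit => _ /zT3[v ->].
  rewrite !tr_dyad -[z]trmxK -trmx_mul Cz trmxK trmxK.
  by rewrite mulNmx mxE.
have C00 Y : Y \in T3 -> \tr (C0 *m Y) = 0.
  by case/zT3 => v ->; rewrite mxtrace_mulC -mulmxA zC0 mulmx0 mxtrace0.
left; right; exists (row_mx 0 z).
  by apply: contra z0 => /eqP; rewrite -row_mx0 => /eq_row_mx[_ ->].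
move=> v; rewrite -[v](@vsubmxK _ 1 2) mul_col_row !mulmx0.
by apply: inT => //; apply: zT.
Qed.

Lemma sing_dyadic3 (t : K) (T : {vspace 'M[K]_3}) :
    t != 0 -> t != 1 -> (\dim T <= 4)%N -> sing T ->
  dyadic T \/ exists q c, compression T q c.
Proof.
move=> t0 t1.
have col (E : {vspace 'M[K]_(1 + 2)}) : (\dim E <= 4)%N -> sing E -> almost_col E ->
    dyadic E \/ exists q c, compression E q c.
  move=> dimE sE /almost_col_norm[U [X [Uu Xu wE eE]]].
  have [/eE typE|nE] := boolP (block_mx 1%:M 0 0 0 \in equivT U X E); first by left.
  have [||typE|[q [c cE]]] := lift_corner3 t0 t1 _ _ wE nE.
  - exact: sing_equivT.
  - by rewrite dim_equivT.
  - by left; apply: dyadic_equivT typE.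
  by right; exists (q *m U), (X *m c); apply: compression_equivT.
move=> dimT sT; have [x [u [x0 u0 uTx]]] := rank1_orth dimT sT.
have [U [X [Uu Xu _ _ [T0 _]]]] := @corner K 2 T x u x0 u0 uTx.
have sT' := sing_equivT Uu Xu sT.
suff [typT|[q [c cT]]] : dyadic (equivT U X T) \/ exists q c, compression (equivT U X T) q c.
- by left; apply: dyadic_equivT typT.
- by right; exists (q *m U), (X *m c); apply: compression_equivT.
have [ac|ac] := dyadic_red (sing_dyadic2 (corner_space_sing T0 sT')).
  by apply: col => //; rewrite dim_equivT.
have [||typT|[q [c cT]]] := col _ _ _ ac.
- by rewrite dim_trT dim_equivT.
- exact: sing_trT.
- by left; apply: dyadic_trT.
by right; exists c^T, q^T; apply: compression_trT.
Qed.

End Dim3.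

(** * Reconstruction of a Frobenius map *)

Section Extension.
Variables (K : fieldType) (n : nat) (A : 'M[K]_n).
Variable F : {linear 'M[K]_n -> 'M[K]_n}.
Hypothesis A0 : A != 0.
Hypothesis FA : forall M, \tr (A *m F M) = \tr (A *m M).
Hypothesis Fonto : forall N, exists M, F M = N.
Hypothesis FU : forall M, \tr (A *m M) = 0 -> M \in unitmx -> F M \in unitmx.

Definition trace_adj (N : 'M[K]_n) : 'M[K]_n := \matrix_(i, j) \tr (N *m F (delta_mx j i)).

Lemma trace_adj_linear : linear trace_adj.
Proof.
by move=> a N N'; apply/matrixP => i j; rewrite !mxE mulmxDl -scalemxAl linearP.
Qed.
HB.instance Definition _ := GRing.isLinear.Build K 'M[K]_n 'M[K]_n _ trace_adj trace_adj_linear.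

Lemma trace_adjE N M : \tr (trace_adj N *m M) = \tr (N *m F M).
Proof.
have psi_lin : linear (fun X : 'M[K]_n => \tr (N *m F X) : K^o).
  by move=> a X Y; rewrite linearP mulmxDr -scalemxAr linearP.
pose psi : {linear 'M[K]_n -> K^o} := HB.pack (fun X : 'M[K]_n => \tr (N *m F X) : K^o)
  (GRing.isLinear.Build _ _ _ _ _ psi_lin).
have [C CE] := trace_form psi; rewrite -[RHS]/(psi M) CE; congr (\tr (_ *m _)).
by apply/matrixP => i j; rewrite mxE -tr_delta -CE.
Qed.

Lemma trace_adjA : trace_adj A = A.
Proof.
apply/eqP; rewrite -subr_eq0; apply/eqP/tr_nondeg => M.
by rewrite mulmxBl linearB /= trace_adjE FA subrr.
Qed.

Definition adj_dyads (x : 'cV[K]_n) : {vspace 'M[K]_n} :=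
  (linfun (trace_adj \o mulmx x : 'rV_n -> 'M_n) @: fullv)%VS.

Lemma dim_adj_dyads x : (\dim (adj_dyads x) <= n)%N.
Proof.
have := limg_ker_dim (linfun (trace_adj \o mulmx x : 'rV_n -> 'M_n)) fullv.
by rewrite dimvf dim_matrix mul1r => E; apply: leq_trans (eq_leq E); rewrite leq_addl.
Qed.

Lemma mem_adj_dyads x u : trace_adj (x *m u) \in adj_dyads x.
Proof. by apply/memv_imgP; exists u; rewrite ?memvf // lfunE. Qed.

Lemma orth_adj_dyads x M : orth (adj_dyads x) M <-> F M *m x = 0.
Proof.
split=> [xM|xM N /memv_imgP[u _ ->]]; last first.
  by rewrite lfunE /= trace_adjE tr_dyad -mulmxA xM mulmx0 mxE.
apply: trmx_inj; rewrite trmx0; apply: vanish_col => u; apply: trmx_inj.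
rewrite trmx_mul trmxK trmx0; apply/matrixP => i j; rewrite !ord1 mulmxA -tr_dyad -trace_adjE.
by rewrite xM ?mem_adj_dyads // mxE.
Qed.

(** [A] accounts for the condition M in V, and the pulled back dyads for F(M) x = 0. *)
Definition kill_space (x : 'cV[K]_n) : {vspace 'M[K]_n} := (<[A]> + adj_dyads x)%VS.

Lemma dim_kill_space x : (\dim (kill_space x) <= n.+1)%N.
Proof.
apply: leq_trans (leq_of_leqif (dimv_add_leqif _ _)) _.
by rewrite dim_vline A0 leq_add2l dim_adj_dyads.
Qed.

Lemma orth_kill_space x M : orth (kill_space x) M <-> \tr (A *m M) = 0 /\ F M *m x = 0.
Proof.
rewrite -orth_adj_dyads; split=> [xM|[AM xM] N /memv_addP[_ /vlineP[a ->] [N' N'x ->]]].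
  split=> [|N Nx]; first by apply: xM; apply: subvP (addvSl _ _) _ (memv_line _).
  by apply: xM; apply: subvP (addvSr _ _) _ Nx.
by rewrite mulmxDl -scalemxAl linearD linearZ /= AM mulr0 add0r xM.
Qed.

Lemma unit_kills (M : 'M[K]_n) (x : 'cV_n) : M \in unitmx -> M *m x = 0 -> x = 0.
Proof. by move=> Mu /(canRL (mulKmx Mu)) ->; rewrite mulmx0. Qed.

Lemma sing_kill_space x : x != 0 -> sing (kill_space x).
Proof.
move=> x0 M /orth_kill_space[/FU AM Mx]; apply/negP => /AM FMu.
by case/eqP: x0; apply: unit_kills Mx.
Qed.

Definition trmx_if (b : bool) (M : 'M[K]_n) := if b then M^T else M.

Lemma trmx_if_linear b : linear (trmx_if b).
Proof. by move=> a M N; case: b; rewrite //= linearP. Qed.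
HB.instance Definition _ b :=
  GRing.isLinear.Build K 'M[K]_n 'M[K]_n _ (trmx_if b) (@trmx_if_linear b).

Lemma tr_trmx_if b M N : \tr (M *m trmx_if b N) = \tr (trmx_if b M *m N).
Proof. by case: b => //=; rewrite -mxtrace_tr trmx_mul trmxK mxtrace_mulC. Qed.

Lemma trmx_trmx_if b M : (trmx_if b M)^T = trmx_if (~~ b) M.
Proof. by case: b => //=; rewrite trmxK. Qed.

Lemma trmx_ifK b : involutive (trmx_if b).
Proof. by case: b => // M; rewrite /= trmxK. Qed.

Definition preserver : Prop :=
  [/\ forall M, \tr (A *m F M) = \tr (A *m M), injective F &
      forall M, \tr (A *m M) = 0 -> M \in unitmx -> F M \in unitmx].

Definition frobenius_on : Prop := exists b P Q, [/\ P \in unitmx, Q \in unitmx &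
  forall M, \tr (A *m M) = 0 -> F M = P *m trmx_if b M *m Q].

(** [b] records the side of the dyads in the space attached to [x]: false for the y u with y fixed,
    true for the v z with z fixed, where z is read as a column on which the transpose acts. *)
Definition linked b (x y : 'cV[K]_n) :=
  forall M, \tr (A *m M) = 0 -> F M *m x = 0 -> trmx_if b M *m y = 0.

Lemma dyadic_linked x : dyadic (kill_space x) -> exists b, exists2 y, y != 0 & linked b x y.
Proof.
case=> [[y y0 yT]|[z z0 zT]].
  exists false, y => // M AM Mx; apply: trmx_inj; rewrite trmx0; apply: vanish_col => u.
  apply: trmx_inj; rewrite trmx_mul trmxK trmx0; apply/matrixP => i j; rewrite !ord1 mulmxA -tr_dyad.
  by rewrite mxE (iffRL (orth_kill_space x M)).
exists true, z^T; rewrite ?trmx_neq0 // => M AM Mx; apply: trmx_inj; rewrite /= trmx_mul !trmxK trmx0.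
apply: vanish_col => v; apply/matrixP => i j; rewrite !ord1 -tr_dyad mxE.
by rewrite (iffRL (orth_kill_space x M)).
Qed.

Lemma linear_mx p q (theta : {linear 'cV[K]_p -> 'cV[K]_q}) : exists Q, forall v, theta v = Q *m v.
Proof.
exists (\matrix_(i, j) theta (delta_mx j 0) i 0) => v.
rewrite [in LHS](matrix_sum_delta v) linear_sum; apply/matrixP => i j.
rewrite ord1 !mxE summxE; apply: eq_bigr => k _.
by rewrite big_ord1 linearZ !mxE mulrC.
Qed.

Definition trA (M : 'M[K]_n) : K^o := \tr (A *m M).
Lemma trA_linear : linear trA.
Proof. by move=> a M N; rewrite /trA mulmxDr -scalemxAr linearP. Qed.
HB.instance Definition _ := GRing.isLinear.Build K 'M[K]_n K^o _ trA trA_linear.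

Lemma linked_factor b x y : linked b x y ->
  exists Q, forall M, \tr (A *m M) = 0 -> trmx_if b M *m y = Q *m (F M *m x).
Proof.
move=> xy; have [|theta thE] := @linear_factor K _ _ _ (lker (linfun trA))
   (mulmxr x \o F) (mulmxr y \o trmx_if b : {linear 'M[K]_n -> 'cV_n}).
  by move=> M; rewrite memv_ker lfunE => /eqP AM /=; apply: xy.
have [Q QE] := linear_mx theta; exists Q => M AM.
by have := thE M; rewrite -QE /= => <- //; rewrite memv_ker lfunE /= /trA AM.
Qed.

Lemma annih_line N : (forall M, \tr (A *m M) = 0 -> \tr (N *m M) = 0) ->
  exists a, N = a *: A.
Proof. by move=> NA; apply/vlineP/orthK => M MA; apply: NA; apply: MA; apply: memv_line. Qed.

Lemma rank_le1 m p (B : 'M[K]_(m, p)) :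
    (forall w w' : 'rV_p, (w <= B)%MS -> (w' <= B)%MS ->
       exists a b, ((a != 0) || (b != 0)) /\ a *: w + b *: w' = 0) ->
  (\rank B <= 1)%N.
Proof.
move=> dep; have [->|B0] := eqVneq B 0; first by rewrite mxrank0.
have w0 : nz_row B != 0 by rewrite nz_row_eq0.
suff /mxrankS le : (B <= nz_row B)%MS by rewrite (leq_trans le) // rank_rV w0.
apply/row_subP => i; have [a [b [ab E]]] := dep _ _ (row_sub i B) (nz_row_sub B).
have a0 : a != 0.
  apply: contraTneq ab => a0; move/eqP: E; rewrite a0 eqxx scale0r add0r scaler_eq0 (negPf w0).
  by rewrite orbF => ->.
move/eqP: E; rewrite addr_eq0 => /eqP/(congr1 ( *:%R a^-1)).
by rewrite scalerA mulVf // scale1r => ->; rewrite scalemx_sub // eqmx_opp scalemx_sub.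
Qed.

(** For [w] in the row space of [B], the dyad [y *m w] is, up to transposition, orthogonal to V,
    hence a multiple of [A]. So this row space is at most a line. *)
Lemma rank_annih b m (y : 'cV_n) (B : 'M[K]_(m, n)) : y != 0 ->
  (forall M, \tr (A *m M) = 0 -> B *m trmx_if b M *m y = 0) -> (\rank B <= 1)%N.
Proof.
move=> y0 By; have ann w : (w <= B)%MS -> exists a, y *m w = a *: trmx_if b A.
  case/submxP => c ->; have [|a E] := @annih_line (trmx_if b (y *m (c *m B))).
    move=> M /By E; rewrite -tr_trmx_if tr_dyad -!mulmxA (mulmxA B) E mulmx0 mxE //.
  by exists a; rewrite -[LHS](trmx_ifK b) E linearZ.
apply: rank_le1 => w w' /ann[a wE] /ann[a' w'E].
have [w0|w0] := eqVneq w 0.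
  by exists 1, 0; rewrite oner_eq0 w0 scaler0 scale0r addr0.
exists a', (- a); rewrite oppr_eq0; split.
  apply/norP => -[]; rewrite !negbK => _ /eqP a0; case/eqP: w0.
  by apply: (dyad_eq0 y0); rewrite wE a0 scale0r.
apply: (dyad_eq0 y0); rewrite mulmxDr -!scalemxAr wE w'E scaleNr !scalerA mulrC.
by rewrite subrr.
Qed.

Lemma dyad_row m p (c d : 'cV[K]_m) (u z : 'rV[K]_p) :
  c != 0 -> c *m u = d *m z -> exists b, u = b *: z.
Proof.
move=> /nonzero_row[r rc] E; exists (((r *m c) 0 0)^-1 * (r *m d) 0 0).
have rc0 : (r *m c) 0 0 != 0.
  by apply: contra rc => /eqP rc; rewrite [_ *m _]mx11_scalar rc raddf0.
apply: (scalerI rc0); rewrite scalerA mulrA mulfV // mul1r -!mul_scalar_mx -!mx11_scalar.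
by rewrite -!mulmxA E.
Qed.

Lemma dyad_col m p (c d : 'cV[K]_m) (u z : 'rV[K]_p) :
  u != 0 -> c *m u = d *m z -> exists b, c = b *: d.
Proof.
rewrite -trmx_neq0 => u0 /(congr1 trmx); rewrite !trmx_mul => /(dyad_row u0)[b /(congr1 trmx)].
by rewrite linearZ /= !trmxK => ->; exists b.
Qed.

Definition separated (x x' : 'cV[K]_n) : Prop := exists p p' q : 'rV_n,
  [/\ p *m x = 1, p *m x' = 0, p' *m x = 0 & p' *m x' = 1] /\
  [/\ q *m x = 0, q *m x' = 0 & q *m A != 0].

Lemma reach x x' v v' : separated x x' ->
  exists M, [/\ \tr (A *m M) = 0, F M *m x = v & F M *m x' = v'].
Proof.
case=> p [p' [q [[px px' p'x p'x'] [qx qx' qA]]]].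
have [c qAc] := nonzero_col qA.
have s0 : (q *m A *m c) 0 0 != 0.
  by apply: contra qAc => /eqP E; rewrite [_ *m _]mx11_scalar E raddf0.
pose N0 := v *m p + v' *m p'; pose s := - \tr (A *m N0) / (q *m A *m c) 0 0.
have [M FM] := Fonto (N0 + s *: (c *m q)); exists M; split.
- have tcq : \tr (A *m (c *m q)) = (q *m A *m c) 0 0.
    by rewrite mulmxA mxtrace_mulC mulmxA trace_mx11.
  by rewrite -FA FM mulmxDr -scalemxAr mxtraceD mxtraceZ tcq mulfVK // addrN.
- rewrite FM !mulmxDl -scalemxAl -!mulmxA px p'x qx !mulmx0 scaler0 !addr0.
  by rewrite mulmx1.
rewrite FM !mulmxDl -scalemxAl -!mulmxA px' p'x' qx' !mulmx0 scaler0 !addr0 add0r.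
by rewrite mulmx1.
Qed.

Lemma trace_adj_inj N : trace_adj N = 0 -> N = 0.
Proof.
move=> N0; apply: tr_nondeg => M; have [M' <-] := Fonto M.
by rewrite -trace_adjE N0 mul0mx mxtrace0.
Qed.

Lemma full_image (T : {vspace 'M[K]_n}) (W : vectType K) (g : {linear W -> 'M[K]_n}) :
    \dim {: W} = n -> (\dim T <= n)%N -> (forall u, g u \in T) ->
    (forall u, g u = 0 -> u = 0) ->
  forall N, N \in T -> exists u, N = g u.
Proof.
move=> dimW dimT gT g0 N NT; pose L := (linfun g @: fullv)%VS.
have LT : (L <= T)%VS by apply/subvP => _ /memv_imgP[w _ ->]; rewrite lfunE /= gT.
have dimL : \dim L = n.
  rewrite limg_dim_eq ?dimW //.
  apply/eqP; rewrite -subv0; apply/subvP => w; rewrite memv_cap memv_ker lfunE /=.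
  by case/andP => _ /eqP/g0 ->; rewrite mem0v.
have /eqP TL : L == T by rewrite eqEdim LT dimL.
by move: NT; rewrite -TL => /memv_imgP[w _ ->]; exists w; rewrite lfunE.
Qed.

(** As tr (A M) = z F(M) d, the condition F(M) d = 0 already puts M in V. So [adj_dyads d], of
    dimension at most n, is dyadic without the help of [A]. It contains A = d z, which forces the
    common factor of its dyads to be d or z up to a scalar. *)
Lemma adj_dyads_rank1 (d : 'cV_n) (z : 'rV_n) : (2 <= n)%N -> d != 0 -> z != 0 -> A = d *m z ->
  (forall N, N \in adj_dyads d <-> exists u, N = d *m u) \/
  (forall N, N \in adj_dyads d <-> exists v, N = v *m z).
Proof.
move=> n2 d0 z0 AE.
have zA M : F M *m d = 0 -> \tr (A *m M) = 0.
  by move=> Md; rewrite -FA AE tr_dyad -mulmxA Md mulmx0 mxE.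
have sd : sing (adj_dyads d).
  move=> M /orth_adj_dyads Md; apply/negP => /(FU (zA M Md)) FMu.
  by case/eqP: d0; apply: unit_kills Md.
have td : dyadic (adj_dyads d).
  have := dim_adj_dyads d; move: (adj_dyads d) sd; case: (n) n2 => [//|[//|k]] _ T sT dimT.
  exact: sing_dyadic.
have AT : A \in adj_dyads d by rewrite -trace_adjA AE mem_adj_dyads.
have dimr : \dim {: 'rV[K]_n} = n by rewrite dimvf dim_matrix mul1r.
have dimc : \dim {: 'cV[K]_n} = n by rewrite dimvf dim_matrix mulr1.
case: td => [[c c0 cT]|[c c0 cT]]; [left|right].
  have cfull := full_image (g := mulmx c : {linear 'rV_n -> 'M_n}) dimr (dim_adj_dyads d) cT
    (fun u => dyad_eq0 c0).
  have [u /= uE] := cfull A AT.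
  have [|b cE] := @dyad_col _ _ c d u z _ (etrans (esym uE) AE).
    by apply: contra A0 => /eqP u0; rewrite uE u0 mulmx0.
  have b0 : b != 0 by apply: contraNneq c0 => b0; rewrite cE b0 scale0r.
  move=> N; split=> [/cfull[w /= ->]|[w ->]].
    by exists (b *: w); rewrite cE -scalemxAl scalemxAr.
  have := cT (b^-1 *: w); rewrite cE -scalemxAl -scalemxAr scalerA mulfV // scale1r //.
have cfull := full_image (g := mulmxr c : {linear 'cV_n -> 'M_n}) dimc (dim_adj_dyads d) cT
  (fun v => dyad_eq0r c0).
have [u /= uE] := cfull A AT.
have [|b cE] := @dyad_row _ _ u d c z _ (etrans (esym uE) AE).
  by apply: contra A0 => /eqP u0; rewrite uE u0 mul0mx.
have b0 : b != 0 by apply: contraNneq c0 => b0; rewrite cE b0 scale0r.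
move=> N; split=> [/cfull[w /= ->]|[w ->]].
  by exists (b *: w); rewrite cE -scalemxAl scalemxAr.
by have := cT (b^-1 *: w); rewrite cE -scalemxAl -scalemxAr scalerA mulVf // scale1r.
Qed.

(* As F M x and F M x' are independent, z^T M y = 0 on V, so that A is a dyad y' z^T; the structure of adj_dyads y' is
   then incompatible with each of the two links. *)
Lemma separated_mixed x x' y z : (2 <= n)%N -> separated x x' -> y != 0 -> z != 0 ->
  linked false x y -> linked true x' z -> False.
Proof.
move=> n2 xx' y0 z0 xy xz.
have [Q QE] := linked_factor xy; have [R RE] := linked_factor xz.
have QR M : \tr (A *m M) = 0 -> z^T *m Q *m (F M *m x) = (y^T *m R *m (F M *m x'))^T.
  move=> AM; rewrite -mulmxA -QE // -mulmxA -RE //= !trmx_mul !trmxK.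
  by rewrite mulmxA.
have zQ : z^T *m Q = 0.
  apply: vanish_col => v; have [M [AM Mx Mx']] := reach v 0 xx'.
  by rewrite -{1}Mx QR // Mx' mulmx0 trmx0.
have [|a aE] := @annih_line (y *m z^T).
  by move=> M AM; rewrite tr_dyad -mulmxA -[M]/(trmx_if false M) QE // mulmxA zQ mul0mx mxE.
have a0 : a != 0.
  apply: contra z0 => /eqP a0; move: aE; rewrite a0 scale0r => /(dyad_eq0 y0)/(congr1 trmx).
  by rewrite trmxK trmx0 => ->.
have AE : A = (a^-1 *: y) *m z^T by rewrite -scalemxAl aE scalerA mulVf // scale1r.
set d := a^-1 *: y in AE.
have d0 : d != 0 by rewrite scaler_eq0 invr_eq0 negb_or a0 y0.
have [p [p' [q [_ [qx qx' qA]]]]] := xx'.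
have qd : q *m d != 0 by apply: contra qA => /eqP E; rewrite AE mulmxA E mul0mx.
have [v v0 zv] : exists2 v : 'cV_n, v != 0 & z^T *m v = 0.
  have [|v v0 vz] := @annihilating_row K n <[z]>%VS; first by rewrite dim_vline z0.
  exists v^T; rewrite ?trmx_neq0 //; apply: trmx_inj.
  by rewrite trmx_mul !trmxK trmx0 vz ?memv_line.
have [M FM] := Fonto (v *m q).
have AM : \tr (A *m M) = 0.
  by rewrite -FA FM AE tr_dyad !mulmxA zv !mul0mx mxE.
have FMd : F M *m d != 0.
  rewrite FM -mulmxA; apply: contra qd => /eqP/(dyad_eq0 v0) ->; exact: eqxx.
have FMx : F M *m x = 0 by rewrite FM -mulmxA qx mulmx0.
have FMx' : F M *m x' = 0 by rewrite FM -mulmxA qx' mulmx0.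
case/eqP: FMd; apply/orth_adj_dyads => N NT.
have zt0 : z^T != 0 by rewrite trmx_neq0.
case: (adj_dyads_rank1 n2 d0 zt0 AE) => adjP; have /adjP[w ->] := NT.
  have My : M *m y = 0 by apply: (xy M).
  by rewrite tr_dyad -!mulmxA -!scalemxAr My mulmx0 scaler0 mxE.
have zM : z^T *m M = 0.
  by apply: trmx_inj; rewrite trmx_mul trmxK trmx0; apply: (xz M).
by rewrite tr_dyad zM mul0mx mxE.
Qed.

Lemma separatedC x x' : separated x x' -> separated x' x.
Proof. by case=> p [p' [q [[? ? ? ?] [? ? ?]]]]; exists p', p, q. Qed.

Lemma separated_linked b x x' y : (2 <= n)%N -> separated x x' -> y != 0 ->
  linked b x y -> dyadic (kill_space x') -> exists2 y', y' != 0 & linked b x' y'.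
Proof.
move=> n2 xx' y0 xy /dyadic_linked[b' [y' y'0 x'y']].
have [<-|bb'] := eqVneq b' b; first by exists y'.
case: b b' bb' xy x'y' => [] [] // _ xy x'y'.
  by have := separated_mixed n2 (separatedC xx') y'0 y0 x'y' xy.
by have := separated_mixed n2 xx' y0 y'0 xy x'y'.
Qed.

(** Up to transposition, every M in V with F(M) x = F(M) x' = 0 kills Y = (y, y', y''), so all the
    products Y U lie in a space of dimension at most 2 n + 1. An injective Y would give 3 n
    dimensions. *)
Lemma linked_dependent b x x' y y' y'' : (2 <= n)%N ->
    linked b x y -> linked b x' y' -> linked b (x + x') y'' ->
  exists c c' c'' : K, [|| c != 0, c' != 0 | c'' != 0] /\ c *: y + c' *: y' + c'' *: y'' = 0.
Proof.
move=> n2 xy xy' xy''; pose Y : 'M_(n, 1 + (1 + 1)) := row_mx y (row_mx y' y'').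
suff [c c0 Yc] : exists2 c : 'cV_(1 + (1 + 1)), c != 0 & Y *m c = 0.
  move: Yc; rewrite -[c]vsubmxK -[dsubmx c]vsubmxK /Y !mul_row_col.
  have sE (z : 'cV[K]_n) (e : 'M[K]_1) : z *m e = e 0 0 *: z.
    by rewrite -mul_mx_scalar -mx11_scalar.
  rewrite !sE addrA => Yc; eexists _, _, _; split; last exact: Yc.
  apply: contraNT c0; rewrite !negb_or !negbK => /and3P[/eqP e0 /eqP e1 /eqP e2].
  rewrite -[c]vsubmxK -[dsubmx c]vsubmxK [usubmx c]mx11_scalar e0.
  rewrite [usubmx _]mx11_scalar e1 [dsubmx (dsubmx c)]mx11_scalar e2.
  by rewrite raddf0 !col_mx0.
pose g : {linear 'M[K]_(3, n) -> 'M_n} := (trmx_if b \o mulmx (Y : 'M_(n, 3))).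
have [g0|ng] := classic (forall U, g U = 0 -> U = 0); last first.
  have [U [gU U0]] : exists U, g U = 0 /\ U <> 0.
    by apply: NNPP => nU; apply: ng => U gU; apply: NNPP => U0; apply: nU; exists U.
  have [v Uv] : exists v : 'cV_n, U *m v != 0 by apply: nonzero_col; apply/eqP.
  exists (U *m v) => //; rewrite mulmxA -[Y *m U](trmx_ifK b).
  by move: gU; rewrite /g /= => ->; rewrite linear0 mul0mx.
pose T2 := (kill_space x + adj_dyads x')%VS.
have dimT2 : (\dim T2 <= n.+1 + n)%N.
  apply: leq_trans (leq_of_leqif (dimv_add_leqif _ _)) _.
  by rewrite leq_add ?dim_kill_space ?dim_adj_dyads.
have gT2 U : g U \in T2.
  apply: orthK => M MT; have /orth_kill_space[AM Mx] : orth (kill_space x) M.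
    by move=> N NT; apply: MT; apply: subvP (addvSl _ _) _ NT.
  have /orth_adj_dyads Mx' : orth (adj_dyads x') M.
    by move=> N NT; apply: MT; apply: subvP (addvSr _ _) _ NT.
  rewrite /g /= -tr_trmx_if mxtrace_mulC mulmxA.
  suff -> : trmx_if b M *m Y = 0 by rewrite mul0mx mxtrace0.
  rewrite /Y (@mul_mx_row _ _ _ 1 2) (@mul_mx_row _ _ _ 1 1) (xy M) // (xy' M) // (xy'' M) //.
    by rewrite !row_mx0.
  by rewrite mulmxDr Mx Mx' addr0.
have : (\dim (linfun g @: fullv) <= n.+1 + n)%N.
  apply: leq_trans dimT2; apply: dimvS; apply/subvP => _ /memv_imgP[U _ ->].
  by rewrite lfunE gT2.
rewrite limg_dim_eq ?dimvf ?dim_matrix; last first.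
  apply/eqP; rewrite -subv0; apply/subvP => U; rewrite memv_cap memv_ker lfunE.
  by case/andP => _ /eqP/g0 ->; rewrite mem0v.
by rewrite -[(3 * n)%R]/(3 * n)%N; move: n2; lia.
Qed.

Lemma factor_neq0 b (x y : 'cV_n) (Q : 'M_n) : (2 <= n)%N -> y != 0 ->
  (forall M, \tr (A *m M) = 0 -> trmx_if b M *m y = Q *m (F M *m x)) -> Q != 0.
Proof.
move=> n2 y0 QE; apply: contraL n2 => /eqP Q0; rewrite -ltnNge ltnS.
have := @rank_annih b n y 1%:M y0; rewrite mxrank1; apply=> M AM.
by rewrite mul1mx QE // Q0 mul0mx.
Qed.

(** Since (F(M) x, F(M) x') is arbitrary, a relation between the three columns becomes c Q v + c' Q'
    v' + c'' Q'' (v + v') = 0 for all v and v'. The factors are thus proportional, with nonzero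
    coefficients as none of them is 0, and rescaling y' turns the factor at x' into Q. *)
Lemma factor_proportional b (x x' y y' : 'cV_n) (Q : 'M_n) : (2 <= n)%N ->
    separated x x' -> y != 0 -> y' != 0 -> dyadic (kill_space (x + x')) -> separated x (x + x') ->
    linked b x y -> linked b x' y' ->
    (forall M, \tr (A *m M) = 0 -> trmx_if b M *m y = Q *m (F M *m x)) ->
  exists2 z : 'cV_n, z != 0 & forall M, \tr (A *m M) = 0 -> trmx_if b M *m z = Q *m (F M *m x').
Proof.
move=> n2 xx' y0 y'0 typ'' sep'' xy xy' QE.
have [y'' y''0 xy''] := separated_linked n2 sep'' y0 xy typ''.
have [Q' Q'E] := linked_factor xy'; have [Q'' Q''E] := linked_factor xy''.
have Q0 := factor_neq0 n2 y0 QE; have Q'0 := factor_neq0 n2 y'0 Q'E.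
have Q''0 := factor_neq0 n2 y''0 Q''E.
have [c [c' [c'' [c0 cE]]]] := linked_dependent n2 xy xy' xy''.
have E (v v' : 'cV_n) : c *: (Q *m v) + c' *: (Q' *m v') + c'' *: (Q'' *m (v + v')) = 0.
  have [M [AM Mx Mx']] := reach v v' xx'.
  rewrite -Mx -Mx' -mulmxDr -QE // -Q'E // -Q''E // !scalemxAr -!mulmxDr cE.
  by rewrite mulmx0.
have E1 : c *: Q = - (c'' *: Q'').
  apply/eqP; rewrite -addr_eq0; apply/eqP/vanish_col => v.
  by have := E v 0; rewrite !mulmx0 scaler0 !addr0 mulmxDl -!scalemxAl.
have E2 : c' *: Q' = - (c'' *: Q'').
  apply/eqP; rewrite -addr_eq0; apply/eqP/vanish_col => v.
  by have := E 0 v; rewrite !mulmx0 scaler0 !add0r mulmxDl -!scalemxAl.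
have c''0 : c'' != 0.
  apply: contraTneq c0 => c''0; move/eqP: E1; move/eqP: E2.
  rewrite c''0 scale0r oppr0 !scaler_eq0 (negPf Q0) (negPf Q'0) !orbF => -> ->.
  by rewrite eqxx.
have c'0 : c' != 0.
  apply: contraNneq Q''0 => c'0; move/eqP: E2.
  by rewrite c'0 scale0r eq_sym oppr_eq0 scaler_eq0 (negPf c''0).
have cn0 : c != 0.
  apply: contraNneq Q''0 => cn0; move/eqP: E1.
  by rewrite cn0 scale0r eq_sym oppr_eq0 scaler_eq0 (negPf c''0).
exists ((c^-1 * c') *: y'); first by rewrite scaler_eq0 mulf_eq0 invr_eq0 !negb_or cn0 c'0 y'0.
move=> M AM; rewrite -scalemxAr Q'E // scalemxAl -scalerA E2 -E1 scalerA mulVf //.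
by rewrite scale1r.
Qed.

Lemma not_unit_kills (P : 'M[K]_n) : P \notin unitmx -> exists2 t : 'cV_n, t != 0 & P *m t = 0.
Proof.
rewrite -unitmx_tr => /det_singular/eqP/det0P[v v0 vP]; exists v^T; rewrite ?trmx_neq0 //.
by apply: trmx_inj; rewrite trmx_mul trmxK vP trmx0.
Qed.

(** If P t = 0, surjectivity of F gives Q N X t = 0 for all N in V, so Q has rank at most 1. Its
    left kernel kills all the M y, so it has rank at most 1 too, and n <= 2. Similarly, a row
    killing Q kills V, which is impossible. *)
Lemma frobenius_from_factor b (P Q X : 'M[K]_n) (x y : 'cV_n) : (3 <= n)%N ->
    X \in unitmx -> y != 0 ->
    (forall M, \tr (A *m M) = 0 -> trmx_if b M *m y = Q *m (F M *m x)) ->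
    (forall M, \tr (A *m M) = 0 -> trmx_if b M *m P = Q *m F M *m X) ->
  exists P' Q', [/\ P' \in unitmx, Q' \in unitmx &
    forall M, \tr (A *m M) = 0 -> F M = P' *m trmx_if b M *m Q'].
Proof.
move=> n3 Xu y0 QyE PE.
have Pu : P \in unitmx.
  apply: contraLR n3 => /not_unit_kills[t t0 Pt]; rewrite -ltnNge ltnS.
  have Xt0 : X *m t != 0.
    by apply: contra t0 => /eqP/(canRL (mulKmx Xu)) ->; rewrite mulmx0.
  have rQ : (\rank Q <= 1)%N.
    apply: (@rank_annih false _ _ _ Xt0) => N AN /=; have [M FM] := Fonto N.
    by rewrite mulmxA -FM -PE ?FA -?mulmxA ?Pt ?mulmx0 // -FA FM.
  have rk : (\rank (kermx Q) <= 1)%N.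
    apply: (@rank_annih b _ _ _ y0) => M AM.
    by rewrite -mulmxA QyE // !mulmxA mulmx_ker !mul0mx.
  move: rk rQ; rewrite mxrank_ker; lia.
have Qu : Q \in unitmx.
  apply: contraLR n3 => /det_singular/eqP/det0P[w w0 wQ]; rewrite -ltnNge ltnS.
  suff : (\rank (1%:M : 'M[K]_n) <= 1)%N by rewrite mxrank1; apply: leqW.
  apply: (@rank_annih (~~ b) _ w^T); first by rewrite trmx_neq0.
  move=> M AM; have wM : w *m trmx_if b M = 0.
    have := congr1 (mulmx w) (PE M AM); rewrite !mulmxA wQ !mul0mx.
    by move/(canRL (mulmxK Pu)); rewrite mul0mx.
  by rewrite mul1mx; apply: trmx_inj; rewrite trmx_mul trmxK trmx_trmx_if negbK wM trmx0.
exists (invmx Q), (P *m invmx X); rewrite unitmx_mul !unitmx_inv Pu Xu Qu; split=> // M AM.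
by rewrite mulmxA -(mulmxA _ _ P) PE // !mulmxA mulVmx // mul1mx mulmxK.
Qed.

(** All columns of [X] are compared with the column [i0]. A third index, available since n >= 3,
    provides the row q required by [separated]. *)
Lemma frobenius_of_dyadic (X : 'M[K]_n) (i0 : 'I_n) : (3 <= n)%N -> X \in unitmx ->
    (forall k, row k (invmx X) *m A != 0) ->
    (forall i, dyadic (kill_space (col i X))) ->
    (forall i, i != i0 -> dyadic (kill_space (col i0 X + col i X))) ->
  frobenius_on.
Proof.
move=> n3 Xu rowA typX typS; have n2 : (2 <= n)%N by apply: ltnW.
have dual i j : row i (invmx X) *m col j X = if i == j then 1 else 0 :> 'M_1.
  rewrite rowE colE mulmxA -(mulmxA _ _ X) mulVmx // mulmx1 mul_delta_mx_cond.
  by apply/matrixP => k l; rewrite !ord1; case: (i == j); rewrite !mxE ?eqxx.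
have sep i : i != i0 -> separated (col i0 X) (col i X) /\
                        separated (col i0 X) (col i0 X + col i X).
  move=> ii0; have [k] : exists k, k \notin [set i0; i].
    apply/existsP; rewrite -[[exists k, _]]negbK negb_exists; apply/negP => /forallP all.
    have : (#|'I_n| <= #|[set i0; i]|)%N.
      by apply: subset_leq_card; apply/subsetP => k _; have := all k; rewrite negbK.
    by rewrite card_ord cards2 leqNgt (leq_trans _ n3) // ltnS; case: (_ != _).
  rewrite !inE negb_or => /andP[ki0 ki]; split.
    exists (row i0 (invmx X)), (row i (invmx X)), (row k (invmx X)).
    by rewrite !dual !eqxx (negPf ii0) (eq_sym i0) (negPf ii0) (negPf ki0) (negPf ki).
  exists (row i0 (invmx X) - row i (invmx X)), (row i (invmx X)), (row k (invmx X)).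
  rewrite !mulmxDr !mulmxBl !dual !eqxx (negPf ii0) (eq_sym i0) (negPf ii0) (negPf ki0) (negPf ki).
  by rewrite subr0 sub0r addrN add0r addr0.
have [b [y0 y00 xy0]] := dyadic_linked (typX i0).
have [Q QE] := linked_factor xy0.
have ally i : exists y : 'cV_n, y != 0 /\
    forall M, \tr (A *m M) = 0 -> trmx_if b M *m y = Q *m (F M *m col i X).
  have [->|ii0] := eqVneq i i0; first by exists y0.
  have [si ssi] := sep i ii0; have [y y1 xy] := separated_linked n2 si y00 xy0 (typX i).
  have [z z0 zE] := factor_proportional n2 si y00 y1 (typS i ii0) ssi xy0 xy QE.
  by exists z.
have [y yP] := fin_all_exists ally; pose P := \matrix_(i, j) y j i 0.
exists b; apply: (frobenius_from_factor (P := P) (Q := Q) (x := col i0 X) n3 Xu y00 QE) => M AM.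
apply/matrixP => i j; have [_ /(_ M AM)/matrixP/(_ i 0)] := yP j.
rewrite -mulmxA colE !mulmxA -colE [X in _ = X -> _]mxE => <-.
by rewrite !mxE; apply: eq_bigr => l _; rewrite mxE.
Qed.

End Extension.

Lemma preserver_onto (K : fieldType) n (A : 'M[K]_n) (F : {linear 'M[K]_n -> 'M[K]_n}) :
  preserver A F -> forall N, exists M, F M = N.
Proof.
move=> [_ Finj _] N; have kF : lker (linfun F) == 0%VS.
  by apply/lker0P => X Y; rewrite !lfunE; apply: Finj.
by exists ((linfun F)^-1%VF N); have := lker0_lfunVK kF N; rewrite lfunE.
Qed.

(** * Size at least 4, and size 3 over more than two elements *)

Section Large.
Variable K : fieldType.

Lemma unit_map_rows p q (R R' : 'M[K]_(p, p + q)) : row_free R -> row_free R' ->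
  exists2 C, C \in unitmx & R *m C = R'.
Proof.
move=> /complete_rows[S Su] /complete_rows[S' S'u].
exists (invmx (col_mx R S) *m col_mx R' S'); first by rewrite unitmx_mul unitmx_inv Su S'u.
have RE : R = row_mx 1%:M 0 *m col_mx R S by rewrite mul_row_col mul1mx mul0mx addr0.
by rewrite {1}RE -mulmxA mulKVmx // mul_row_col mul1mx mul0mx addr0.
Qed.

Variables (n : nat) (A : 'M[K]_n).
Variable F : {linear 'M[K]_n -> 'M[K]_n}.
Hypothesis A0 : A != 0.
Hypothesis FA : forall M, \tr (A *m F M) = \tr (A *m M).
Hypothesis Fonto : forall N, exists M, F M = N.
Hypothesis FU : forall M, \tr (A *m M) = 0 -> M \in unitmx -> F M \in unitmx.

(** Each row of the inverse of [X] takes the value 1 at [A *m c]. *)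
Lemma basis_rows (X : 'M[K]_n) (c : 'cV_n) : X \in unitmx ->
  X *m const_mx 1 = A *m c -> forall k, row k (invmx X) *m A != 0.
Proof.
move=> Xu Xc k; apply/eqP => /(congr1 (mulmxr c)) /=; rewrite mul0mx -mulmxA -Xc.
rewrite rowE -mulmxA mulKmx // -rowE => /matrixP/(_ 0 0)/eqP.
by rewrite !mxE oner_eq0.
Qed.

Lemma unit_col_neq0 (X : 'M[K]_n) (v : 'cV_n) : X \in unitmx -> v != 0 -> X *m v != 0.
Proof. by move=> Xu; apply: contra => /eqP/(canRL (mulKmx Xu)) ->; rewrite mulmx0. Qed.

Lemma delta_neq0 (i : 'I_n) : (delta_mx i 0 : 'cV[K]_n) != 0.
Proof. by apply/eqP => /matrixP/(_ i 0)/eqP; rewrite !mxE !eqxx oner_eq0. Qed.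

Lemma delta_sum_neq0 (i j : 'I_n) : i != j -> (delta_mx i 0 + delta_mx j 0 : 'cV[K]_n) != 0.
Proof.
move=> ij; apply/eqP => /matrixP/(_ i 0)/eqP.
by rewrite !mxE !eqxx (negPf ij) addr0 oner_eq0.
Qed.

Lemma frobenius_of_all_dyadic : (3 <= n)%N ->
    (forall x, x != 0 -> dyadic (kill_space A F x)) ->
  frobenius_on A F.
Proof.
move=> n3 Atyp; have [c Ac] := nonzero_col A0.
have i0 : 'I_n by case: (n) n3 => // m _; exact: ord0.
have one0 : (const_mx 1 : 'cV[K]_n) != 0.
  by apply/eqP => /matrixP/(_ i0 0)/eqP; rewrite !mxE oner_eq0.
have [X Xu Xc] := unit_map one0 Ac.
apply: (frobenius_of_dyadic A0 FA Fonto FU (X := X) (i0 := i0)) => //.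
- exact: basis_rows Xc.
- by move=> i; apply: Atyp; rewrite colE unit_col_neq0 ?delta_neq0.
move=> i ii0; apply: Atyp; rewrite !colE -mulmxDr unit_col_neq0 ?delta_sum_neq0 //.
by rewrite eq_sym.
Qed.

End Large.

Lemma frobenius_ge4 (K : fieldType) (k : nat) (A : 'M[K]_(k.+4))
    (F : {linear 'M[K]_(k.+4) -> 'M[K]_(k.+4)}) :
  A != 0 -> preserver A F -> frobenius_on A F.
Proof.
move=> A0 FP; have [FA _ FU] := FP; have Fonto := preserver_onto FP.
apply: (frobenius_of_all_dyadic A0 FA Fonto FU) => // x x0.
by apply: sing_dyadicS; [apply: dim_kill_space|apply: sing_kill_space].
Qed.

(** * Size 3 with a scalar other than 0 and 1 *)

Section Three.
Variables (K : fieldType) (t : K) (A : 'M[K]_3).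
Variable F : {linear 'M[K]_3 -> 'M[K]_3}.
Hypothesis t0 : t != 0.
Hypothesis t1 : t != 1.
Hypothesis A0 : A != 0.
Hypothesis FA : forall M, \tr (A *m F M) = \tr (A *m M).
Hypothesis Fonto : forall N, exists M, F M = N.
Hypothesis FU : forall M, \tr (A *m M) = 0 -> M \in unitmx -> F M \in unitmx.

Lemma dyadic_or_compression x : x != 0 ->
  dyadic (kill_space A F x) \/ exists q c, compression (kill_space A F x) q c.
Proof. by move=> x0; apply: (sing_dyadic3 t0 t1); [apply: dim_kill_space|apply: sing_kill_space]. Qed.

Lemma mem_kill_space x : A \in kill_space A F x.
Proof. by apply: subvP (addvSl _ _) _ (memv_line _). Qed.

(** For x and d independent, injectivity of the adjoint of F implies that [kill_space A F x] meets
    [adj_dyads F d] only in multiples of A. A compression space containing A would share with it a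
    whole plane of dyads d w or v z. *)
Lemma dyadic_of_rank1 (d : 'cV_3) (z : 'rV_3) x : A = d *m z -> row_free (col_mx d^T x^T) ->
  dyadic (kill_space A F x).
Proof.
move=> AE fdx.
have indep u v : d *m u = x *m v -> u = 0.
  have dxE : d *m u - x *m v = row_mx d x *m col_mx u (- v).
    by rewrite (@mul_row_col _ _ 1 1) mulmxN.
  move/eqP; rewrite -subr_eq0 dxE => /eqP/(congr1 trmx).
  rewrite trmx_mul trmx0 tr_row_mx => E.
  have /(congr1 trmx) : (col_mx u (- v))^T = 0.
    have /row_freeP[B dB] := fdx.
    by rewrite -[LHS]mulmx1 -dB mulmxA E mul0mx.
  by rewrite trmxK trmx0 -col_mx0 => /(@eq_col_mx _ 1 1)[].
have d0 : d != 0 by apply: contraNneq A0 => d0; rewrite AE d0 mul0mx.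
have z0 : z != 0 by apply: contraNneq A0 => z0; rewrite AE z0 mulmx0.
have x0 : x != 0.
  apply: contraTneq fdx => ->; apply/negP => /row_freeP[B dB].
  move: row_mx01 => /(_ K)/eqP; apply; rewrite -[LHS]mulmx1 -dB mulmxA.
  by rewrite (@mul_row_col _ _ 1 1) mul0mx mul1mx add0r trmx0 mul0mx.
have [//|[q [c [q0 c0 TE]]]] := dyadic_or_compression x0.
have [qA Ac] := iffLR (TE A) (mem_kill_space x).
have qd : q *m d = 0 by apply: (dyad_eq0r z0); rewrite -mulmxA -AE.
have zc : z *m c = 0 by apply: (dyad_eq0 d0); rewrite mulmxA -AE.
have cap N : N \in kill_space A F x -> N \in adj_dyads F d -> exists a, N = a *: A.
  case/memv_addP => _ /vlineP[a ->] [_ /memv_imgP[u _ ->] ->] /memv_imgP[u' _].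
  rewrite !lfunE /= => E; exists a; rewrite E.
  have /(trace_adj_inj Fonto) : trace_adj F (a *: A + x *m u - d *m u') = 0.
    by rewrite linearB linearD linearZ /= (trace_adjA FA) E subrr.
  rewrite {1}AE scalemxAr addrAC -mulmxBr => /eqP; rewrite addr_eq0 -mulmxN => /eqP/indep/eqP.
  rewrite subr_eq0 => /eqP <-; rewrite -scalemxAr -AE linearZ /= (trace_adjA FA) //.
have [adjP|adjP] := adj_dyads_rank1 A0 FA FU isT d0 z0 AE.
  have : ~~ (kermx c <= z)%MS.
    apply/negP => /mxrankS; rewrite mxrank_ker !rank_rV z0.
    by have := rank_leq_col c; case: (\rank c) => [|[|]].
  case/row_subPn => i; set w := row i _ => wz.
  have wc : w *m c = 0 by rewrite /w rowE -mulmxA mulmx_ker mulmx0.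
  have [||a] := cap (d *m w).
  - by apply/TE; rewrite mulmxA qd mul0mx -mulmxA wc mulmx0.
  - by apply/adjP; exists w.
  rewrite AE scalemxAr => /eqP; rewrite -subr_eq0 -mulmxBr => /eqP/(dyad_eq0 d0)/eqP.
  by rewrite subr_eq0 => /eqP wE; rewrite wE scalemx_sub in wz.
have : ~~ (kermx q^T <= d^T)%MS.
  apply/negP => /mxrankS; rewrite mxrank_ker !rank_rV trmx_neq0 d0 mxrank_tr.
  by have := rank_leq_row q; case: (\rank q) => [|[|]].
case/row_subPn => i; set w := row i _ => wd.
have wq : q *m w^T = 0.
  by apply: trmx_inj; rewrite trmx_mul trmxK trmx0 /w rowE -mulmxA mulmx_ker mulmx0.
have [||a] := cap (w^T *m z).
- by apply/TE; rewrite mulmxA wq mul0mx -mulmxA zc mulmx0.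
- by apply/adjP; exists w^T.
rewrite AE scalemxAl => /eqP; rewrite -subr_eq0 -mulmxBl => /eqP/(dyad_eq0r z0)/eqP.
rewrite subr_eq0 => /eqP/(congr1 trmx); rewrite trmxK => wE.
by rewrite wE linearZ scalemx_sub in wd.
Qed.

(** Both spaces contain [A], which has rank at least 2 and therefore determines q and c up to
    scalars. *)
Lemma compression_unique x x' q c q' c' : (1 < \rank A)%N ->
    compression (kill_space A F x) q c -> compression (kill_space A F x') q' c' ->
  kill_space A F x = kill_space A F x'.
Proof.
move=> rA [q0 c0 TE] [q'0 c'0 TE'].
have [qA Ac] := iffLR (TE A) (mem_kill_space x); have [q'A Ac'] := iffLR (TE' A) (mem_kill_space x').
have line (B : 'M[K]_3) (p p' : 'rV_3) : (1 < \rank B)%N -> p != 0 -> p *m B = 0 ->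
    p' *m B = 0 -> exists b, p' = b *: p.
  move=> rB p0 /sub_kermxP pB /sub_kermxP p'B; apply/sub_rVP; apply: submx_trans p'B _.
  rewrite -(geq_leqif (mxrank_leqif_sup pB)) mxrank_ker rank_rV p0.
  by move: rB; have := rank_leq_row B; case: (\rank B) => [|[|[|[|]]]].
have [b qE] := line A q q' rA q0 qA q'A.
have [||||b' cE] := line A^T c^T c'^T.
- by rewrite mxrank_tr.
- by rewrite trmx_neq0.
- by rewrite -trmx_mul Ac trmx0.
- by rewrite -trmx_mul Ac' trmx0.
have {}cE : c' = b' *: c by apply: trmx_inj; rewrite cE linearZ.
have b0 : b != 0 by apply: contraNneq q'0 => b0; rewrite qE b0 scale0r.
have b'0 : b' != 0 by apply: contraNneq c'0 => bz; rewrite cE bz scale0r.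
apply/vspaceP => N; apply/idP/idP => [/TE[qN Nc]|/TE'[]].
  by apply/TE'; rewrite qE cE -scalemxAl -scalemxAr qN Nc !scaler0.
rewrite qE cE -scalemxAl -scalemxAr => qN Nc; apply/TE; split.
  by move/eqP: qN; rewrite scaler_eq0 (negPf b0) => /eqP.
by move/eqP: Nc; rewrite scaler_eq0 (negPf b'0) => /eqP.
Qed.

(** If x' is not a multiple of x, some row r kills x but not x'. With v != 0 such that r A v = 0,
    the dyad v r is F(M) for an M in V that separates the two spaces. *)
Lemma kill_space_inj x x' : x != 0 -> kill_space A F x = kill_space A F x' -> exists s, x' = s *: x.
Proof.
move=> x0 TT; apply: NNPP => nx.
have nle : ~~ (x'^T <= x^T)%MS.
  by apply/negP => /sub_rVP[s /(congr1 trmx)]; rewrite linearZ /= !trmxK => E; apply: nx; exists s.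
have [r rx rx'] : exists2 r : 'rV_3, r *m x = 0 & r *m x' != 0.
  move: nle; rewrite submxE => E; pose C := cokermx x^T; rewrite -/C in E.
  have [w] := nonzero_col E; exists (C *m w)^T.
    by apply: trmx_inj; rewrite trmx_mul trmxK trmx0 mulmxA mulmx_coker mul0mx.
  by rewrite -trmx_neq0 trmx_mul trmxK mulmxA.
have [|v v0 vA] := @annihilating_row K 3 <[(r *m A)^T]>%VS.
  by rewrite dim_vline; case: (_ != _).
have rAv : r *m A *m v^T = 0.
  by apply: trmx_inj; rewrite trmx_mul trmxK trmx0 vA ?memv_line.
have [M FM] := Fonto (v^T *m r).
have AM : \tr (A *m M) = 0.
  by rewrite -FA FM mulmxA mxtrace_mulC mulmxA rAv mxtrace0.
have : orth (kill_space A F x) M by apply/orth_kill_space; rewrite FM -mulmxA rx mulmx0.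
rewrite TT => /orth_kill_space[_]; rewrite FM -mulmxA => /dyad_eq0; rewrite trmx_neq0 => /(_ v0) E.
by rewrite E eqxx in rx'.
Qed.

(** The columns to be tested are, in the basis [X], the e_i and the e_0 + e_i. [S] is a property of
    these coordinates that keeps them away from the exceptional columns. *)
Lemma basis_points (X : 'M[K]_3) (S : 'cV_3 -> Prop) :
    (forall i, S (delta_mx i 0)) -> (forall i, i != 0 -> S (delta_mx 0 0 + delta_mx i 0)) ->
    X \in unitmx -> (exists c : 'cV_3, X *m const_mx 1 = A *m c) ->
    (forall e, e != 0 -> S e -> dyadic (kill_space A F (X *m e))) ->
  frobenius_on A F.
Proof.
move=> Sd Sdd Xu [c Xc] Styp; apply: (frobenius_of_dyadic A0 FA Fonto FU (X := X) (i0 := 0)) => //.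
- exact: basis_rows Xc.
- by move=> i; rewrite colE; apply: Styp; rewrite ?delta_neq0.
by move=> i i0; rewrite !colE -mulmxDr; apply: Styp; [apply: delta_sum_neq0; rewrite eq_sym|apply: Sdd].
Qed.

Lemma frobenius_three : frobenius_on A F.
Proof.
have [c Ac] := nonzero_col A0.
have one0 : (const_mx 1 : 'cV[K]_3) != 0.
  by apply/eqP => /matrixP/(_ 0 0)/eqP; rewrite !mxE oner_eq0.
have [Y Yu Yc] := unit_map one0 Ac.
(* All the coordinates to be tested have a zero, so none is a multiple of the all-ones column, which
   [Y] sends to A c. *)
pose hole (e : 'cV[K]_3) := exists j, e j 0 = 0.
have hole1 i : hole (delta_mx i 0).
  exists (if i == 0 then 1 else 0); rewrite mxE.
  by case: i => [[|[|[|//]]] ?].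
have hole2 i : i != 0 -> hole (delta_mx 0 0 + delta_mx i 0).
  move=> i0; exists (if i == 1 then 2%:R else 1); move: i0; rewrite !mxE.
  by case: i => [[|[|[|//]]] ?] //= _; rewrite ?addr0.
have hole_one e r : e != 0 -> hole e -> e <> r *: const_mx 1.
  move=> e0 [j ej] E; move: (ej); rewrite E !mxE mulr1 => r0.
  by case/eqP: e0; rewrite E r0 scale0r.
have [rA|rA] := leqP (\rank A) 1.
  have [d [z AE]] := rank1_dyad rA.
  have zc : (z *m c) 0 0 != 0.
    by apply: contra Ac => /eqP zc; rewrite AE -mulmxA [z *m c]mx11_scalar zc raddf0 mulmx0.
  set s := (z *m c) 0 0 in zc.
  apply: (basis_points hole1 hole2 Yu); first by exists c.
  move=> e e0 [j ej]; apply: (dyadic_of_rank1 AE); apply: row_free2 => a b E.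
  have dE : d = s^-1 *: (Y *m const_mx 1).
    by rewrite Yc AE -mulmxA [z *m c]mx11_scalar mul_mx_scalar -/s scalerA mulVf // scale1r.
  have {}E : a * s^-1 *: const_mx 1 + b *: e = 0.
    apply: (can_inj (mulKmx Yu)); rewrite mulmxDr -!scalemxAr mulmx0 -[RHS]E dE.
    by rewrite scalerA.
  have a0 : a = 0.
    have := congr1 (fun M : 'cV_3 => M j 0) E; rewrite !mxE ej mulr1 mulr0 addr0.
    by move/eqP; rewrite mulf_eq0 invr_eq0 (negPf zc) orbF => /eqP.
  split=> //; move/eqP: E; rewrite a0 mul0r scale0r add0r scaler_eq0 (negPf e0) orbF.
  by move/eqP.
have [all|] := classic (forall x, x != 0 -> dyadic (kill_space A F x)).
  exact: frobenius_of_all_dyadic.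
move=> nall; have [x0 [x00 nx0]] : exists x0, x0 != 0 /\ ~ dyadic (kill_space A F x0).
  by apply: NNPP => nx; apply: nall => x x0; apply: NNPP => nt; apply: nx; exists x.
have [//|[q0 [c0 comp0]]] := dyadic_or_compression x00.
have good x : x != 0 -> (forall s, x <> s *: x0) -> dyadic (kill_space A F x).
  move=> xn0 xx0; have [//|[q [c' comp]]] := dyadic_or_compression xn0.
  by have [s E] := kill_space_inj x00 (compression_unique rA comp0 comp); case: (xx0 s).
have [[s x0s]|nx0a] := classic (exists s, x0 = s *: (A *m c)).
  apply: (basis_points hole1 hole2 Yu); first by exists c.
  move=> e e0 eh; apply: good; first by rewrite unit_col_neq0.
  move=> r; rewrite x0s -Yc scalerA scalemxAr => /(can_inj (mulKmx Yu)).
  exact: hole_one.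
(* (0, 1, 1) is proportional to no e_i and no e_0 + e_i, and independent of the all-ones column. So
   [X] can send it to the exceptional [x0], and the all-ones column to A c. *)
pose d : 'cV[K]_3 := \col_i (i != 0)%:R.
have fa : row_free (col_mx (A *m c)^T x0^T).
  apply: row_free2 => a b E; have b0 : b = 0.
    apply/eqP; apply: contraT => b0; case: nx0a; exists (- (b^-1 * a)).
    move/eqP: E; rewrite addrC addr_eq0 => /eqP/(congr1 ( *:%R b^-1)).
    by rewrite scalerA mulVf // scale1r => ->; rewrite scalerN scalerA scaleNr.
  by move/eqP: E; rewrite b0 scale0r addr0 scaler_eq0 (negPf Ac) orbF => /eqP.
have fd : row_free (col_mx (const_mx 1 : 'cV[K]_3)^T d^T).
  apply: row_free2 => a b E; have a0 : a = 0.
    by have := congr1 (fun M : 'cV_3 => M 0 0) E; rewrite !mxE /= mulr1 mulr0 addr0.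
  split=> //; have := congr1 (fun M : 'cV_3 => M 1 0) E.
  by rewrite !mxE /= a0 mul0r add0r mulr1.
have [C Cu CE] := @unit_map_rows K 2 1 _ _ fd fa.
pose X := C^T; have Xu : X \in unitmx by rewrite unitmx_tr.
move: CE; rewrite (@mul_col_mx _ 1 1) => /(@eq_col_mx _ 1 1)[/(congr1 trmx) X1 /(congr1 trmx) Xd].
rewrite trmx_mul !trmxK -/X in X1; rewrite trmx_mul !trmxK -/X in Xd.
pose S (e : 'cV[K]_3) := forall r, e <> r *: d.
apply: (@basis_points X S) => //; last 1 first.
- move=> e e0 Se; apply: good; first by rewrite unit_col_neq0.
  by move=> r; rewrite -Xd scalemxAr => /(can_inj (mulKmx Xu)); apply: Se.
- move=> i r /matrixP E; have := E 2%:R 0; have := E 1 0; have := E 0 0; rewrite !mxE.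
  case: i E => [[|[|[|//]]] ?] _ /=; rewrite ?mulr0 ?mulr1.
  + by move/eqP; rewrite oner_eq0.
  + by move=> _ <- /eqP; rewrite eq_sym oner_eq0.
  + by move=> _ <- /eqP; rewrite oner_eq0.
- move=> i i0 r /matrixP/(_ 0 0); rewrite !mxE; case: i i0 => [[|[|[|//]]] ?] //= _.
  + by rewrite mulr0 addr0 => /eqP; rewrite oner_eq0.
  + by rewrite mulr0 addr0 => /eqP; rewrite oner_eq0.
by exists c.
Qed.

End Three.

(** * Size 2 *)

Section Two.
Variable K : fieldType.

Definition mx2 (a b c d : K) : 'M[K]_2 :=
  \matrix_(i, j) if i == 0 then (if j == 0 then a else b) else (if j == 0 then c else d).

Lemma mx2E (M : 'M[K]_2) : M = mx2 (M 0 0) (M 0 1) (M 1 0) (M 1 1).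
Proof.
by apply/matrixP => -[[|[|//]] ?] [[|[|//]] ?]; rewrite !mxE /=; congr (M _ _); apply: val_inj.
Qed.

Lemma mx2_00 a b c d : mx2 a b c d 0 0 = a. Proof. by rewrite mxE. Qed.
Lemma mx2_01 a b c d : mx2 a b c d 0 1 = b. Proof. by rewrite mxE. Qed.
Lemma mx2_10 a b c d : mx2 a b c d 1 0 = c. Proof. by rewrite mxE. Qed.
Lemma mx2_11 a b c d : mx2 a b c d 1 1 = d. Proof. by rewrite mxE. Qed.
Definition mx2_entry := (mx2_00, mx2_01, mx2_10, mx2_11).

Lemma mx2D a b c d a' b' c' d' :
  mx2 a b c d + mx2 a' b' c' d' = mx2 (a + a') (b + b') (c + c') (d + d').
Proof. by rewrite [LHS]mx2E !mxE. Qed.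

Lemma mx2Z s a b c d : s *: mx2 a b c d = mx2 (s * a) (s * b) (s * c) (s * d).
Proof. by rewrite [LHS]mx2E !mxE. Qed.

Lemma mx2M a b c d a' b' c' d' : mx2 a b c d *m mx2 a' b' c' d' =
  mx2 (a * a' + b * c') (a * b' + b * d') (c * a' + d * c') (c * b' + d * d').
Proof. by rewrite [LHS]mx2E !mxE !big_ord_recl !big_ord0 !mxE /= !addr0. Qed.

Lemma mx2T a b c d : (mx2 a b c d)^T = mx2 a c b d.
Proof. by rewrite [LHS]mx2E !mxE. Qed.

Lemma mx2_unit a b c d : (mx2 a b c d \in unitmx) = (a * d - b * c != 0).
Proof. by rewrite unitmxE unitfE det2E !mx2_entry. Qed.

Lemma mx2_inj a b c d a' b' c' d' :
  mx2 a b c d = mx2 a' b' c' d' -> [/\ a = a', b = b', c = c' & d = d'].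
Proof.
by move=> E; split; [have := congr1 (fun M : 'M_2 => M 0 0) E|
  have := congr1 (fun M : 'M_2 => M 0 1) E|have := congr1 (fun M : 'M_2 => M 1 0) E|
  have := congr1 (fun M : 'M_2 => M 1 1) E]; rewrite !mxE.
Qed.

Lemma sym_rank1 (S : 'M[K]_2) : S^T = S -> S \notin unitmx -> S != 0 ->
  exists (l : K) (x : 'cV_2), [/\ l != 0, x != 0 & S = l *: (x *m x^T)].
Proof.
move=> ST nS S0; have : (\rank S <= 1)%N.
  have := rank_leq_row S; rewrite leq_eqVlt ltnS => /orP[fS|//].
  by move: nS; rewrite -row_free_unit /row_free fS.
case/rank1_dyad => x [u SE].
have x0 : x != 0 by apply: contraNneq S0 => x0; rewrite SE x0 mul0mx.
have [|b uE] := @dyad_row K 2 2 x u^T u x^T x0; first by rewrite -trmx_mul -SE ST SE.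
exists b, x; split=> //; last by rewrite SE uE scalemxAr.
by apply: contraNneq S0 => b0; rewrite SE uE b0 scale0r mulmx0.
Qed.

(* At t = -1/p the hypothesis reads 0 = q^2 / p^2; for r, take t = -r/e. *)
Lemma conic_coeffs (p q r e : K) : e != 0 -> q != 0 ->
  (forall t, (1 + t * p) * (t ^+ 2 * e + t * r) = t ^+ 2 * q ^+ 2) ->
  [/\ p = 0, r = 0 & e = q ^+ 2].
Proof.
move=> e0 q0 E; have p0 : p = 0.
  apply/eqP; apply: contraT => p0; have := E (- p^-1).
  rewrite mulNr mulVf // subrr mul0r => /esym/eqP.
  by rewrite sqrrN mulf_eq0 !expf_eq0 /= invr_eq0 (negPf p0) (negPf q0).
have r0 : r = 0.
  apply/eqP; apply: contraT => r0; have := E (- (r / e)).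
  have -> : (- (r / e)) ^+ 2 * e + - (r / e) * r = 0 by field.
  rewrite mulr0 => /esym/eqP.
  by rewrite sqrrN mulf_eq0 !expf_eq0 /= mulf_eq0 invr_eq0 (negPf r0) (negPf e0) (negPf q0).
by split=> //; have := E 1; rewrite p0 r0 mulr0 !addr0 expr1n !mul1r.
Qed.

(** [P] is the basis in which the images of [E0] and [E1] are diagonal matrix units up to scalars,
    and [T] is the image of [E2] there. Singularity at the points (1, t, t^2) of the conic forces p
    = r = 0 and e = q^2, so that G is, up to the scalar [l0], the congruence by P diag (1, q). *)
Lemma sym_preserver (G : {linear 'M[K]_2 -> 'M[K]_2}) :
    (forall S, S^T = S -> (G S)^T = G S) ->
    (forall S, S^T = S -> S \notin unitmx -> G S \notin unitmx) ->
    (forall S, S^T = S -> G S = 0 -> S = 0) ->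
  exists P Q, [/\ P \in unitmx, Q \in unitmx & forall S, S^T = S -> G S = P *m S *m Q].
Proof.
move=> Gsym Gsing Ginj.
pose E0 := mx2 1 0 0 0; pose E1 := mx2 0 0 0 1; pose E2 := mx2 0 1 1 0.
have E0T : E0^T = E0 by rewrite mx2T.
have E1T : E1^T = E1 by rewrite mx2T.
have E2T : E2^T = E2 by rewrite mx2T.
have GE S : S^T = S -> S \notin unitmx -> S <> 0 ->
    exists (l : K) (x : 'cV_2), [/\ l != 0, x != 0 & G S = l *: (x *m x^T)].
  move=> ST Su S0; apply: sym_rank1; [exact: Gsym|exact: Gsing|].
  by apply/eqP => /(Ginj _ ST).
have [|| l0 [p0 [l00 p00 GE0]]] := GE _ E0T.
- by rewrite mx2_unit mulr0 mulr0 subrr eqxx.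
- by move/(congr1 (fun M : 'M_2 => M 0 0))/eqP; rewrite !mxE oner_eq0.
have [|| l1 [p1 [l10 p10 GE1]]] := GE _ E1T.
- by rewrite mx2_unit mul0r mulr0 subrr eqxx.
- by move/(congr1 (fun M : 'M_2 => M 1 1))/eqP; rewrite !mxE oner_eq0.
pose P : 'M[K]_2 := row_mx p0 p1.
have Pu : P \in unitmx.
  rewrite -unitmx_tr /P (@tr_row_mx _ 2 1 1) -row_free_unit; apply: row_free2 => a b ab.
  have b0 : b = 0.
    apply/eqP; apply: contraT => b0.
    have p1E : p1 = (- (b^-1 * a)) *: p0.
      move/eqP: ab; rewrite addrC addr_eq0 => /eqP/(congr1 ( *:%R b^-1)).
      by rewrite scalerA mulVf // scale1r => ->; rewrite scalerN scalerA scaleNr.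
    set s := - _ in p1E; pose c := l1 * s * s / l0.
    have : G (E1 - c *: E0) = 0.
      rewrite linearB linearZ /= GE1 GE0 p1E [(_ *: _)^T]linearZ /= -scalemxAl -scalemxAr !scalerA.
      by rewrite /c mulfVK // subrr.
    have ET : (E1 - c *: E0)^T = E1 - c *: E0 by rewrite linearB linearZ /= E1T E0T.
    move/(Ginj _ ET)/eqP; rewrite subr_eq0 mx2Z => /eqP/mx2_inj[_ _ _ /eqP].
    by rewrite mulr0 oner_eq0.
  by split=> //; move/eqP: ab; rewrite b0 scale0r addr0 scaler_eq0 (negPf p00) orbF => /eqP.
have PE i : P *m delta_mx i 0 = if i == 0 then p0 else p1.
  rewrite -colE; case: i => [[|[|//]] ?] /=; apply/matrixP => k l; rewrite !ord1 mxE.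
    by rewrite -[RHS](@row_mxEl _ 2 1 1 p0 p1); congr (P _ _); apply: val_inj.
  by rewrite -[RHS](@row_mxEr _ 2 1 1 p0 p1); congr (P _ _); apply: val_inj.
have E0d : E0 = (delta_mx 0 0 : 'cV_2) *m (delta_mx 0 0 : 'cV_2)^T.
  by rewrite trmx_delta mul_delta_mx [RHS]mx2E !mxE.
have E1d : E1 = (delta_mx 1 0 : 'cV_2) *m (delta_mx 1 0 : 'cV_2)^T.
  by rewrite trmx_delta mul_delta_mx [RHS]mx2E !mxE.
have {}GE0 : G E0 = l0 *: (P *m E0 *m P^T).
  by rewrite GE0 E0d mulmxA PE -mulmxA -trmx_mul PE.
pose e := l1 / l0; have e0 : e != 0 by rewrite mulf_neq0 ?invr_eq0.
have {}GE1 : G E1 = l0 *: (P *m (e *: E1) *m P^T).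
  rewrite GE1 -scalemxAr -scalemxAl scalerA mulrC mulfVK // E1d mulmxA PE.
  by rewrite -mulmxA -trmx_mul PE.
pose T := l0^-1 *: (invmx P *m G E2 *m (invmx P)^T).
have GE2 : G E2 = l0 *: (P *m T *m P^T).
  rewrite /T -scalemxAr -scalemxAl scalerA mulfV // scale1r !mulmxA mulmxV // mul1mx.
  by rewrite -mulmxA -trmx_mul mulmxV // trmx1 mulmx1.
have TT : T^T = T.
  by rewrite /T linearZ /= !trmx_mul !trmxK Gsym // mulmxA.
pose p := T 0 0; pose q := T 0 1; pose r := T 1 1.
have TE : T = mx2 p q q r.
  by rewrite [T]mx2E; congr mx2; rewrite -{1}TT mxE.
have push c X : c *: (P *m X *m P^T) = P *m (c *: X) *m P^T.
  by rewrite -scalemxAr -scalemxAl.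
have GS a b c : G (mx2 a b b c) =
    l0 *: (P *m mx2 (a + b * p) (b * q) (b * q) (b * r + c * e) *m P^T).
  have -> : mx2 a b b c = a *: E0 + b *: E2 + c *: E1.
    by rewrite !mx2Z !mx2D !(mulr0, mulr1, addr0, add0r).
  rewrite !linearD !linearZ /= GE0 GE1 GE2 -!scalerA !(scalerA _ l0) ![_ * l0]mulrC -!(scalerA l0).
  rewrite -!scalerDr; congr (_ *: _); rewrite !push -!mulmxDl -!mulmxDr.
  by rewrite TE !mx2Z !mx2D !(mulr0, mulr1, addr0, add0r).
have q0 : q != 0.
  (* If q = 0, then [T] is diagonal, and a combination of [E0] and [E1] cancels the image of
     [E2]. *)
  apply/eqP => q0; have /Ginj E : G (mx2 (- p) 1 1 (- (r / e))) = 0.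
    rewrite GS q0 !mul1r addNr mulNr mulfVK // addrN.
    have -> : mx2 0 0 0 0 = 0 :> 'M[K]_2 by rewrite [RHS]mx2E !mxE.
    by rewrite mulmx0 mul0mx scaler0.
  have /matrixP/(_ 0 1)/eqP := E (mx2T _ _ _ _).
  by rewrite !mxE oner_eq0.
have [|p_0 r_0 eE] := conic_coeffs e0 q0 (p := p) (r := r).
  move=> t; have : G (mx2 1 t t (t ^+ 2)) \notin unitmx.
    by apply: Gsing; rewrite ?mx2T // mx2_unit mul1r expr2 subrr eqxx.
  rewrite GS unitmxZ ?unitfE // !unitmx_mul unitmx_tr Pu andbT /= mx2_unit negbK subr_eq0.
  by move/eqP; rewrite (addrC (t * r)) => ->; rewrite -expr2 exprMn.
exists (l0 *: (P *m mx2 1 0 0 q)), (mx2 1 0 0 q *m P^T); split.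
- by rewrite unitmxZ ?unitfE // unitmx_mul Pu mx2_unit mul1r mulr0 subr0.
- by rewrite unitmx_mul unitmx_tr Pu mx2_unit mul1r mulr0 subr0 q0.
move=> S ST; have S10 : S 1 0 = S 0 1 by rewrite -{1}ST mxE.
rewrite [S]mx2E S10 GS p_0 r_0 eE -!scalemxAl; congr (_ *: _).
rewrite [RHS](_ : _ = P *m (mx2 1 0 0 q *m mx2 (S 0 0) (S 0 1) (S 0 1) (S 1 1) *m
  mx2 1 0 0 q) *m P^T); last by rewrite !mulmxA.
rewrite !mx2M; congr (_ *m mx2 _ _ _ _ *m _); ring.
Qed.

(** The determinant is here minus the product of the off-diagonal entries b and c. The off-diagonal
    entries of G N are nonzero linear forms by surjectivity, and their product vanishes whenever b c
    = 0. Hence one is proportional to b and the other to c, and their order decides the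
    transposition. *)
Lemma corner_preserver (G : {linear 'M[K]_2 -> 'M[K]_2}) :
    (forall N : 'M_2, N 1 1 = 0 -> G N 1 1 = 0) ->
    (forall N : 'M_2, N 1 1 = 0 -> N \notin unitmx -> G N \notin unitmx) ->
    (forall N : 'M_2, N 1 1 = 0 -> G N = 0 -> N = 0) ->
    (forall N : 'M_2, N 1 1 = 0 -> exists2 M : 'M_2, M 1 1 = 0 & G M = N) ->
  exists b P Q, [/\ P \in unitmx, Q \in unitmx &
    forall N : 'M_2, N 1 1 = 0 -> G N = P *m trmx_if b N *m Q].
Proof.
move=> G11 Gsing Ginj Gonto.
pose E0 := mx2 1 0 0 0; pose E1 := mx2 0 1 0 0; pose E2 := mx2 0 0 1 0.
pose g i := G (if i == 0%N then E0 else if i == 1%N then E1 else E2).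
have gE i : g i = mx2 (g i 0 0) (g i 0 1) (g i 1 0) 0.
  rewrite {1}[g i]mx2E; congr mx2; apply: G11.
  by case: ifP => _; [|case: ifP => _]; rewrite mx2_11.
have GE a b c : G (mx2 a b c 0) = mx2 (a * g 0 0 0 + b * g 1 0 0 + c * g 2 0 0)
    (a * g 0 0 1 + b * g 1 0 1 + c * g 2 0 1) (a * g 0 1 0 + b * g 1 1 0 + c * g 2 1 0) 0.
  have -> : mx2 a b c 0 = a *: E0 + b *: E1 + c *: E2.
    by rewrite !mx2Z !mx2D !(mulr0, mulr1, addr0, add0r).
  rewrite !linearD !linearZ /= -[G E0]/(g 0%N) -[G E1]/(g 1%N) -[G E2]/(g 2%N).
  by rewrite {1}(gE 0%N) {1}(gE 1%N) {1}(gE 2%N) !mx2Z !mx2D !mulr0 !addr0.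
have prod a b c : b * c = 0 ->
    (a * g 0 0 1 + b * g 1 0 1 + c * g 2 0 1) * (a * g 0 1 0 + b * g 1 1 0 + c * g 2 1 0) = 0.
  move=> bc; have : G (mx2 a b c 0) \notin unitmx.
    by apply: Gsing; rewrite ?mx2_11 // mx2_unit mulr0 bc subrr eqxx.
  by rewrite GE mx2_unit negbK mulr0 sub0r oppr_eq0 => /eqP.
have onto01 : exists a b c, a * g 0 0 1 + b * g 1 0 1 + c * g 2 0 1 = 1.
  have [|M M11 GM] := Gonto (mx2 0 1 0 0); first by rewrite mx2_11.
  exists (M 0 0), (M 0 1), (M 1 0); move: GM; rewrite [M]mx2E M11 GE.
  by case/mx2_inj => _; rewrite !mx2_entry.
have onto10 : exists a b c, a * g 0 1 0 + b * g 1 1 0 + c * g 2 1 0 = 1.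
  have [|M M11 GM] := Gonto (mx2 0 0 1 0); first by rewrite mx2_11.
  exists (M 0 0), (M 0 1), (M 1 0); move: GM; rewrite [M]mx2E M11 GE.
  by case/mx2_inj => _ _; rewrite !mx2_entry.
move: (prod 1 0 0) (prod 0 1 0) (prod 0 0 1) (prod 1 1 0) (prod 1 0 1).
rewrite !(mul0r, mulr0, mul1r, addr0, add0r) => /(_ erefl) h0 /(_ erefl) h1 /(_ erefl) h2.
move=> /(_ erefl) h01 /(_ erefl) h02.
move: onto01 onto10 h0 h1 h2 h01 h02 GE.
set l0 := g 0 0 1; set l1 := g 1 0 1; set l2 := g 2 0 1.
set m0 := g 0 1 0; set m1 := g 1 1 0; set m2 := g 2 1 0.
move=> [a [b [c ol]]] [a' [b' [c' om]]] h0 h1 h2 h01 h02 GE.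
have prod0 (x y : K) : x * y = 0 -> x != 0 -> y = 0.
  by move=> /eqP; rewrite mulf_eq0 => /orP[/eqP->|/eqP//]; rewrite eqxx.
have l00 : l0 = 0.
  apply/eqP; apply: contraT => l00; have m00 := prod0 _ _ h0 l00.
  have m10 : m1 = 0.
    by apply: (prod0 l0) => //; move: h01; rewrite m00 add0r mulrDl h1 addr0.
  have m20 : m2 = 0.
    by apply: (prod0 l0) => //; move: h02; rewrite m00 add0r mulrDl h2 addr0.
  by move/eqP: om; rewrite m00 m10 m20 !mulr0 !addr0 eq_sym oner_eq0.
have m00 : m0 = 0.
  apply/eqP; apply: contraT => m00.
  have l10 : l1 = 0.
    by apply: (prod0 m0) => //; move: h01; rewrite l00 add0r mulrDr h1 addr0 mulrC.
  have l20 : l2 = 0.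
    by apply: (prod0 m0) => //; move: h02; rewrite l00 add0r mulrDr h2 addr0 mulrC.
  by move/eqP: ol; rewrite l00 l10 l20 !mulr0 !addr0 eq_sym oner_eq0.
move: ol om; rewrite l00 m00 !mulr0 !add0r => ol om.
move: GE; rewrite l00 m00; set g0 := g 0 0 0; set g1 := g 1 0 0; set g2 := g 2 0 0 => GE.
have g00 : g0 != 0.
  apply/eqP => g00; have : E0 = 0.
    apply: Ginj; first by rewrite mx2_11.
    by rewrite GE g00 !(mul0r, mulr0, add0r, addr0) [RHS]mx2E !mxE.
  by move/(congr1 (fun M : 'M_2 => M 0 0))/eqP; rewrite !mxE oner_eq0.
have [l10|l10] := eqVneq l1 0.
  have l20 : l2 != 0 by apply/eqP => l20; move/eqP: ol; rewrite l10 l20 !mulr0 addr0 eq_sym oner_eq0.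
  have m20 := prod0 _ _ h2 l20.
  have m10 : m1 != 0 by apply/eqP => m10; move/eqP: om; rewrite m10 m20 !mulr0 addr0 eq_sym oner_eq0.
  exists true, (mx2 g0 g1 0 m1), (mx2 1 0 (g2 / g0) (l2 / g0)); split.
  - by rewrite mx2_unit mulr0 subr0 mulf_neq0.
  - by rewrite mx2_unit mul0r subr0 mul1r mulf_neq0 ?invr_eq0.
  move=> N N11; rewrite [N]mx2E N11 GE l10 m20 /= mx2T !mx2M.
  by congr mx2; field.
have m10 := prod0 _ _ h1 l10.
have m20 : m2 != 0 by apply/eqP => m20; move/eqP: om; rewrite m10 m20 !mulr0 addr0 eq_sym oner_eq0.
have l20 : l2 = 0 by apply: (prod0 m2) => //; rewrite mulrC.
exists false, (mx2 g0 g2 0 m2), (mx2 1 0 (g1 / g0) (l1 / g0)); split.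
- by rewrite mx2_unit mulr0 subr0 mulf_neq0.
- by rewrite mx2_unit mul0r subr0 mul1r mulf_neq0 ?invr_eq0.
move=> N N11; rewrite [N]mx2E N11 GE m10 l20 /= !mx2M.
by congr mx2; field.
Qed.

Lemma frobenius_inverse n (A : 'M[K]_n) (F G : {linear 'M[K]_n -> 'M[K]_n}) b P Q :
    (forall M, \tr (A *m F M) = \tr (A *m M)) -> (forall M, G (F M) = M) ->
    P \in unitmx -> Q \in unitmx ->
    (forall N, \tr (A *m N) = 0 -> G N = P *m trmx_if b N *m Q) ->
  frobenius_on A F.
Proof.
move=> FA FK Pu Qu GE; have FE M : \tr (A *m M) = 0 -> F M = trmx_if b (invmx P *m M *m invmx Q).
  by move=> AM; rewrite -{2}(FK M) GE ?FA // -!mulmxA mulKmx // mulmxV // mulmx1 trmx_ifK.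
case: b FE {GE} => FE.
  exists true, (invmx Q)^T, (invmx P)^T; rewrite !unitmx_tr !unitmx_inv; split=> // M /FE ->.
  by rewrite /= !trmx_mul mulmxA.
by exists false, (invmx P), (invmx Q); rewrite !unitmx_inv.
Qed.

Lemma frobenius_two (A : 'M[K]_2) (F : {linear 'M[K]_2 -> 'M[K]_2}) :
    A != 0 -> (forall M, \tr (A *m F M) = \tr (A *m M)) -> injective F ->
    (forall M, \tr (A *m M) = 0 -> M \in unitmx -> F M \in unitmx) ->
  frobenius_on A F.
Proof.
move=> A0 FA Finj FU; pose fF := linfun F.
have kF : lker fF == 0%VS by apply/lker0P => M N; rewrite !lfunE; apply: Finj.
pose G : {linear 'M[K]_2 -> 'M[K]_2} := (fF^-1)%VF.
have FK M : G (F M) = M by have := lker0_lfunK kF M; rewrite lfunE.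
have GK N : F (G N) = N by have := lker0_lfunVK kF N; rewrite lfunE.
have GA N : \tr (A *m G N) = \tr (A *m N) by rewrite -FA GK.
have Gsing N : \tr (A *m N) = 0 -> N \notin unitmx -> G N \notin unitmx.
  by move=> AN; apply: contra => /FU; rewrite GA GK; apply.
have [Au|nAu] := boolP (A \in unitmx).
  (* A matrix multiplied on the left by [mx2 0 1 (-1) 0] becomes symmetric exactly when its trace is
     0, so C V is the space of symmetric matrices. *)
  pose C := mx2 0 1 (-1) 0 *m A.
  have Cu : C \in unitmx by rewrite unitmx_mul Au mx2_unit mul0r sub0r mulrN1 opprK oner_eq0.
  have sym M : (C *m M)^T = C *m M <-> \tr (A *m M) = 0.
    rewrite /C -mulmxA /mxtrace !big_ord_recl big_ord0 addr0.
    have -> : lift ord0 ord0 = 1 :> 'I_2 by apply: val_inj.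
    rewrite [A *m M]mx2E mx2M mx2T !mx2_entry !(mul0r, mul1r, mulN1r, add0r, addr0).
    split=> [/mx2_inj[_ <- _ _]|/eqP]; first by rewrite addrN.
    by rewrite addr_eq0 => /eqP ->; rewrite opprK.
  clearbody C.
  have symV S : S^T = S -> \tr (A *m (invmx C *m S)) = 0.
    by move=> ST; apply/sym; rewrite mulKVmx.
  pose G' : {linear 'M[K]_2 -> 'M[K]_2} := (mulmx C \o (G \o mulmx (invmx C))).
  have [|||P [Q [Pu Qu G'E]]] := @sym_preserver G'.
  - by move=> S /symV AS /=; apply/sym; rewrite GA.
  - move=> S ST Su /=; rewrite unitmx_mul Cu /=; apply: Gsing; first exact: symV.
    by rewrite unitmx_mul unitmx_inv Cu.
  - move=> S _ /= /(canRL (mulKmx Cu)); rewrite mulmx0 => GS.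
    have : invmx C *m S = 0 by rewrite -[LHS]GK [G _]GS linear0.
    by move/(canRL (mulKVmx Cu)); rewrite mulmx0.
  apply: (@frobenius_inverse _ A F G false (invmx C *m P *m C) Q) => //.
    by rewrite !unitmx_mul unitmx_inv Cu Pu.
  move=> N AN; have /G'E /= : (C *m N)^T = C *m N by apply/sym.
  by rewrite mulKmx // => /(canRL (mulKmx Cu)) ->; rewrite !mulmxA.
have : (\rank A <= 1)%N.
  have := rank_leq_row A; rewrite leq_eqVlt ltnS => /orP[fA|//].
  by move: nAu; rewrite -row_free_unit /row_free fA.
case/rank1_dyad => d [z AE].
have d0 : d != 0 by apply: contraNneq A0 => d0; rewrite AE d0 mul0mx.
have z0 : z != 0 by apply: contraNneq A0 => z0; rewrite AE z0 mulmx0.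
(* Bases in which [A] is the last matrix unit and V the space of matrices with zero lower right
   entry. *)
have [Z Zu zE] := unit_row 1 z0; have [X Xu dE] := unit_col 1 d0.
have trE M : \tr (A *m M) = (Z *m M *m X) 1 1.
  rewrite AE tr_dyad -zE -dE.
  have -> : delta_mx 0 1 *m Z *m M *m (X *m delta_mx 1 0) =
      delta_mx 0 1 *m (Z *m M *m X) *m delta_mx 1 0 :> 'M_1 by rewrite !mulmxA.
  by rewrite delta_entry mxE mulr1n.
have backE N : Z *m (invmx Z *m N *m invmx X) *m X = N.
  by rewrite -!mulmxA mulKVmx // mulVmx // mulmx1.
pose G' : {linear 'M[K]_2 -> 'M[K]_2} :=
  ((mulmx Z \o mulmxr X) \o (G \o (mulmx (invmx Z) \o mulmxr (invmx X)))).
have G'E N : G' N = Z *m G (invmx Z *m N *m invmx X) *m X by rewrite /= !mulmxA.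
have V' (N : 'M_2) : N 1 1 = 0 -> \tr (A *m (invmx Z *m N *m invmx X)) = 0.
  by rewrite trE backE.
have [||||b [P [Q [Pu Qu GE]]]] := @corner_preserver G'.
- by move=> N /V' N11; rewrite G'E -trE GA.
- move=> N N11 Nu; rewrite G'E !unitmx_mul Zu Xu andbT; apply: Gsing; first exact: V'.
  by rewrite !unitmx_mul !unitmx_inv Zu Xu andbT.
- move=> N _; rewrite G'E => /(canRL (mulmxK Xu)); rewrite mul0mx => /(canRL (mulKmx Zu)).
  rewrite mulmx0 => GN; rewrite -[N]backE -[invmx Z *m N *m invmx X]GK GN.
  by rewrite linear0 mulmx0 mul0mx.
- move=> N /V' AN; exists (Z *m F (invmx Z *m N *m invmx X) *m X); first by rewrite -trE FA.
  rewrite G'E -{2}[N]backE -!(mulmxA Z) mulKmx // -!mulmxA mulmxV // mulmx1 FK.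
  by rewrite !mulmxA.
have GN N : \tr (A *m N) = 0 -> G N = invmx Z *m (P *m trmx_if b (Z *m N *m X) *m Q) *m invmx X.
  have backE' Y : invmx Z *m (Z *m Y *m X) *m invmx X = Y.
    by rewrite -!mulmxA mulKmx // mulmxV // mulmx1.
  by rewrite trE => /GE <-; rewrite G'E !backE'.
case: b GN {GE} => GN.
  apply: (@frobenius_inverse _ A F G true (invmx Z *m P *m X^T) (Z^T *m Q *m invmx X)) => //.
  - by rewrite !unitmx_mul unitmx_inv unitmx_tr Zu Pu.
  - by rewrite !unitmx_mul unitmx_inv unitmx_tr Zu Qu.
  by move=> N /GN ->; rewrite /= !trmx_mul !mulmxA.
apply: (@frobenius_inverse _ A F G false (invmx Z *m P *m Z) (X *m Q *m invmx X)) => //.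
- by rewrite !unitmx_mul unitmx_inv Zu Pu.
- by rewrite !unitmx_mul unitmx_inv Xu Qu.
by move=> N /GN ->; rewrite /= !mulmxA.
Qed.

End Two.

(** * Size 3 over the field with two elements *)

(** Entries in row-major order; a flat constructor is cheap to evaluate in the enumerations. *)
Inductive bm := BM of bool & bool & bool & bool & bool & bool & bool & bool & bool.

Definition bm_seq (m : bm) : seq bool :=
  let: BM a b c d e f g h i := m in [:: a; b; c; d; e; f; g; h; i].

(* Conditionals rather than boolean operators: evaluation stops early. *)
Definition xor2 (x y : bool) := if x then (if y then false else true) else y.

Definition bm_add m n :=
  let: BM a b c d e f g h i := m in let: BM a' b' c' d' e' f' g' h' i' := n in
  BM (xor2 a a') (xor2 b b') (xor2 c c') (xor2 d d') (xor2 e e') (xor2 f f')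
     (xor2 g g') (xor2 h h') (xor2 i i').

Definition bm_dot (a b c x y z : bool) :=
  xor2 (if a then x else false) (xor2 (if b then y else false) (if c then z else false)).

Definition bm_mul m n :=
  let: BM a b c d e f g h i := m in let: BM a' b' c' d' e' f' g' h' i' := n in
  BM (bm_dot a b c a' d' g') (bm_dot a b c b' e' h') (bm_dot a b c c' f' i')
     (bm_dot d e f a' d' g') (bm_dot d e f b' e' h') (bm_dot d e f c' f' i')
     (bm_dot g h i a' d' g') (bm_dot g h i b' e' h') (bm_dot g h i c' f' i').

Definition bm_tr m :=
  let: BM a b c d e f g h i := m in BM a d g b e h c f i.

Definition minor2 (a b c d : bool) :=
  xor2 (if a then d else false) (if b then c else false).

Definition bm_det m :=
  let: BM a b c d e f g h i := m in
  xor2 (if a then minor2 e f h i else false)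
    (xor2 (if b then minor2 d f g i else false) (if c then minor2 d e g h else false)).

(** The adjugate, without signs since -1 = 1; it is the inverse of a unit, whose determinant can
    only be 1. *)
Definition bm_adj m :=
  let: BM a b c d e f g h i := m in
  BM (minor2 e f h i) (minor2 b c h i) (minor2 b c e f)
     (minor2 d f g i) (minor2 a c g i) (minor2 a c d f)
     (minor2 d e g h) (minor2 a b g h) (minor2 a b d e).

Definition bm0 := BM false false false false false false false false false.

Definition bm_is0 m :=
  let: BM a b c d e f g h i := m in
  if a then false else if b then false else if c then false else
  if d then false else if e then false else if f then false else
  if g then false else if h then false else ~~ i.

Definition bm_eq m n := bm_is0 (bm_add m n).

Fixpoint forallb T (p : T -> bool) s :=
  if s is x :: s' then if p x then forallb p s' else false else true.
Fixpoint existsb T (p : T -> bool) s :=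
  if s is x :: s' then if p x then true else existsb p s' else false.

(* The entry (i, j) of the matrix of number c is the bit 3 i + j of c. *)
Fixpoint bits (k c : nat) : seq bool := if k is k'.+1 then odd c :: bits k' c./2 else [::].

Fixpoint all_seqs k : seq (seq bool) :=
  if k is k'.+1 then map (cons false) (all_seqs k') ++ map (cons true) (all_seqs k') else [:: [::]].

Definition bm_tr0 (r3 : bool) m :=
  let: BM a _ _ _ e _ _ _ i := m in ~~ (xor2 (xor2 a e) (if r3 then i else false)).

Definition code (b : seq bool) :=
  if b is [:: a; b; c; d; e; f; g; h; i] then BM a b c d e f g h i else bm0.

Definition all_bm := map code (all_seqs 9).

(* Enumerates the images v of the elements b of a basis, pruning as soon as some partial sum
   violates the preservation of units or injectivity; pairs consists of the sums of the
   previous basis elements with their images. *)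
Section Search.
Variables (V : seq bm) (leaf : seq (bm * bm) -> bool).

Fixpoint search (pairs acc : seq (bm * bm)) (cands bs : seq bm) : bool :=
  if bs is b :: bs' then
    forallb (fun v =>
      if forallb (fun p => let i := bm_add p.2 v in
           let d := bm_add p.1 b in
           if bm_det d then bm_det i else if bm_is0 d then true else ~~ bm_is0 i) pairs
      then search (pairs ++ [seq (bm_add p.1 b, bm_add p.2 v) | p <- pairs]) ((b, v) :: acc) V bs'
      else true) cands
  else leaf acc.
End Search.

(* The image v0 = P b0 Q of the unit b0 determines Q from P. *)
Definition leafb (G : seq bm) (b0 : bm) (acc : seq (bm * bm)) : bool :=
  if [seq p.2 | p <- acc & bm_eq p.1 b0] is v0 :: _ then
  existsb (fun P =>
    let Q := bm_mul (bm_adj b0) (bm_mul (bm_adj P) v0) in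
    let Q' := bm_mul (bm_adj (bm_tr b0)) (bm_mul (bm_adj P) v0) in
    if forallb (fun p => bm_eq p.2 (bm_mul (bm_mul P p.1) Q)) acc then bm_det Q else
    if forallb (fun p => bm_eq p.2 (bm_mul (bm_mul P (bm_tr p.1)) Q')) acc then bm_det Q'
    else false) G
  else false.

Definition of_nats := map (fun c => code (bits 9 c)).
(* Bases of the spaces orthogonal to diag (1, 1, 0) and diag (1, 1, 1), starting with a unit,
   found by trial so that the search tree is small. Up to the maps M |-> P M Q which preserve
   the space, the image of the first basis element is one of the representatives. *)
Definition basis2 := of_nats [:: 275; 241; 117; 159; 236; 437; 177; 174]%N.
Definition reps2 := of_nats [:: 85; 87; 95]%N.
Definition basis3 := of_nats [:: 380; 230; 461; 140; 157; 400; 66; 217]%N.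
Definition reps3 := of_nats [:: 85; 95]%N.
Definition bm_GL := filter bm_det all_bm.

Definition run_search r3 basis reps :=
  search (filter (bm_tr0 r3) all_bm) (leafb bm_GL (head bm0 basis)) [:: (bm0, bm0)] [::] reps basis.

Definition sums (bs : seq bm) := foldr (fun b s => s ++ [seq bm_add b m | m <- s]) [:: bm0] bs.

Definition spans r3 bs :=
  forallb (fun m => existsb (bm_eq m) (sums bs)) (filter (bm_tr0 r3) all_bm).

(** [St] consists of the pairs (P, Q) with Q A P = A, for which M |-> P M Q preserves tr (A M). *)
Definition orbits (A : bm) r3 reps :=
  let St := filter (fun PQ => bm_eq (bm_mul (bm_mul PQ.2 A) PQ.1) A)
    [seq (P, Q) | P <- bm_GL, Q <- bm_GL] in
  forallb (fun v => existsb (fun PQ => existsb (bm_eq (bm_mul (bm_mul PQ.1 v) PQ.2)) reps) St)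
    (filter bm_det (filter (bm_tr0 r3) all_bm)).

Definition diag_form r3 := BM true false false false true false false false r3.

Lemma bm_seqK : cancel bm_seq code. Proof. by case. Qed.
HB.instance Definition _ := Equality.copy bm (can_type bm_seqK).

Lemma mem_all_bm m : m \in all_bm.
Proof.
have mem k s : size s = k -> s \in all_seqs k.
  elim: k s => [|k IHk] [|b s] //= [/IHk ms]; rewrite mem_cat.
  by case: b; rewrite (mem_map (fun _ _ => _)) ?ms ?orbT //; congruence.
by rewrite -[m]bm_seqK map_f // mem //; case: m.
Qed.

Lemma bm_is0P m : bm_is0 m -> m = bm0.
Proof. by case: m => -[] [] [] [] [] [] [] [] []. Qed.

Lemma bm_eqP m n : bm_eq m n -> m = n.
Proof.
move/bm_is0P; case: m n => a b c d e f g h i [a' b' c' d' e' f' g' h' i'] /=.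
have x0 x y : xor2 x y = false -> x = y by case: x y => [] [].
by case=> /x0-> /x0-> /x0-> /x0-> /x0-> /x0-> /x0-> /x0-> /x0->.
Qed.

Lemma forallbP (T : eqType) (p : T -> bool) s : forallb p s -> forall x, x \in s -> p x.
Proof.
elim: s => //= y s IHs; case: ifP => // py /IHs ps x; rewrite inE => /orP[/eqP->//|].
exact: ps.
Qed.

Lemma forallb_intro (T : eqType) (p : T -> bool) s : (forall x, x \in s -> p x) -> forallb p s.
Proof.
elim: s => //= y s IHs ps; rewrite ps ?mem_head //.
by apply: IHs => x xs; apply: ps; rewrite inE xs orbT.
Qed.

Lemma existsbP (T : eqType) (p : T -> bool) s : existsb p s -> exists2 x, x \in s & p x.
Proof.
elim: s => //= y s IHs; case: ifP => [py _|_ /IHs[x xs px]].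
  by exists y; rewrite ?inE ?eqxx.
by exists x; rewrite ?inE ?xs ?orbT.
Qed.

(** [phi] is itself one of the branches, and passes every pruning test. The test at the end of that
    branch therefore holds for [phi]. *)
Lemma search_sound (r3 : bool) (V : seq bm) (leaf : seq (bm * bm) -> bool) (phi : bm -> bm) :
    (forall m, bm_tr0 r3 m -> m \in V) ->
    (forall m n, bm_tr0 r3 m -> bm_tr0 r3 n -> bm_tr0 r3 (bm_add m n)) ->
    (forall m n, phi (bm_add m n) = bm_add (phi m) (phi n)) ->
    (forall m, bm_tr0 r3 m -> bm_tr0 r3 (phi m)) ->
    (forall m, bm_tr0 r3 m -> bm_det m -> bm_det (phi m)) ->
    (forall m, bm_is0 (phi m) -> bm_is0 m) ->
  forall bs pairs acc cands,
    (forall p, p \in pairs -> p.2 = phi p.1 /\ bm_tr0 r3 p.1) ->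
    (forall b, b \in bs -> bm_tr0 r3 b) -> phi (head bm0 bs) \in cands ->
    search V leaf pairs acc cands bs ->
  leaf (catrev [seq (b, phi b) | b <- bs] acc).
Proof.
move=> inV trD phiD trphi detphi phi0; elim=> [|b bs IHbs] pairs acc cands //= pairsP bsP phib.
have trb : bm_tr0 r3 b by apply: bsP; rewrite mem_head.
move=> /forallbP/(_ _ phib); case: ifP => [_|/negP[]]; last first.
  apply: forallb_intro => p /pairsP[p2 p1] /=; rewrite p2 -phiD.
  case: ifP => [/detphi -> //|_]; first exact: trD.
  by case: ifP => // /negP n0; apply/negP => /phi0.
apply: IHbs.
- move=> p; rewrite mem_cat => /orP[/pairsP//|/mapP[q /pairsP[q2 q1] ->]] /=.
  by rewrite phiD -q2 trD.
- by move=> b' b'bs; apply: bsP; rewrite inE b'bs orbT.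
case: bs {bsP} (bsP) => [|b' bs] bsP /=; apply/inV/trphi; first by case: (r3).
by apply: bsP; rewrite !inE eqxx orbT.
Qed.

Lemma leafb_sound G b0 acc : leafb G b0 acc -> exists P Q,
  [/\ P \in G, bm_det Q &
    (forall p, p \in acc -> p.2 = bm_mul (bm_mul P p.1) Q) \/
    (forall p, p \in acc -> p.2 = bm_mul (bm_mul P (bm_tr p.1)) Q)].
Proof.
rewrite /leafb; case: [seq _ | _ <- _ & _] => // v0 _ /existsbP[P PG].
set Q := bm_mul _ _; set Q' := bm_mul _ _.
case: ifP => [/forallbP PQ detQ|_]; first by exists P, Q; split=> //; left=> p /PQ/bm_eqP.
case: ifP => // /forallbP PQ detQ; exists P, Q'; split=> //; right=> p /PQ/bm_eqP //.
Qed.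

(** * Boolean matrices as matrices over a field with two elements *)

Section Field2.
Variable K : fieldType.
Hypothesis K2 : forall t : K, t = 0 \/ t = 1.

Lemma two0 : 1 + 1 = 0 :> K.
Proof.
by case: (K2 (1 + 1)) => // /(canRL (addrK _))/eqP; rewrite subrr oner_eq0.
Qed.

Lemma opp2 (x : K) : - x = x.
Proof. by apply/eqP; rewrite eq_sym -addr_eq0 -[x]mulr1 -mulrDr two0 mulr0 eqxx. Qed.

Definition b2k (b : bool) : K := b%:R.

Lemma b2k_xor x y : b2k (xor2 x y) = b2k x + b2k y.
Proof. by case: x y => [] []; rewrite /b2k /= ?two0 ?addr0 ?add0r. Qed.

Lemma b2k_and x y : b2k (if x then y else false) = b2k x * b2k y.
Proof. by case: x y => [] []; rewrite /b2k /= ?mulr0 ?mul1r ?mul0r. Qed.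

Definition dec (m : bm) : 'M[K]_3 := \matrix_(i, j) b2k (nth false (bm_seq m) (3 * i + j)).

Definition enc (M : 'M[K]_3) : bm :=
  let c i j := M (inord i) (inord j) != 0 in
  BM (c 0 0) (c 0 1) (c 0 2) (c 1 0) (c 1 1) (c 1 2) (c 2 0) (c 2 1) (c 2 2).

Lemma k2b (t : K) : b2k (t != 0) = t.
Proof. by case: (K2 t) => ->; rewrite /b2k ?eqxx ?oner_neq0. Qed.

Lemma encK : cancel enc dec.
Proof.
move=> M; apply/matrixP => i j; rewrite mxE.
rewrite -[in RHS](inord_val i) -[in RHS](inord_val j).
by case: i j => [[|[|[|//]]] ?] [[|[|[|//]]] ?]; rewrite /= k2b.
Qed.

Lemma decK : cancel dec enc.
Proof.
have b2kK b : (b2k b != 0) = b by case: b; rewrite /b2k ?oner_neq0 ?eqxx.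
by case=> a b c d e f g h i; rewrite /enc !mxE !inordK //= !b2kK.
Qed.

Lemma decD m n : dec (bm_add m n) = dec m + dec n.
Proof.
case: m n => a b c d e f g h i [a' b' c' d' e' f' g' h' i'].
by apply/matrixP => -[[|[|[|//]]] ?] [[|[|[|//]]] ?]; rewrite !mxE /= b2k_xor.
Qed.

Lemma decM m n : dec (bm_mul m n) = dec m *m dec n.
Proof.
case: m n => a b c d e f g h i [a' b' c' d' e' f' g' h' i'].
apply/matrixP => -[[|[|[|//]]] ?] [[|[|[|//]]] ?];
 by rewrite !mxE !big_ord_recl big_ord0 !mxE /= !b2k_xor !b2k_and addr0.
Qed.

Lemma dec_tr m : dec (bm_tr m) = (dec m)^T.
Proof.
case: m => a b c d e f g h i.
by apply/matrixP => -[[|[|[|//]]] ?] [[|[|[|//]]] ?]; rewrite !mxE.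
Qed.

Lemma dec0 : dec bm0 = 0.
Proof. by apply/matrixP => -[[|[|[|//]]] ?] [[|[|[|//]]] ?]; rewrite !mxE. Qed.

Lemma dec_det m : \det (dec m) = b2k (bm_det m).
Proof.
case: m => a b c d e f g h i.
rewrite (expand_det_row _ 0) !big_ord_recl big_ord0 /cofactor !det2E !mxE /= !opp2.
by rewrite !b2k_xor !b2k_and !b2k_xor !b2k_and expr1n; ring.
Qed.

Lemma dec_unit m : (dec m \in unitmx) = bm_det m.
Proof. by rewrite unitmxE unitfE dec_det; case: bm_det; rewrite /b2k ?oner_neq0 ?eqxx. Qed.

Lemma tr0P r3 m : bm_tr0 r3 m <-> \tr (dec (diag_form r3) *m dec m) = 0.
Proof.
have -> : \tr (dec (diag_form r3) *m dec m) = b2k (~~ bm_tr0 r3 m).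
  case: m => a b c d e f g h i; rewrite -decM /mxtrace !big_ord_recl big_ord0 !mxE /=.
  rewrite negbK addr0 addrA !b2k_xor !b2k_and; case: r3; rewrite /b2k ?mul0r ?mul1r ?addr0 ?add0r //.
by case: bm_tr0; rewrite /b2k; split=> // /eqP; rewrite oner_eq0.
Qed.

(** Conjugation by M |-> U M L, which carries the hyperplane of L A U onto that of A. *)
Lemma frobenius_transport n (A L U : 'M[K]_n) :
    L \in unitmx -> U \in unitmx ->
    (forall F, preserver A F -> frobenius_on A F) ->
  forall F, preserver (L *m A *m U) F -> frobenius_on (L *m A *m U) F.
Proof.
move=> Lu Uu AF F [FA Finj FU].
pose F' : {linear 'M[K]_n -> 'M[K]_n} :=
  ((mulmx U \o mulmxr L) \o (F \o (mulmx (invmx U) \o mulmxr (invmx L)))).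
have F'E M : F' M = U *m F (invmx U *m M *m invmx L) *m L by rewrite /= !mulmxA.
have trE M : \tr (L *m A *m U *m M) = \tr (A *m (U *m M *m L)).
  by rewrite -!mulmxA mxtrace_mulC -!mulmxA.
have backE M : U *m (invmx U *m M *m invmx L) *m L = M.
  by rewrite -!mulmxA mulKVmx // mulVmx // mulmx1.
have backE' M : invmx U *m (U *m M *m L) *m invmx L = M.
  by rewrite -!mulmxA mulKmx // mulmxV // mulmx1.
have [|b [P [Q [Pu Qu PQ]]]] := AF F'.
  split=> [M|M N|M AM Mu]; first by rewrite F'E -trE FA trE backE.
    rewrite !F'E => /(congr1 (fun X => invmx U *m X *m invmx L)); rewrite !backE'.
    by move/Finj/(congr1 (fun X => U *m X *m L)); rewrite !backE.
  rewrite F'E !unitmx_mul Uu Lu andbT; apply: FU; first by rewrite trE backE.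
  by rewrite !unitmx_mul !unitmx_inv Uu Lu andbT.
have FE M : \tr (L *m A *m U *m M) = 0 ->
    F M = invmx U *m (P *m trmx_if b (U *m M *m L) *m Q) *m invmx L.
  by rewrite trE => /PQ <-; rewrite F'E !backE'.
case: b FE {PQ} => FE.
  exists true, (invmx U *m P *m L^T), (U^T *m Q *m invmx L); split.
  - by rewrite !unitmx_mul unitmx_inv unitmx_tr Uu Pu Lu.
  - by rewrite !unitmx_mul unitmx_inv unitmx_tr Uu Qu Lu.
  by move=> M /FE ->; rewrite /= !trmx_mul !mulmxA.
exists false, (invmx U *m P *m U), (L *m Q *m invmx L); split.
- by rewrite !unitmx_mul unitmx_inv Uu Pu.
- by rewrite !unitmx_mul unitmx_inv Lu Qu.
by move=> M /FE ->; rewrite /= !mulmxA.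
Qed.

(** The search gives the Frobenius form on the basis elements; linearity extends it to their sums,
    which exhaust the hyperplane. *)
Lemma preserver_reps r3 basis reps F : preserver (dec (diag_form r3)) F ->
    run_search r3 basis reps -> spans r3 basis -> (forall b, b \in basis -> bm_tr0 r3 b) ->
    enc (F (dec (head bm0 basis))) \in reps ->
  frobenius_on (dec (diag_form r3)) F.
Proof.
move=> [FA Finj FU] runP spanP basisP repP; pose phi m := enc (F (dec m)).
have decphi m : dec (phi m) = F (dec m) by rewrite /phi encK.
have dec_inj := can_inj decK.
have phiD m n : phi (bm_add m n) = bm_add (phi m) (phi n).
  by apply: dec_inj; rewrite decD !decphi decD linearD.
have /leafb_sound[P [Q [PG Qd PQ]]] : leafb bm_GL (head bm0 basis)
    (catrev [seq (b, phi b) | b <- basis] [::]).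
  apply: (search_sound _ _ phiD _ _ _ _ basisP repP runP).
  - by move=> m m0; rewrite mem_filter m0 mem_all_bm.
  - move=> m n /tr0P m0 /tr0P n0; apply/tr0P.
    by rewrite decD mulmxDr linearD /= m0 n0 addr0.
  - by move=> m /tr0P m0; apply/tr0P; rewrite decphi FA.
  - by move=> m /tr0P m0; rewrite -!dec_unit decphi; apply: FU.
  - move=> m /bm_is0P m0; have : F (dec m) = 0 by rewrite -decphi m0 dec0.
    rewrite -(linear0 F) => /Finj; rewrite -dec0 => /dec_inj ->; by [].
  move=> p; rewrite inE => /eqP -> /=; split; last by case: (r3).
  by apply: dec_inj; rewrite decphi dec0 linear0.
have Pd : bm_det P by move: PG; rewrite mem_filter => /andP[].
have [b bE] : exists b, forall m, m \in basis -> F (dec m) = dec P *m trmx_if b (dec m) *m dec Q.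
  have mem m : m \in basis -> (m, phi m) \in catrev [seq (b, phi b) | b <- basis] [::].
    by move=> mb; rewrite catrevE cats0 mem_rev; apply/mapP; exists m.
  case: PQ => PQ; [exists false|exists true] => m /mem/PQ /= E.
    by rewrite -decphi E !decM.
  by rewrite -decphi E !decM dec_tr.
exists b, (dec P), (dec Q); rewrite !dec_unit Pd Qd; split=> // M AM.
have : enc M \in filter (bm_tr0 r3) all_bm.
  by rewrite mem_filter mem_all_bm andbT; apply/tr0P; rewrite encK.
move: spanP => /forallbP H /H /existsbP[m mS /bm_eqP E]; rewrite -[M]encK E.
have {}mS : m \in sums basis by [].
move: m mS {E H}; rewrite /sums; move: bE; elim: (basis) => [|c s IHs] bE m /=.
  by rewrite inE => /eqP ->; rewrite dec0 !linear0 ?mulmx0 mul0mx.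
have {}IHs m' := IHs (fun m'' ms => bE m'' (mem_behead (s := c :: s) ms)) m'.
rewrite mem_cat => /orP[/IHs//|/mapP[m' /IHs E ->]].
by rewrite decD !linearD /= E (bE c) ?mem_head // ?mulmxDr mulmxDl.
Qed.

(** The first basis element is a unit, and so is its image. Composing F with a map M |-> P M Q
    preserving the trace form moves this image to a representative, and the composition is undone at
    the end. *)
Lemma preserver_diag_form r3 basis reps F : preserver (dec (diag_form r3)) F ->
    run_search r3 basis reps -> spans r3 basis -> forallb (bm_tr0 r3) basis ->
    bm_det (head bm0 basis) -> orbits (diag_form r3) r3 reps ->
  frobenius_on (dec (diag_form r3)) F.
Proof.
move=> FP runP spanP /forallbP basisP det0 orbP; have [FA Finj FU] := FP.
have b0 : bm_tr0 r3 (head bm0 basis).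
  by case: basis det0 basisP {runP spanP} => //= c s _; apply; rewrite mem_head.
pose v := enc (F (dec (head bm0 basis))).
have vV : v \in filter bm_det (filter (bm_tr0 r3) all_bm).
  have Fu : F (dec (head bm0 basis)) \in unitmx by apply: FU; [apply/tr0P|rewrite dec_unit].
  rewrite !mem_filter mem_all_bm andbT -dec_unit /v encK Fu andTb.
  by apply/tr0P; rewrite encK FA; apply/tr0P.
have /existsbP[[P Q] PQ wPQ] := forallbP orbP vV.
have /existsbP[w wr /bm_eqP vw] : existsb (bm_eq (bm_mul (bm_mul P v) Q)) reps := wPQ.
move: PQ; rewrite mem_filter => /andP[QAP0 PQS].
have /bm_eqP QAP : bm_eq (bm_mul (bm_mul Q (diag_form r3)) P) (diag_form r3) := QAP0.
have /allpairsP[[P' Q'] [PG QG PQE]] := PQS; have {PQE} [EP EQ] := PQE; subst P' Q'.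
have Pu : dec P \in unitmx by rewrite dec_unit; move: PG; rewrite mem_filter => /andP[].
have Qu : dec Q \in unitmx by rewrite dec_unit; move: QG; rewrite mem_filter => /andP[].
pose F' : {linear 'M[K]_3 -> 'M[K]_3} := ((mulmx (dec P) \o mulmxr (dec Q)) \o F).
have F'E M : F' M = dec P *m F M *m dec Q by rewrite /= mulmxA.
have [||b [R [S [Ru Su RS]]]] := @preserver_reps r3 basis reps F' _ runP spanP basisP.
- split=> [M|M N|M AM Mu].
  + rewrite F'E -[RHS]FA -{2}QAP !decM -!mulmxA [RHS]mxtrace_mulC.
    by rewrite -!mulmxA.
  + rewrite !F'E => /(can_inj (mulmxK Qu))/(can_inj (mulKmx Pu)); exact: Finj.
  by rewrite F'E !unitmx_mul Pu Qu FU.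
- have wE : dec P *m F (dec (head bm0 basis)) *m dec Q = dec w.
    by rewrite -vw !decM /v encK.
  by rewrite F'E wE decK.
exists b, (invmx (dec P) *m R), (S *m invmx (dec Q)).
rewrite !unitmx_mul !unitmx_inv Pu Qu Ru Su; split=> // M /RS; rewrite F'E => E.
by rewrite -!mulmxA (mulmxA R) (mulmxA _ S) -E -!mulmxA mulKmx // mulmxV // mulmx1.
Qed.

Lemma frobenius_F2 (A : 'M[K]_3) F : (1 < \rank A)%N -> preserver A F -> frobenius_on A F.
Proof.
move=> rA; rewrite -(mulmx_ebase A); apply: frobenius_transport.
- exact: col_ebase_unit.
- exact: row_ebase_unit.
have formE r3 : pid_mx (if r3 then 3 else 2) = dec (diag_form r3) :> 'M[K]_3.
  by case: r3; apply/matrixP => -[[|[|[|//]]] ?] [[|[|[|//]]] ?]; rewrite !mxE.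
have : \rank A = 2 \/ \rank A = 3.
  by move: rA; have := rank_leq_row A; case: (\rank A) => [|[|[|[|]]]] //; auto.
case=> -> F' F'P.
  rewrite (formE false) in F'P *.
  by apply: (preserver_diag_form (basis := basis2) (reps := reps2) F'P); vm_compute.
rewrite (formE true) in F'P *.
by apply: (preserver_diag_form (basis := basis3) (reps := reps3) F'P); vm_compute.
Qed.

End Field2.

(** * Hyperplanes as kernels of trace forms, and the extension of f *)

Section Final.
Variable K : fieldType.

Lemma hyperplane_form n (V : {vspace 'M[K]_n}) : hyperplane V ->
  exists A : 'M[K]_n, A != 0 /\ forall M, (M \in V) = (\tr (A *m M) == 0).
Proof.
rewrite /hyperplane => dimV.
have /subvPn[N _ NV] : ~~ (fullv <= V)%VS.
  by apply/negP => /dimvS; rewrite -dimV ltnn.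
have [A AN AV] := separation NV.
exists A; split; first by apply: contraNneq AN => ->; rewrite mul0mx mxtrace0.
pose k := linfun (trA A).
have memk M : (M \in lker k) = (\tr (A *m M) == 0) by rewrite memv_ker lfunE.
have Vk : (V <= lker k)%VS by apply/subvP => M /AV; rewrite memk => ->.
suff -> : V = lker k by [].
apply/eqP; rewrite eqEdim Vk -ltnS dimV -(limg_ker_dim k fullv) capfv.
rewrite -addn1 leq_add2l lt0n dimv_eq0; apply/eqP => k0.
have : k N \in limg k by rewrite memv_img ?memvf.
by rewrite k0 memv0 lfunE /= (negPf AN).
Qed.

Lemma F2_of_two_elements : (forall t : K, t = 0 \/ t = 1) -> isF2 K.
Proof.
move=> K2; have t0 := two0 K2.
pose h (x : 'F_2) : K := (x : nat)%:R.
have h_add : zmod_morphism h.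
  by case=> [[|[|//]] ?] [[|[|//]] ?]; rewrite /h /= ?subr0 ?sub0r ?subrr ?(opp2 K2).
have h_mul : monoid_morphism h.
  by split=> // -[[|[|//]] ?] [[|[|//]] ?]; rewrite /h /= ?mulr0 ?mul0r ?mulr1.
pose phi : {rmorphism 'F_2 -> K} := HB.pack h (GRing.isZmodMorphism.Build _ _ h h_add)
  (GRing.isMonoidMorphism.Build _ _ h h_mul).
exists phi; exists (fun t => if t == 0 then 0 else 1) => [x|t].
  case: x => [[|[|//]] ?]; rewrite /phi /= /h /= ?eqxx ?oner_eq0; exact: val_inj.
by case: (K2 t) => ->; rewrite ?eqxx ?oner_eq0.
Qed.

(** Bases that carry the dyad [A] to the last matrix unit carry V to [V1 K]. *)
Lemma exceptional_rank1 (V : {vspace 'M[K]_3}) A : (forall t : K, t = 0 \/ t = 1) ->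
    A != 0 -> (\rank A <= 1)%N -> (forall M, (M \in V) = (\tr (A *m M) == 0)) ->
  exceptional V.
Proof.
move=> K2 A0 /rank1_dyad[d [z AE]] VE; exists erefl; split; first exact: F2_of_two_elements.
have d0 : d != 0 by apply: contraNneq A0 => d0; rewrite AE d0 mul0mx.
have z0 : z != 0 by apply: contraNneq A0 => z0; rewrite AE z0 mulmx0.
have [P Pu zE] := unit_row ord_max z0; have [X Xu dE] := unit_col ord_max d0.
have VP N : (N \in V) = ((P *m N *m X) ord_max ord_max == 0).
  rewrite VE AE tr_dyad -zE -dE.
  have -> : delta_mx 0 ord_max *m P *m N *m (X *m delta_mx ord_max 0) =
      delta_mx 0 ord_max *m (P *m N *m X) *m delta_mx ord_max 0 :> 'M_1 by rewrite !mulmxA.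
  by rewrite delta_entry mxE mulr1n.
exists P, (invmx X); rewrite unitmx_inv invmxK; split=> // M; rewrite memV1 /=.
split=> [M33|[N NV ->]]; last by rewrite -VP.
have ME : M = P *m (invmx P *m M *m invmx X) *m X.
  by rewrite -!mulmxA mulKVmx // mulVmx // mulmx1.
by exists (invmx P *m M *m invmx X); rewrite // VP -ME.
Qed.

Lemma preserver_frobenius n (V : {vspace 'M[K]_n}) (A : 'M[K]_n) F : (0 < n)%N ->
    A != 0 -> (forall M, (M \in V) = (\tr (A *m M) == 0)) -> ~ exceptional V ->
  preserver A F -> frobenius_on A F.
Proof.
case: n V A F => [//|[|[|[|n]]]] V A F _ A0 VE nex FP.
(* At size 1 the hyperplane is 0. *)
- exists false, 1%:M, 1%:M; rewrite unitmx1; split=> // M AM.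
  have -> : M = 0; last by rewrite !linear0 ?mulmx0 ?mul0mx.
  have A00 : A 0 0 != 0.
    by apply: contra A0 => /eqP A00; rewrite [A]mx11_scalar A00 raddf0.
  have : A 0 0 * M 0 0 = 0 by rewrite -AM trace_mx11 mxE big_ord1.
  by move/eqP; rewrite mulf_eq0 (negPf A00) /= => /eqP M0; rewrite [M]mx11_scalar M0 raddf0.
- by have [FA Finj FU] := FP; apply: frobenius_two.
- have [[t [t0 t1]]|nt] := classic (exists t : K, t != 0 /\ t != 1).
    have [FA _ FU] := FP; exact: (frobenius_three t0 t1 A0 FA (preserver_onto FP) FU).
  have K2 (t : K) : t = 0 \/ t = 1.
    have [->|t0] := eqVneq t 0; first by left.
    by have [->|t1] := eqVneq t 1; [right|case: nt; exists t].
  have [rA|rA] := leqP (\rank A) 1; first by case: nex; apply: exceptional_rank1 VE.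
  exact: frobenius_F2 FP.
exact: frobenius_ge4.
Qed.

End Final.

Theorem theorem26 (K : fieldType) (n : nat) (n_gt0 : (0 < n)%N)
    (V : {vspace 'M[K]_n}) (hypV : hyperplane V)
    (f : {linear subvs_of V -> subvs_of V}) (f_bij : bijective f)
    (f_GL : forall M : subvs_of V,
        vsval M \in unitmx -> vsval (f M) \in unitmx) :
  ~ exceptional V ->
  exists2 g : 'M[K]_n -> 'M[K]_n,
    frobenius g & forall M : subvs_of V, g (vsval M) = vsval (f M).
Proof.
move=> nex; have [A [A0 VE]] := hyperplane_form hypV.
have [N AN] : exists N, \tr (A *m N) = 1.
  have /subvPn[N _ NV] : ~~ (fullv <= V)%VS.
    by apply/negP => /dimvS; rewrite -hypV ltnn.
  rewrite VE in NV; exists ((\tr (A *m N))^-1 *: N).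
  by rewrite -scalemxAr linearZ /= mulVf.
(* Projection onto V along N. The extension of f that fixes N preserves tr (A M), and its
   injectivity follows from that of f. *)
pose pi M := M - \tr (A *m M) *: N.
have piV M : pi M \in V by rewrite VE mulmxBr -scalemxAr linearB linearZ /= AN mulr1 subrr.
have pi_id M : M \in V -> pi M = M by rewrite VE /pi => /eqP ->; rewrite scale0r subr0.
pose h M := vsval (f (vsproj V (pi M))) + \tr (A *m M) *: N.
have h_lin : linear h.
  move=> a X Y; have piD : pi (a *: X + Y) = a *: pi X + pi Y.
    rewrite /pi mulmxDr -scalemxAr mxtraceD mxtraceZ scalerDl scalerBr scalerA.
    by rewrite opprD addrACA.
  rewrite /h piD [vsproj V _]linearP [f _]linearP [vsval _]linearP /=.
  rewrite mulmxDr -scalemxAr mxtraceD mxtraceZ.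
  by rewrite scalerDl scalerDr scalerA addrACA.
pose F : {linear 'M[K]_n -> 'M[K]_n} := HB.pack h (GRing.isLinear.Build _ _ _ _ h h_lin).
have FV M : M \in V -> F M = vsval (f (vsproj V M)).
  move=> MV; rewrite /= /h pi_id //; move: MV; rewrite VE => /eqP ->.
  by rewrite scale0r addr0.
have FA M : \tr (A *m F M) = \tr (A *m M).
  rewrite /= /h mulmxDr -scalemxAr linearD linearZ /= AN mulr1.
  by have := subvsP (f (vsproj V (pi M))); rewrite VE => /eqP ->; rewrite add0r.
have Finj : injective F.
  move=> X Y /eqP; rewrite -subr_eq0 -linearB => /eqP F0.
  have XYV : X - Y \in V by rewrite VE -FA F0 mulmx0 mxtrace0.
  apply/eqP; rewrite -subr_eq0 -(vsprojK XYV); move: F0; rewrite FV // => f0.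
  have /(bij_inj f_bij) -> : f (vsproj V (X - Y)) = f 0.
    by apply: val_inj; rewrite linear0 /= f0.
  by rewrite linear0.
have FP : preserver A F.
  split=> // M /eqP; rewrite -VE => MV Mu; rewrite FV //; apply: f_GL.
  by rewrite vsprojK.
have [b [P [Q [Pu Qu PQ]]]] := preserver_frobenius n_gt0 A0 VE nex FP.
exists (fun M => P *m trmx_if b M *m Q).
  by exists P, Q; split=> //; case: b {PQ}; [right|left].
move=> M; rewrite -PQ ?FV ?subvsP //; last by apply/eqP; rewrite -VE subvsP.
by rewrite vsvalK.
Qed.
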